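(* Let $\Phi\in\mathcal{L}_2^*$ be arbitrary, i.e. $\Phi=\{\Phi(x)\}_{x\in\mathbb{R}}$ is a predictable process with $\mathbb{E}\int_{\mathbb{R}}|\Phi(x)|^2dx<\infty$. Define $V_\Phi(x,z)=\Phi(x)z$ for all $x\in\mathbb{R}$ and $z\in\mathbb{R}_0$. Then $V_\Phi\in\mathrm{dom}(\delta)$ and $\delta(V_\Phi)=I(\Phi)$.
   Context: Let $\mathbb{R}_0=\mathbb{R}\setminus\{0\}$, endowed with the distance $d(x,y)=|x^{-1}-y^{-1}|$, and let $\mathcal{B}_b(\mathbb{R})$, $\mathcal{B}_b(\mathbb{R}_0)$ be the classes of bounded Borel sets (bounded subsets of $\mathbb{R}_0$ are those bounded away from $0$). Let $\nu$ be a measure on $\mathbb{R}_0$ with $m_2=\int_{\mathbb{R}_0}z^2\nu(dz)<\infty$. Let $N$ be a Poisson random measure on $\mathbf{Z}=\mathbb{R}\times\mathbb{R}_0$ (with Borel $\sigma$-field $\mathcal{Z}$) with intensity $\mathfrak{m}(dx,dz)=dx\,\nu(dz)$ on a complete probability space $(\Omega,\mathcal{F},\mathbb{P})$, and $\widehat N=N-\mathfrak{m}$. Set $L(A)=\int_{A\times\mathbb{R}_0}z\,\widehat N(dx,dz)$ for $A\in\mathcal{B}_b(\mathbb{R})$ (usual $L^2$-integral with respect to $\widehat N$). Filtration: $\mathcal{F}_x=\sigma\{N([a,b]\times\Gamma):-\infty<a<b\le x,\ \Gamma\in\mathcal{B}_b(\mathbb{R}_0)\}\vee\mathcal{N}$,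 $x\in\mathbb{R}$, where $\mathcal{N}$ is the class of $\mathbb{P}$-negligible sets. Simple processes: $\mathcal{E}$ is the class of processes $X(x)=\sum_{i=1}^nY_i1_{(b_{i-1},b_i]}(x)$ with $-\infty<b_0<\dots<b_n<\infty$ and $Y_i$ bounded and $\mathcal{F}_{b_{i-1}}$-measurable. A process $\{X(x)\}_{x\in\mathbb{R}}$ is predictable if $(\omega,x)\mapsto X(\omega,x)$ is measurable with respect to the $\sigma$-field $\mathcal{P}=\sigma(\mathcal{E})$ on $\Omega\times\mathbb{R}$. Itô integral: for $X\in\mathcal{E}$ of the form $X(x)=\sum_{i=1}^nY_i1_{(b_{i-1},b_i]}(x)$, with $-\infty<b_0<\dots<b_n<\infty$ and $Y_i$ bounded and $\mathcal{F}_{b_{i-1}}$-measurable, and $K>0$, $I_K(X)=\sum_{i=1}^nY_iL((b_{i-1},b_i]\cap[-K,K])$. If $X$ is predictable with $[X]_{K,2}^2:=\mathbb{E}\int_{-K}^K|X(x)|^2dx<\infty$ for all $K>0$, then $I_K(X)$ is the $L^2(\Omega)$-limit of $I_K(X_m)$ for any simple processes $X_m$ with $[X_m-X]_{K,2}\to0$ for all $K>0$ (such a sequence exists and the limit does not depend on it). $\mathcal{L}_2^*$ is the set of predictable processes $X$ with $\mathbb{E}\int_{\mathbb{R}}|X(x)|^2dx<\infty$, and for $X\in\mathcal{L}_2^*$, $I(X)=\int_{\mathbb{R}}X(x)L(dx)$ is the $L^2(\Omega)$-limit of $I_K(X)$ as $K\to\infty$. Malliavin calculus: let $\mathcal{H}=L^2(\mathbf{Z},\mathcal{Z},\mathfrak{m})$,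 let $\mathcal{F}^N$ be the ($\mathbb{P}$-completed) $\sigma$-field generated by $N$, and let $L^2(\Omega)$ here denote the square-integrable $\mathcal{F}^N$-measurable random variables. Let $I_n$ be the multiple integral of order $n$ with respect to $\widehat N$. Every $F\in L^2(\Omega)$ has a chaos expansion $F=\mathbb{E}(F)+\sum_{n\ge1}I_n(f_n)$ with $f_n\in\mathcal{H}^{\odot n}$ (symmetric elements of $\mathcal{H}^{\otimes n}$). $\mathrm{dom}(D)$ is the set of such $F$ with $\sum_{n\ge1}n\,n!\,\|f_n\|_{\mathcal{H}^{\otimes n}}^2<\infty$, and for these the Malliavin derivative is $D_\xi F=\sum_{n\ge1}nI_{n-1}(f_n(\cdot,\xi))$, $\xi\in\mathbf{Z}$, an element of $L^2(\Omega;\mathcal{H})$. The Hitsuda–Skorohod integral $\delta:\mathrm{dom}(\delta)\to L^2(\Omega)$ is the adjoint of $D$: $\mathrm{dom}(\delta)$ is the set of $V\in L^2(\Omega;\mathcal{H})$ for which there is a constant $C_V>0$ with $|\mathbb{E}\langle DF,V\rangle_{\mathcal{H}}|\le C_V\|F\|_{L^2(\Omega)}$ for all $F\in\mathrm{dom}(D)$, and $\delta(V)$ is the element of $L^2(\Omega)$ determined by $\mathbb{E}\langle DF,V\rangle_{\mathcal{H}}=\mathbb{E}[F\delta(V)]$ for all $F\in\mathrm{dom}(D)$. *)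

(* Defs.v *)
From HB Require Import structures.
From mathcomp Require Import all_boot all_order all_algebra.
From mathcomp Require Import all_classical all_reals all_analysis.
From mathcomp Require Import perm measurable_realfun.

Set Implicit Arguments.
Unset Strict Implicit.
Unset Printing Implicit Defensive.
Import Order.TTheory GRing.Theory Num.Theory.
Import numFieldNormedType.Exports.
Local Open Scope classical_set_scope.
Local Open Scope ring_scope.

Lemma product_sigma_finite d1 d2 (T1 : measurableType d1)
    (T2 : measurableType d2) (R : realType)
    (m1 : {sigma_finite_measure set T1 -> \bar R})
    (m2 : {sigma_finite_measure set T2 -> \bar R}) :
  sigma_finite setT (m1 \x m2)%E.
Proof.
have /sigma_finiteP[F [TF ndF Foo]] := sigma_finiteT m1.
have /sigma_finiteP[G [TG ndG Goo]] := sigma_finiteT m2.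
exists (fun n => F n `*` G n).
  rewrite -setXTT TF TG predeqE => -[x y]; split.
    move=> [/= [n _ Fnx] [k _ Gky]]; exists (maxn n k) => //; split.
    - by move: x Fnx; exact/subsetPset/ndF/leq_maxl.
    - by move: y Gky; exact/subsetPset/ndG/leq_maxr.
  by move=> [n _ []/= ? ?]; split; exists n.
move=> k; have [? ?] := Foo k; have [? ?] := Goo k.
split; first exact: measurableX.
by rewrite product_measure1E// lte_mul_pinfty// ge0_fin_numE.
Qed.

Section punctured_line.
Context (R : realType).

Definition R0_carrier : Type := {z : R | z != 0}.
HB.instance Definition _ := Choice.on R0_carrier.
HB.instance Definition _ :=
  isPointed.Build R0_carrier (exist (fun z : R => z != 0) 1 (oner_neq0 R)).

Definition R0_val (z : R0_carrier) : R := sval z.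

(* The Borel sigma-field of (R_0, d) is the trace on R \ {0} of the one of R:
   z |-> 1/z is a homeomorphism of R \ {0} for the usual distance. *)
Definition R0 : Type :=
  g_sigma_algebra_preimageType (R0_val : R0_carrier -> measurableTypeR R).
HB.instance Definition _ := Measurable.on R0.

Definition R0_dist (x y : R0) : R := `|(R0_val x)^-1 - (R0_val y)^-1|.

Definition R0_bounded (A : set R0) : Prop :=
  exists M : R, forall x y, A x -> A y -> R0_dist x y <= M.

Definition second_moment (nu : {measure set R0 -> \bar R}) : \bar R :=
  (\int[nu]_z (R0_val z ^+ 2)%:E)%E.

Lemma measurable_R0_val : measurable_fun [set: R0] (R0_val : R0 -> R).
Proof. by move=> _ B mB; exists B. Qed.

(* The product measure dx nu(dz) needs nu to be sigma-finite, which follows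
   from the finiteness of its second moment. *)
Lemma second_moment_sigma_finite (nu : {measure set R0 -> \bar R}) :
  (second_moment nu < +oo)%E -> sigma_finite setT nu.
Proof.
move=> nu2.
pose sq (z : R0) : \bar R := (R0_val z ^+ 2)%:E.
have m2 : measurable_fun [set: R0] sq.
  apply/measurable_EFinP; apply: measurable_funX; exact: measurable_R0_val.
pose F (n : nat) := [set z : R0 | (n.+1%:R^-1%:E <= sq z)%E].
have mF n : measurable (F n).
  by rewrite -[F n]setTI; exact: emeasurable_fun_c_infty.
exists F.
  apply/esym; rewrite -subTset => z _.
  have z2 : 0 < R0_val z ^+ 2.
    by rewrite exprn_even_gt0//=; exact: (svalP z).
  exists (Num.truncn (R0_val z ^+ 2)^-1) => //=.
  rewrite /F/= lee_fin -[leRHS]invrK lef_pV2 ?posrE ?invr_gt0 ?ltr0n//.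
  by apply: ltW; exact: truncnS_gt.
move=> n; split => //.
have e0 : 0 < n.+1%:R^-1 :> R by rewrite invr_gt0.
have := @le_integral_comp_abse _ _ _ nu setT measurableT sq n.+1%:R^-1 idfun
  (@measurable_id _ _ _) (fun _ => id) (fun _ _ _ _ => id) m2 e0.
rewrite setTI (_ : [set x | _] = F n); last first.
  by apply/seteqP; split => z; rewrite /F/= ger0_norm ?sqr_ge0.
rewrite (eq_integral sq) => [le2|z _]; last by rewrite /= ger0_norm ?sqr_ge0.
rewrite ltey; apply/negP => /eqP Foo.
by move: le2; rewrite Foo gt0_muley ?lte_fin// leye_eq => /eqP sqoo; move: nu2;
  rewrite /second_moment sqoo.
Qed.

Definition levy_measure (nu : {measure set R0 -> \bar R})
  (nu2 : (second_moment nu < +oo)%E) : set R0 -> \bar R := nu.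

Section levy_measure_instances.
Variables (nu : {measure set R0 -> \bar R}) (nu2 : (second_moment nu < +oo)%E).
HB.instance Definition _ := Measure.on (levy_measure nu2).
HB.instance Definition _ :=
  Measure_isSigmaFinite.Build _ _ _ (levy_measure nu2)
    (second_moment_sigma_finite nu2).
End levy_measure_instances.

Definition intensity (nu : {measure set R0 -> \bar R})
    (nu2 : (second_moment nu < +oo)%E)
    : set (measurableTypeR R * R0)%type -> \bar R :=
  (@lebesgue_measure R \x levy_measure nu2)%E.

Section intensity_instances.
Variables (nu : {measure set R0 -> \bar R}) (nu2 : (second_moment nu < +oo)%E).
HB.instance Definition _ := Measure.on (intensity nu2).
HB.instance Definition _ :=
  Measure_isSigmaFinite.Build _ _ _ (intensity nu2)
    (product_sigma_finite (@lebesgue_measure R) (levy_measure nu2)).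
End intensity_instances.

End punctured_line.

Section L2.
Context d (T : measurableType d) (R : realType).
Variable mu : {measure set T -> \bar R}.

Definition L2 (f : T -> R) : Prop := f \in Lfun mu 2%:E.

Definition L2_norm (f : T -> R) : \bar R := 'N[mu]_2%:E [EFin \o f]%E.

Definition L2_cvg (u : nat -> T -> R) (f : T -> R) : Prop :=
  (fun k => L2_norm (u k \- f)) @ \oo --> 0%E.

End L2.

Definition measurable_wrt (T : pointedType) (R : realType) (G : set (set T))
    (X : T -> R) : Prop :=
  measurable_fun setT (X : g_sigma_algebraType G -> R).

Section power_measure.
Context d (Z : measurableType d) (R : realType).
Variable m : {sigma_finite_measure set Z -> \bar R}.

Definition tuple_rcons n (u : n.-tuple Z * Z) : n.+1.-tuple Z :=
  [tuple of rcons u.1 u.2].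

Definition tuple_unrcons n (t : n.+1.-tuple Z) : n.-tuple Z * Z :=
  ([tuple tnth t (widen_ord (leqnSn n) i) | i < n], tnth t ord_max).

Lemma tuple_rconsK n : cancel (@tuple_rcons n) (@tuple_unrcons n).
Proof.
move=> [t z]; rewrite /tuple_unrcons /tuple_rcons /=; congr (_, _).
  apply: eq_from_tnth => i; rewrite tnth_mktuple !(tnth_nth z)/= nth_rcons.
  by rewrite size_tuple ltn_ord.
by rewrite (tnth_nth z)/= nth_rcons size_tuple ltnn eqxx.
Qed.

Lemma measurable_tuple_rcons n : measurable_fun setT (@tuple_rcons n).
Proof.
apply/measurable_fun_tnthP => i.
have [ltin|lein] := ltnP i n.
  rewrite (_ : _ \o _ = (fun t => tnth t (Ordinal ltin)) \o fst).
    by apply: measurableT_comp => //; exact: measurable_tnth.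
  apply/funext => -[t z] /=.
  by rewrite !(tnth_nth z)/= nth_rcons size_tuple ltin.
rewrite (_ : _ \o _ = snd); first exact: measurable_snd.
apply/funext => -[t z] /=; rewrite (tnth_nth z)/= nth_rcons size_tuple.
by rewrite ltnNge lein/= eqn_leq lein -ltnS ltn_ord.
Qed.

Lemma measurable_tuple_unrcons n : measurable_fun setT (@tuple_unrcons n).
Proof.
apply/measurable_fun_pair => /=; last exact: measurable_tnth.
apply/measurable_fun_tnthP => i.
rewrite (_ : _ \o _ = fun t => tnth t (widen_ord (leqnSn n) i)).
  exact: measurable_tnth.
by apply/funext => t /=; rewrite tnth_mktuple.
Qed.

Definition rcons_measure n (mu : {sigma_finite_measure set (n.-tuple Z) -> \bar R})
    : set (n.+1.-tuple Z) -> \bar R :=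
  pushforward (mu \x m)%E (@tuple_rcons n).

Section rcons_measure_instances.
Variables (n : nat) (mu : {sigma_finite_measure set (n.-tuple Z) -> \bar R}).

Let measurable_preimage (A : set (n.+1.-tuple Z)) :
  measurable A -> measurable (@tuple_rcons n @^-1` A).
Proof.
by move=> mA; rewrite -[X in measurable X]setTI; exact: measurable_tuple_rcons.
Qed.

Let rcons0 : rcons_measure mu set0 = 0%E.
Proof. by rewrite /rcons_measure /pushforward preimage_set0 measure0. Qed.

Let rcons_ge0 A : (0 <= rcons_measure mu A)%E.
Proof. by rewrite /rcons_measure /pushforward measure_ge0. Qed.

Let rcons_sigma_additive : semi_sigma_additive (rcons_measure mu).
Proof.
move=> F mF tF mUF; rewrite /rcons_measure /pushforward preimage_bigcup.
apply: measure_semi_sigma_additive.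
- by move=> k; exact: measurable_preimage.
- apply/trivIsetP => /= i j _ _ ij; rewrite -preimage_setI.
  by move/trivIsetP : tF => /(_ _ _ _ _ ij) ->//; rewrite preimage_set0.
- by rewrite -preimage_bigcup; exact: measurable_preimage.
Qed.

HB.instance Definition _ := isMeasure.Build _ _ _ (rcons_measure mu)
  rcons0 rcons_ge0 rcons_sigma_additive.

Let rcons_sigma_finite : sigma_finite setT (rcons_measure mu).
Proof.
have [F FT mF] := product_sigma_finite mu m.
exists (fun k => @tuple_unrcons n @^-1` F k).
  by rewrite -preimage_bigcup -FT preimage_setT.
move=> k; split.
  rewrite -[X in measurable X]setTI; apply: measurable_tuple_unrcons => //.
  by have [] := mF k.
rewrite /rcons_measure /pushforward -comp_preimage.
rewrite (_ : _ \o _ = idfun); first by have [] := mF k.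
by apply/funext => u; exact: tuple_rconsK.
Qed.

HB.instance Definition _ := Measure_isSigmaFinite.Build _ _ _
  (rcons_measure mu) rcons_sigma_finite.

End rcons_measure_instances.

Fixpoint power_measure n : {sigma_finite_measure set (n.-tuple Z) -> \bar R} :=
  match n with
  | 0 => [the {sigma_finite_measure set (0.-tuple Z) -> \bar R}
            of \d_([tuple] : 0.-tuple Z)]
  | n'.+1 => [the {sigma_finite_measure set (n'.+1.-tuple Z) -> \bar R}
                of rcons_measure (power_measure n')]
  end.

End power_measure.

Section poisson_malliavin.
Context d (Omega : measurableType d) d' (Z : measurableType d') (R : realType).
Variables (P : probability Omega R) (m : {sigma_finite_measure set Z -> \bar R}).
Variable N : R.-ker Omega ~> Z.

(* At rate 0, [poisson_prob] is the Dirac mass at 0 (unlike [poisson_pmf],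
   which is then constantly 1); its [nat] argument plays no role. *)
Record poisson_random_measure : Prop := PoissonRandomMeasure {
  prm_law : forall A, measurable A -> (m A < +oo)%E -> forall k : nat,
    P [set w | N w A = k%:R%:E] = poisson_prob (fine (m A)) 0%N [set k] ;
  prm_infinite : forall A, measurable A -> m A = +oo%E ->
    P [set w | N w A = +oo%E] = 1%E ;
  prm_independent : forall n (A : 'I_n -> set Z) (B : 'I_n -> set (\bar R)),
    (forall i, measurable (A i)) -> trivIset setT A ->
    (forall i, measurable (B i)) ->
    P (\bigcap_i [set w | B i (N w (A i))])
      = (\prod_(i < n) P [set w | B i (N w (A i))])%E }.

Definition compensated (A : set Z) (w : Omega) : R :=
  fine (N w A) - fine (m A).

(* Elementary functions of n variables, vanishing on the diagonals:
   sum of a_(i_1,...,i_n) 1_(A_(i_1) x ... x A_(i_n)) over n-tuples of indices,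
   with A_1, ..., A_k disjoint of finite measure and a_(i_1,...,i_n) = 0 as soon
   as two indices agree. *)
Record elementary (n : nat) := Elementary {
  el_size : nat ;
  el_set : 'I_el_size -> set Z ;
  el_coef : n.-tuple 'I_el_size -> R }.
Arguments el_set {n} e _ : rename.
Arguments el_coef {n} e _ : rename.

Definition is_elementary n (e : elementary n) : Prop :=
  [/\ forall i, measurable (el_set e i) /\ (m (el_set e i) < +oo)%E,
      trivIset setT (el_set e) &
      forall tau : n.-tuple 'I_(el_size e), ~~ uniq tau -> el_coef e tau = 0].

Definition elementary_fun n (e : elementary n) (t : n.-tuple Z) : R :=
  \sum_(tau : n.-tuple 'I_(el_size e))
    el_coef e tau * \prod_(j < n) \1_(el_set e (tnth tau j)) (tnth t j).

Definition elementary_integral n (e : elementary n) (w : Omega) : R :=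
  \sum_(tau : n.-tuple 'I_(el_size e))
    el_coef e tau * \prod_(j < n) compensated (el_set e (tnth tau j)) w.

(* Elements of the L^2 spaces are represented by functions, so I_n, L, D, delta,
   I_K and I are given by their graphs, as relations that are invariant under
   almost everywhere equality.
   Here, G is a version of I_n(f); for n = 0 this says that G is almost surely equal
   to the constant f. *)
Definition is_multiple_integral n (f : n.-tuple Z -> R) (G : Omega -> R) : Prop :=
  [/\ L2 (power_measure m n) f, L2 P G &
      exists e : nat -> elementary n,
        [/\ forall k, is_elementary (e k),
            L2_cvg (power_measure m n) (fun k => elementary_fun (e k)) f &
            L2_cvg P (fun k => elementary_integral (e k)) G]].

(* Generators of the completed sigma-field F^N; see [measurable_wrt]. *)
Definition noise_events : set (set Omega) :=
  [set E | exists A B, [/\ measurable A, measurable B &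
    E = (fun w => N w A) @^-1` B]] `|` P.-negligible.

Definition L2_noise (F : Omega -> R) : Prop :=
  L2 P F /\ measurable_wrt noise_events F.

(* L^2(Omega; H), identified with L^2(Omega x Z, F^N (x) Z, P (x) m) *)
Definition L2_noise_H (V : Omega * Z -> R) : Prop :=
  L2 (P \x m)%E V /\
  measurable_fun setT (V : (g_sigma_algebraType noise_events * Z)%type -> R).

Definition symmetric_kernel n (f : n.-tuple Z -> R) : Prop :=
  forall s : 'S_n,
    {ae power_measure m n, forall t, f [tuple tnth t (s i) | i < n] = f t}.

(* The kernel f n is only relevant for n >= 1. *)
Definition chaos_expansion (F : Omega -> R) (f : forall n, n.-tuple Z -> R)
    : Prop :=
  (forall n, (1 <= n)%N -> symmetric_kernel (f n)) /\
  exists J : nat -> Omega -> R,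
    (forall n, (1 <= n)%N -> is_multiple_integral (f n) (J n)) /\
    L2_cvg P (fun k w => fine 'E_P[F]%E + \sum_(1 <= n < k.+1) J n w) F.

Definition malliavin_summable (f : forall n, n.-tuple Z -> R) : Prop :=
  (\sum_(1 <= n <oo)
     (n * n`!)%:R%:E * L2_norm (power_measure m n) (f n) ^+ 2 < +oo)%E.

Definition dom_malliavin (F : Omega -> R) : Prop :=
  L2_noise F /\ exists2 f, chaos_expansion F f & malliavin_summable f.

(* U is a version of D F = sum_(n >= 1) n I_(n-1)(f_n(., xi)); below, W n is a
   version of (w, xi) |-> I_n(f_(n+1)(., xi))(w). *)
Definition is_malliavin (F : Omega -> R) (U : Omega * Z -> R) : Prop :=
  [/\ L2_noise F, L2_noise_H U &
      exists f (W : nat -> Omega * Z -> R),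
        [/\ chaos_expansion F f, malliavin_summable f,
            forall n, L2_noise_H (W n) /\
              {ae m, forall xi, is_multiple_integral
                 (fun t => f n.+1 (tuple_rcons (t, xi))) (fun w => W n (w, xi))} &
            L2_cvg (P \x m)%E
              (fun k u => \sum_(0 <= n < k) n.+1%:R * W n u) U]].

Definition expected_inner (U V : Omega * Z -> R) : \bar R :=
  (\int[P]_w \int[m]_xi (U (w, xi) * V (w, xi))%:E)%E.

Definition dom_skorohod (V : Omega * Z -> R) : Prop :=
  L2_noise_H V /\
  exists2 C : R, 0 < C &
    forall F U, dom_malliavin F -> is_malliavin F U ->
      (`|expected_inner U V| <= C%:E * L2_norm P F)%E.

(* G is a version of delta(V) *)
Definition is_skorohod (V : Omega * Z -> R) (G : Omega -> R) : Prop :=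
  [/\ dom_skorohod V, L2_noise G &
      forall F U, dom_malliavin F -> is_malliavin F U ->
        expected_inner U V = 'E_P[fun w => (F w * G w)%R]%E].

End poisson_malliavin.

Section ito.
Context d (Omega : measurableType d) (R : realType).
Variable P : probability Omega R.
Variables (nu : {measure set (R0 R) -> \bar R})
  (nu2 : (second_moment nu < +oo)%E).
Variable N : R.-ker Omega ~> (measurableTypeR R * R0 R)%type.

(* G is a version of L(A) *)
Definition is_levy_noise (A : set R) (G : Omega -> R) : Prop :=
  is_multiple_integral P (intensity nu2) N
    (fun t : 1.-tuple (measurableTypeR R * R0 R)%type =>
       \1_A (tnth t ord0).1 * R0_val (tnth t ord0).2) G.

(* Generators of F_x; see [measurable_wrt]. *)
Definition filtration_events (x : R) : set (set Omega) :=
  [set E | exists a b (Gamma : set (R0 R)) (B : set (\bar R)),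
    [/\ a < b, b <= x, measurable Gamma /\ R0_bounded Gamma, measurable B &
        E = (fun w => N w (`[a, b]%classic `*` Gamma)) @^-1` B]]
  `|` P.-negligible.

(* sum_(i < n) Y_i 1_(b_i, b_(i+1)]; only b_0, ..., b_n and Y_0, ..., Y_(n-1)
   are relevant. *)
Record simple_process := SimpleProcess {
  sp_size : nat ;
  sp_knot : nat -> R ;
  sp_coef : nat -> Omega -> R }.

Definition is_simple (s : simple_process) : Prop :=
  forall i, (i < sp_size s)%N ->
    [/\ sp_knot s i < sp_knot s i.+1,
        exists M : R, forall w, `|sp_coef s i w| <= M &
        measurable_wrt (filtration_events (sp_knot s i)) (sp_coef s i)].

Definition sp_cell (s : simple_process) (i : nat) : set R :=
  `]sp_knot s i, sp_knot s i.+1]%classic.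

Definition sp_fun (s : simple_process) (x : R) (w : Omega) : R :=
  \sum_(i < sp_size s) sp_coef s i w * \1_(sp_cell s i) x.

Definition predictable_events : set (set (Omega * measurableTypeR R)) :=
  [set E | exists s (B : set R), [/\ is_simple s, measurable B &
    E = (fun u : Omega * measurableTypeR R => sp_fun s u.2 u.1) @^-1` B]].

Definition predictable (X : R -> Omega -> R) : Prop :=
  measurable_wrt predictable_events
    (fun u : Omega * measurableTypeR R => X u.2 u.1).

(* The square of [X]_(K,2) *)
Definition sqnorm_on (K : R) (X : R -> Omega -> R) : \bar R :=
  (\int[P]_w \int[@lebesgue_measure R]_(x in `[(- K)%R, K]%classic)
     (`|X x w| ^+ 2)%:E)%E.

(* G is a version of I_K(s) *)
Definition is_simple_ito (K : R) (s : simple_process) (G : Omega -> R) : Prop :=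
  exists Ls : nat -> Omega -> R,
    (forall i, (i < sp_size s)%N ->
       is_levy_noise (sp_cell s i `&` `[- K, K]%classic) (Ls i)) /\
    forall w, G w = \sum_(i < sp_size s) sp_coef s i w * Ls i w.

Definition simple_approx (X : R -> Omega -> R) (s : nat -> simple_process)
    : Prop :=
  (forall k, is_simple (s k)) /\
  forall K : R, 0 < K ->
    (fun k => sqnorm_on K (fun x w => sp_fun (s k) x w - X x w)) @ \oo --> 0%E.

(* G is a version of I_K(X), for X predictable with [X]_(K,2) finite for all K *)
Definition is_ito_on (K : R) (X : R -> Omega -> R) (G : Omega -> R) : Prop :=
  [/\ L2 P G,
      exists s Gs, simple_approx X s /\ forall k, is_simple_ito K (s k) (Gs k) &
      forall s Gs, simple_approx X s ->
        (forall k, is_simple_ito K (s k) (Gs k)) -> L2_cvg P Gs G].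

Definition L2_predictable (X : R -> Omega -> R) : Prop :=
  predictable X /\
  (\int[P]_w \int[@lebesgue_measure R]_x (`|X x w| ^+ 2)%:E < +oo)%E.

(* G is a version of I(X), for X in L2_predictable *)
Definition is_ito (X : R -> Omega -> R) (G : Omega -> R) : Prop :=
  L2 P G /\
  exists J : R -> Omega -> R,
    (forall K, 0 < K -> is_ito_on K X (J K)) /\
    (fun K : R => L2_norm P (J K \- G)) @ +oo --> 0%E.

Definition lift_process (X : R -> Omega -> R)
    (u : Omega * (measurableTypeR R * R0 R)) : R :=
  X u.2.1 u.1 * R0_val u.2.2.

End ito.

(* Main.v *)
(* Let [Y] be bounded and measurable with respect to the noise on [S], let [g] vanish on [S],
   and let [f] be symmetric of order [n + 1].  Then the pairing of [I_(n+1)(f)] with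
   [Y I_1(g)] is [n + 1] times the pairing of [I_n(f(., xi))] with [Y g].  For elementary
   kernels this follows by splitting the cells of [g] along those of [f], using that the
   compensated noise of a cell disjoint from [S] is centred, has the mass of the cell as
   variance, and is independent of [Y]; the general case follows by L^2 approximation.
   With [S = {x <= b_(i-1)}] and [g = 1_(b_(i-1), b_i] z], this is the duality between [D] and
   [delta] for simple processes, and [n = 0] is the Ito isometry.  Both pass to L^2 limits, and
   simple processes are dense among the predictable ones, so [I(Phi)] and [V_Phi] are limits
   along the same simple processes; since [E (I(Phi)) = 0], summing over the chaos expansion of
   [F] gives [E <DF, V_Phi> = E (F I(Phi))]. *)
Require Import Defs.
From HB Require Import structures.
From mathcomp Require Import all_boot all_order all_algebra.
From mathcomp Require Import all_classical all_reals all_analysis.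
From mathcomp Require Import perm measurable_realfun ring lra.
Set Implicit Arguments.
Unset Strict Implicit.
Unset Printing Implicit Defensive.
Import Order.TTheory GRing.Theory Num.Theory.
Import numFieldNormedType.Exports.
Local Open Scope classical_set_scope.
Local Open Scope ring_scope.

(** * The inner product of square-integrable functions *)

(** The elementary kernels approximating a symmetric [f] need not be symmetric. Before the limit,
    the duality is therefore a sum over the position of the variable that meets the noise of the
    cell; a transposition moves this position to the end, and the symmetry of [f] enters only in the
    limit, where the n + 1 terms agree. The axioms of a Poisson random measure speak of finitely
    many disjoint sets, while the coefficients of a process depend on all the noise of the past:
    independence has to be extended to the completed sigma-fields of disjoint regions. Coefficients
    are bounded, which keeps their products with integrals in L^2. All integrals are relations, so
    the existence of versions is part of the work and rests on the completeness of L^2; the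
    negligible sets among the generators make measurability survive L^2 limits. The isometry, the
    zero mean, the measurability and the duality of the Ito integral are stated for the L^2 closure
    of the graph of the simple integral, which contains I_K(Phi) and I(Phi) with their
    integrands. *)

Section L2_space.
Context d (T : measurableType d) (R : realType) (mu : {measure set T -> \bar R}).
Implicit Types f g h : T -> R.

(** [fine] sends an infinite integral to 0, hence the [L2] hypotheses in the linearity laws.
    Functions are not quotiented: [ip_ae] replaces them by versions. *)
Definition ip f g : R := Rintegral mu setT (fun x => f x * g x).
(** L^2 convergence is expressed with squared norms, so that square roots occur only next to the
    Cauchy-Schwarz inequality and [L2_norm]. *)
Definition sqn f : R := ip f f.

Lemma L2P f : L2 mu f <->
  measurable_fun setT f /\ mu.-integrable setT (fun x => (f x ^+ 2)%:E).
Proof.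
split=> [fL|[mf intf]].
  split; last exact: Lfun2_integrable_sqr.
  by move: fL; rewrite /L2 inE => /andP[]; rewrite inE.
rewrite /L2 inE; apply/andP; split; rewrite inE//= /finite_norm unlock /Lnorm.
rewrite poweR_lty//; move/integrableP : intf => [_].
apply: le_lt_trans; rewrite le_eqVlt; apply/orP; left; apply/eqP.
apply: eq_integral => x _ /=.
rewrite powR_mulrn// -normrX ger0_norm ?sqr_ge0//.
Qed.

Lemma L2_measurable f : L2 mu f -> measurable_fun setT f.
Proof. by case/L2P. Qed.

Lemma L2_integrableM f g : L2 mu f -> L2 mu g ->
  mu.-integrable setT (EFin \o (fun x => f x * g x)).
Proof. by move=> fL gL; apply/Lfun1_integrable; exact: Lfun2_mul_Lfun1. Qed.

Lemma le_L2 f g : measurable_fun setT f -> L2 mu g ->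
  (forall x, `|f x| <= `|g x|) -> L2 mu f.
Proof.
move=> mf /L2P[mg ig] fg; apply/L2P; split=> //.
apply: le_integrable ig => //.
  by apply/measurable_EFinP; exact: measurable_funX.
move=> x _ /=; rewrite lee_fin !normrX.
by rewrite ler_pXn2r// nnegrE.
Qed.

Lemma L2D f g : L2 mu f -> L2 mu g -> L2 mu (f \+ g).
Proof.
move=> fL gL; have /L2P[mf jf] := fL; have /L2P[mg jg] := gL; apply/L2P; split.
  exact: measurable_funD.
have ij : mu.-integrable setT (fun x => (2 * f x ^+ 2 + 2 * g x ^+ 2)%:E).
  have -> : (fun x => (2 * f x ^+ 2 + 2 * g x ^+ 2)%:E) =
      ((fun x => 2%:E * (f x ^+ 2)%:E) \+ (fun x => 2%:E * (g x ^+ 2)%:E))%E.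
    by apply/funext => x /=; rewrite EFinD !EFinM.
  by apply: integrableD => //; exact: integrableZl.
apply: le_integrable ij => //.
  by apply/measurable_EFinP/measurable_funX/measurable_funD.
move=> x _ /=; rewrite lee_fin ger0_norm ?sqr_ge0//.
rewrite ger0_norm; last by rewrite addr_ge0// mulr_ge0// sqr_ge0.
by have := sqr_ge0 (f x - g x); rewrite /=; nra.
Qed.

Lemma L2Z (c : R) f : L2 mu f -> L2 mu (fun x => c * f x).
Proof.
move=> /L2P[mf jf]; apply/L2P; split; first exact: measurable_funM.
have -> : (fun x => ((c * f x) ^+ 2)%:E) = (fun x => (c ^+ 2)%:E * (f x ^+ 2)%:E)%E.
  by apply/funext => x; rewrite exprMn EFinM.
exact: integrableZl.
Qed.

Lemma L2B f g : L2 mu f -> L2 mu g -> L2 mu (f \- g).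
Proof.
move=> fL gL; have -> : f \- g = f \+ (fun x => -1 * g x).
  by apply/funext => x /=; rewrite mulN1r.
by apply: L2D => //; exact: L2Z.
Qed.

Lemma L2_0 : L2 mu (fun=> 0).
Proof.
apply/L2P; split=> //.
by under eq_fun do rewrite expr0n/=; exact: integrable0.
Qed.

Lemma L2_sum (I : Type) (s : seq I) (p : pred I) (F : I -> T -> R) :
  (forall i, p i -> L2 mu (F i)) -> L2 mu (fun x => \sum_(i <- s | p i) F i x).
Proof.
move=> LF; elim: s => [|i s ih].
  by under eq_fun do rewrite big_nil; exact: L2_0.
under eq_fun do rewrite big_cons.
by case pi: (p i) => //; apply: L2D => //; exact: LF.
Qed.

Lemma L2_boundedM (M : R) f g : measurable_fun setT f -> (forall x, `|f x| <= M) ->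
  L2 mu g -> L2 mu (fun x => f x * g x).
Proof.
move=> mf fM gL; apply: (le_L2 _ (L2Z M gL)).
  by apply: measurable_funM => //; exact: L2_measurable.
move=> x; rewrite !normrM ler_pM//.
by rewrite (le_trans (fM x))// ler_norm.
Qed.

Lemma ipE f g : L2 mu f -> L2 mu g -> (ip f g)%:E = (\int[mu]_x (f x * g x)%:E)%E.
Proof.
by move=> fL gL; rewrite /ip /Rintegral fineK// integrable_fin_num//; exact: L2_integrableM.
Qed.

Lemma eq_ip f g f' g' : f =1 f' -> g =1 g' -> ip f g = ip f' g'.
Proof. by move=> /funext -> /funext ->. Qed.

Lemma ip_ae f g f' g' : L2 mu f -> L2 mu g -> L2 mu f' -> L2 mu g' ->
  {ae mu, forall x, f x = f' x} -> {ae mu, forall x, g x = g' x} ->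
  ip f g = ip f' g'.
Proof.
move=> fL gL fL' gL' ff gg; rewrite /ip /Rintegral; congr fine.
apply: ae_eq_integral => //.
- by apply/measurable_EFinP/measurable_funM; exact: L2_measurable.
- by apply/measurable_EFinP/measurable_funM; exact: L2_measurable.
- by apply: filterS2 ff gg => x -> -> _.
Qed.

Lemma ipC f g : ip f g = ip g f.
Proof. by rewrite /ip; apply: eq_Rintegral => x _; rewrite mulrC. Qed.

Lemma ip0l f : ip (fun=> 0) f = 0.
Proof. by rewrite /ip /Rintegral; under eq_integral do rewrite mul0r; rewrite integral0. Qed.

Lemma ipDl f g h : L2 mu f -> L2 mu g -> L2 mu h -> ip (f \+ g) h = ip f h + ip g h.
Proof.
move=> fL gL hL; rewrite /ip -RintegralD//; try exact: L2_integrableM.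
by apply: eq_Rintegral => x _ /=; rewrite mulrDl.
Qed.

Lemma ipZl c f h : L2 mu f -> L2 mu h -> ip (fun x => c * f x) h = c * ip f h.
Proof.
move=> fL hL; rewrite /ip -RintegralZl//; last exact: L2_integrableM.
by apply: eq_Rintegral => x _; rewrite mulrA.
Qed.

Lemma ipBl f g h : L2 mu f -> L2 mu g -> L2 mu h -> ip (f \- g) h = ip f h - ip g h.
Proof.
move=> fL gL hL; rewrite /ip -RintegralB//; try exact: L2_integrableM.
by apply: eq_Rintegral => x _ /=; rewrite mulrBl.
Qed.

Lemma ipBr f g h : L2 mu f -> L2 mu g -> L2 mu h -> ip h (f \- g) = ip h f - ip h g.
Proof. by move=> fL gL hL; rewrite ipC ipBl// ![ip _ h]ipC. Qed.

Lemma ipZr c f h : L2 mu f -> L2 mu h -> ip h (fun x => c * f x) = c * ip h f.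
Proof. by move=> fL hL; rewrite ipC ipZl// [ip f h]ipC. Qed.

Lemma ip_suml (I : Type) (s : seq I) (p : pred I) (F : I -> T -> R) h :
  (forall i, p i -> L2 mu (F i)) -> L2 mu h ->
  ip (fun x => \sum_(i <- s | p i) F i x) h = \sum_(i <- s | p i) ip (F i) h.
Proof.
move=> LF hL; elim: s => [|i s ih].
  rewrite big_nil (@eq_ip _ _ (fun x => 0 * h x) h)//; last first.
    by move=> x; rewrite big_nil mul0r.
  by rewrite ipZl ?mul0r.
rewrite big_cons; case: ifPn => pi.
  rewrite -ih -ipDl//; [|exact: LF|exact: L2_sum].
  by apply: eq_ip => // x; rewrite big_cons pi.
by rewrite -ih; apply: eq_ip => // x; rewrite big_cons (negbTE pi).
Qed.

Lemma sqn_ge0 f : 0 <= sqn f.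
Proof. by apply: Rintegral_ge0 => x _; rewrite -expr2 sqr_ge0. Qed.

Lemma sqnE f : L2 mu f -> (sqn f)%:E = (\int[mu]_x (f x ^+ 2)%:E)%E.
Proof. by move=> fL; rewrite /sqn ipE//; apply: eq_integral => x _; rewrite expr2. Qed.

Lemma sqn0 : sqn (fun=> 0) = 0.
Proof. by apply: EFin_inj; rewrite sqnE ?integral0_eq//; [move=> x _; rewrite expr0n|exact: L2_0]. Qed.

Lemma sqn_diag f : sqn (f \- f) = 0.
Proof.
rewrite (_ : f \- f = fun=> 0) ?sqn0//.
by apply/funext => x /=; rewrite subrr.
Qed.

Lemma sqnB f g : L2 mu f -> L2 mu g -> sqn (f \- g) = sqn f - 2 * ip f g + sqn g.
Proof.
move=> fL gL; have fgL := L2B fL gL; rewrite /sqn ipBl// ipC [ip g _]ipC !ipBl//.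
by rewrite [ip g f]ipC; ring.
Qed.

Lemma sqnBC f g : sqn (f \- g) = sqn (g \- f).
Proof.
by rewrite /sqn /ip; apply: eq_Rintegral => x _ /=; ring.
Qed.

Lemma sqnZ c f : L2 mu f -> sqn (fun x => c * f x) = c ^+ 2 * sqn f.
Proof.
move=> fL; rewrite /sqn ipZl//; last exact: L2Z.
by rewrite ipC ipZl// mulrA.
Qed.

Lemma sqn_le f g : L2 mu f -> L2 mu g -> (forall x, `|f x| <= `|g x|) ->
  sqn f <= sqn g.
Proof.
move=> fL gL fg; apply: le_Rintegral => //; try exact: L2_integrableM.
move=> x _; rewrite -!expr2 -(real_normK (num_real (f x))).
by rewrite -(real_normK (num_real (g x))) ler_pXn2r// nnegrE.
Qed.

(** Pointwise (a + b)^2 <= 2 a^2 + 2 b^2. The factors 2 are absorbed by the choice of epsilon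
    wherever a triangle inequality is used. *)
Lemma sqn_tri f g h : L2 mu f -> L2 mu g -> L2 mu h ->
  sqn (f \- h) <= 2 * sqn (f \- g) + 2 * sqn (g \- h).
Proof.
move=> fL gL hL; rewrite -!RintegralZl//; last first.
  by apply: L2_integrableM; exact: L2B.
  by apply: L2_integrableM; exact: L2B.
rewrite -RintegralD//; last first.
- have := L2_integrableM (L2Z 2 (L2B gL hL)) (L2B gL hL).
  by apply: eq_integrable => // x _ /=; rewrite mulrA.
- have := L2_integrableM (L2Z 2 (L2B fL gL)) (L2B fL gL).
  by apply: eq_integrable => // x _ /=; rewrite mulrA.
apply: le_Rintegral => //.
- by apply: L2_integrableM; exact: L2B.
- have -> : EFin \o (fun x => 2 * ((f \- g) x * (f \- g) x) + 2 * ((g \- h) x * (g \- h) x)) =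
     ((EFin \o (fun x => (2 * (f \- g) x) * (f \- g) x)%R) \+ (EFin \o (fun x => (2 * (g \- h) x) * (g \- h) x)%R))%E.
    by apply/funext => x /=; rewrite !mulrA.
  by apply: integrableD => //; apply: L2_integrableM; try apply: L2Z; exact: L2B.
move=> x _ /=.
by have := sqr_ge0 (f x - g x - (g x - h x)); nra.
Qed.

(** The squared norm of f - t g is a polynomial in t that is nowhere negative. *)
Lemma cauchy_schwarz f g : L2 mu f -> L2 mu g -> ip f g ^+ 2 <= sqn f * sqn g.
Proof.
move=> fL gL.
have H t : 0 <= sqn f - 2 * t * ip f g + t ^+ 2 * sqn g.
  have := sqn_ge0 (f \- (fun x => t * g x)).
  rewrite sqnB//; last exact: L2Z.
  by rewrite sqnZ// [ip f _]ipC ipZl// [ip g f]ipC mulrA.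
have := sqn_ge0 g; rewrite le_eqVlt => /predU1P[g0|g0].
  rewrite -g0 mulr0; have [->|b0] := eqVneq (ip f g) 0; first by rewrite expr0n.
  (* The polynomial is affine with nonzero slope here, and this t would give it the value -1. *)
  have := H ((sqn f + 1) / (2 * ip f g)); rewrite -g0 mulr0 addr0.
  have -> : 2 * ((sqn f + 1) / (2 * ip f g)) * ip f g = sqn f + 1 by field.
  lra.
(* The minimiser of the polynomial. *)
have := H (ip f g / sqn g).
rewrite -(pmulr_lge0 _ g0) => {}H.
have -> : sqn f * sqn g = ip f g ^+ 2 +
  (sqn f - 2 * (ip f g / sqn g) * ip f g + (ip f g / sqn g) ^+ 2 * sqn g) * sqn g.
  by field; rewrite gt_eqF.
by rewrite lerDl.
Qed.

Lemma ip_le_norm f g : L2 mu f -> L2 mu g ->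
  `|ip f g| <= Num.sqrt (sqn f) * Num.sqrt (sqn g).
Proof.
move=> fL gL; rewrite -sqrtrM ?sqn_ge0// -sqrtr_sqr ler_wsqrtr//.
exact: cauchy_schwarz.
Qed.

Lemma L2_normE f : L2 mu f -> L2_norm mu f = (Num.sqrt (sqn f))%:E.
Proof.
move=> fL; rewrite /L2_norm unlock /Lnorm.
have -> : (\int[mu]_x `|(EFin \o f) x| `^ 2)%E = (sqn f)%:E.
  rewrite sqnE//; apply: eq_integral => x _ /=.
  by rewrite powR_mulrn// real_normK ?num_real.
by rewrite poweR_EFin powR12_sqrt ?sqn_ge0.
Qed.

Section filter.
Context (I : Type) (F : set_system I) {FF : Filter F}.

Lemma L2_normP (u : I -> T -> R) : (forall i, L2 mu (u i)) ->
  ((fun i => L2_norm mu (u i)) @ F --> 0%E) <-> (sqn (u i) @[i --> F] --> 0).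
Proof.
move=> uL; under eq_fun do rewrite L2_normE//.
split=> [/fine_cvgP[_ h0]|h].
  have h : Num.sqrt (sqn (u i)) @[i --> F] --> 0 := h0.
  have -> : (fun i => sqn (u i)) =
      (fun i => Num.sqrt (sqn (u i)) * Num.sqrt (sqn (u i))).
    by apply/funext => i; rewrite -expr2 sqr_sqrtr ?sqn_ge0.
  by rewrite -[X in _ --> X](mulr0 0); apply: cvgM.
apply: cvg_EFin; first exact: nearW.
by rewrite -(sqrtr0 R); apply: continuous_cvg => //; exact: sqrt_continuous.
Qed.

(** Expanded around the limits, the difference is a sum of three pairings, each with a factor that
    tends to 0; Cauchy-Schwarz bounds them. *)
Lemma ip_cvg (u v : I -> T -> R) f g :
  (forall i, L2 mu (u i)) -> (forall i, L2 mu (v i)) -> L2 mu f -> L2 mu g ->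
  sqn (u i \- f) @[i --> F] --> 0 -> sqn (v i \- g) @[i --> F] --> 0 ->
  ip (u i) (v i) @[i --> F] --> ip f g.
Proof.
move=> uL vL fL gL uf vg.
have sq0 (w : I -> R) : w i @[i --> F] --> 0 -> Num.sqrt (w i) @[i --> F] --> 0.
  by move=> w0; rewrite -(sqrtr0 R); apply: continuous_cvg => //; exact: sqrt_continuous.
have H (i : I) : `|ip (u i) (v i) - ip f g| <=
    Num.sqrt (sqn (u i \- f)) * Num.sqrt (sqn (v i \- g))
    + Num.sqrt (sqn (u i \- f)) * Num.sqrt (sqn g)
    + Num.sqrt (sqn f) * Num.sqrt (sqn (v i \- g)).
  have -> : ip (u i) (v i) - ip f g =
      ip (u i \- f) (v i \- g) + ip (u i \- f) g + ip f (v i \- g).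
    by rewrite !ipBl ?ipBr//; [ring|exact: L2B].
  rewrite (le_trans (ler_normD _ _))// lerD//; last by apply: ip_le_norm => //; exact: L2B.
  rewrite (le_trans (ler_normD _ _))// lerD//; apply: ip_le_norm => //; exact: L2B.
apply/cvgrPdist_le => e e0.
have : (Num.sqrt (sqn (u i \- f)) * Num.sqrt (sqn (v i \- g))
    + Num.sqrt (sqn (u i \- f)) * Num.sqrt (sqn g)
    + Num.sqrt (sqn f) * Num.sqrt (sqn (v i \- g))) @[i --> F] -->
    0 * 0 + 0 * Num.sqrt (sqn g) + Num.sqrt (sqn f) * 0.
  apply: cvgD; first apply: cvgD.
  - by apply: cvgM; exact: sq0.
  - by apply: cvgMr_tmp; exact: sq0.
  - by apply: cvgMl_tmp; exact: sq0.
rewrite !mul0r mulr0 !addr0 => /cvgrPdist_le/(_ _ e0).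
apply: filterS => i; rewrite sub0r normrN distrC => h.
by rewrite (le_trans (H i))// (le_trans _ h)// ler_norm.
Qed.

Lemma ip_cvgr (u : I -> T -> R) f g :
  (forall i, L2 mu (u i)) -> L2 mu f -> L2 mu g -> sqn (u i \- f) @[i --> F] --> 0 ->
  ip g (u i) @[i --> F] --> ip g f.
Proof.
move=> uL fL gL uf; apply: (ip_cvg (fun=> gL)) => //.
rewrite (_ : (fun=> _) = fun=> 0); first exact: cvg_cst.
by apply/funext => i; exact: sqn_diag.
Qed.

End filter.

(** The integral of the sum of 2^k (v k)^2 is at most the sum of 2^-k, so this weighted series is
    finite almost everywhere, and it controls the series of |v k|. Fast L^2 convergence thus yields
    convergence almost everywhere. *)
Lemma ae_summable (v : nat -> T -> R) : (forall k, L2 mu (v k)) ->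
  (forall k, sqn (v k) <= (4^-1) ^+ k) ->
  {ae mu, forall x, cvgn (series (fun k => `|v k x|))}.
Proof.
move=> vL v4.
pose F k x : \bar R := (2 ^+ k * v k x ^+ 2)%:E.
have mF k : measurable_fun setT (F k).
  by apply/measurable_EFinP; apply: measurable_funM => //; apply: measurable_funX; exact: L2_measurable.
have F0 k x : (0 <= F k x)%E by rewrite lee_fin mulr_ge0// sqr_ge0.
have mS : measurable_fun setT (fun x => \sum_(k <oo) F k x)%E.
  by apply: ge0_emeasurable_sum => // k x _ _; exact: F0.
have iF : (\int[mu]_x (\sum_(k <oo) F k x) < +oo)%E.
  rewrite integral_nneseries//.
  (* The bound is 2^-k, spelled as in [cvg_geometric_eseries_half]. *)
  have H k : (\int[mu]_x F k x <= (2 / (2 ^ (k + 1))%:R)%:E)%E.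
    rewrite (_ : \int[mu]_x F k x = (2 ^+ k * sqn (v k))%:E)%E; last first.
      rewrite EFinM sqnE// -ge0_integralZl_EFin//.
      - by move=> x _; rewrite lee_fin sqr_ge0.
      - by apply/measurable_EFinP; apply: measurable_funX; exact: L2_measurable.
    rewrite lee_fin -ler_pdivlMl ?exprn_gt0// (le_trans (v4 k))//.
    have -> : (2 ^ (k + 1))%:R = 2 * 2 ^+ k :> R by rewrite natrX addn1 exprS.
    have -> : 2 / (2 * 2 ^+ k) = 2 ^- k :> R by rewrite invfM mulrA divff// mul1r.
    by rewrite -exprVn -exprMn -invfM -natrM.
  apply: (@le_lt_trans _ _ (\sum_(k <oo) (2 / (2 ^ (k + 1))%:R)%:E)%E).
    apply: lee_nneseries => *; last exact: H.
    by apply: integral_ge0 => *; exact: F0.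
  have /cvg_lim := @cvg_geometric_eseries_half R 2 0.
  by rewrite /eseries => /(_ (@ereal_hausdorff R)) ->; rewrite ltry.
have /integrable_ae : mu.-integrable setT (fun x => \sum_(k <oo) F k x)%E.
  apply/integrableP; split => //; apply: le_lt_trans iF.
  rewrite le_eqVlt; apply/orP; left; apply/eqP; apply: eq_integral => x _.
  by rewrite gee0_abs//; exact: nneseries_ge0.
move=> /(_ measurableT); apply: filterS => x /(_ I) Sx.
have c2 : cvgn (series (fun k => (2^-1) ^+ k + 2 ^+ k * v k x ^+ 2 : R)).
  have -> : (fun k => (2^-1) ^+ k + 2 ^+ k * v k x ^+ 2 : R) =
     (geometric 1 2^-1) + (fun k => 2 ^+ k * v k x ^+ 2).
    apply/funext => k.
    transitivity (1 * 2^-1 ^+ k + 2 ^+ k * v k x ^+ 2); first by rewrite mul1r.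
    by [].
  apply: is_cvg_seriesD.
    by apply: is_cvg_geometric_series; rewrite gtr0_norm//; lra.
  apply: nondecreasing_is_cvgn.
    apply/nondecreasing_series => n _ _; by rewrite mulr_ge0// sqr_ge0.
  exists (fine (\sum_(k <oo) F k x)%E) => _ [n _ <-].
  rewrite -lee_fin fineK// /series/= -sumEFin.
  by apply: nneseries_lim_ge => k _ _; exact: F0.
(* AM-GM: |v k x| <= 2^-k + 2^k (v k x)^2 *)
apply: series_le_cvg c2 => // k.
  apply: addr_ge0; first by rewrite exprn_ge0// invr_ge0.
  by apply: mulr_ge0; [exact: exprn_ge0|exact: sqr_ge0].
have p0 := exprn_gt0 k (ltr0Sn R 1).
have h := sqr_ge0 (2 ^+ k * `|v k x| - 1).
have h2 := mulr_ge0 (ltW p0) (normr_ge0 (v k x)).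
rewrite exprVn -(ler_pM2l p0) mulrDr divff ?gt_eqF// -[v k x ^+ 2]real_normK ?num_real//.
by move: h h2; rewrite mulrA; nra.
Qed.

(** Riesz-Fischer: a subsequence whose consecutive squared distances are at most 4^-k converges
    almost everywhere, and Fatou's lemma turns the Cauchy bound into a bound on the distance to the
    limit. *)
Lemma L2_complete (u : nat -> T -> R) : (forall n, L2 mu (u n)) ->
  (forall e, 0 < e -> exists N, forall n m, (N <= n)%N -> (N <= m)%N ->
     sqn (u n \- u m) <= e) ->
  exists2 f, L2 mu f & sqn (u n \- f) @[n --> \oo] --> 0.
Proof.
move=> uL uC.
have /choice[M MP] k : exists N, forall n m, (N <= n)%N -> (N <= m)%N ->
     sqn (u n \- u m) <= 4^-1 ^+ k.
  by apply: uC; rewrite exprn_gt0.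
(* Partial sums of the thresholds are nondecreasing and still satisfy [M k <= s k]. *)
pose s k := (\sum_(i < k.+1) M i)%N.
have sS k : s k.+1 = (s k + M k.+1)%N by rewrite /s big_ord_recr.
have Ms k : (M k <= s k)%N by rewrite /s big_ord_recr/= leq_addl.
have s_nd i j : (i <= j)%N -> (s i <= s j)%N.
  elim: j => [|j ih]; first by rewrite leqn0 => /eqP ->.
  rewrite leq_eqVlt => /predU1P[->//|]; rewrite ltnS => /ih ij.
  by rewrite (leq_trans ij)// sS leq_addr.
have := @ae_summable (fun k => u (s k.+1) \- u (s k)) (fun k => L2B (uL _) (uL _)).
have h4 k : sqn (u (s k.+1) \- u (s k)) <= 4^-1 ^+ k.
  by apply: MP => //; rewrite (leq_trans (Ms k))// s_nd.
move=> /(_ h4)[A [mA A0 NA]].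
have cA x : ~ A x -> cvgn (fun k => u (s k) x).
  move=> nAx; have : cvgn (series (fun k => `|(u (s k.+1) \- u (s k)) x|)).
    by apply: contrapT => nc; apply: nAx; exact: NA.
  move=> /normed_cvg/= cs.
  have -> : (fun k => u (s k) x) = cst (u (s 0%N) x) +
      series (fun k => (u (s k.+1) \- u (s k)) x).
    apply/funext => k; rewrite fctE/= /series/= telescope_sumr//.
    by rewrite addrC subrK.
  by apply: is_cvgD => //; exact: is_cvg_cst.
(* Set to 0 on the exceptional null set, so that the limit exists at every point and is
   measurable. *)
pose g k x := u (s k) x * \1_(~` A) x.
have gL k : L2 mu (g k).
  apply: (le_L2 _ (uL (s k))).
    by apply: measurable_funM; [exact: L2_measurable|apply: measurable_indic; exact: measurableC].
  move=> x; rewrite /g normrM indicE; case: (_ \in _) => /=.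
    by rewrite normr1 mulr1.
  by rewrite normr0 mulr0.
pose f x := limn (fun k => g k x).
have gf x : g k x @[k --> \oo] --> f x.
  rewrite /f; apply/cvg_ex.
  have [Ax|nAx] := pselect (A x).
    have -> : (fun k => g k x) = cst 0.
      by apply/funext => k; rewrite /g indicE memNset ?mulr0//; apply.
    by exists 0; exact: cvg_cst.
  have -> : (fun k => g k x) = (fun k => u (s k) x).
    apply/funext => k; rewrite /g indicE mem_set ?mulr1//.
  by have /cvg_ex := cA _ nAx.
have mf : measurable_fun setT f.
  by apply: (measurable_fun_cvg (h := g)) => // k; exact: L2_measurable.
(* Fatou along the subsequence; the shift [K] is there because the Cauchy bound only holds from some
   index on. *)
have key e n K : (forall k, sqn (u n \- u (s (k + K)%N)) <= e) ->
    (\int[mu]_x ((u n x - f x) ^+ 2)%:E <= e%:E)%E.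
  move=> ue; pose h k x := ((u n x - g (k + K)%N x) ^+ 2)%:E.
  have mh k : measurable_fun setT (h k).
    by apply/measurable_EFinP/measurable_funX/measurable_funB; exact: L2_measurable.
  have hf x : limn_einf (h ^~ x) = ((u n x - f x) ^+ 2)%:E.
    apply: (cvg_limn_einf_sup _).1; apply: cvg_EFin; first exact: nearW.
    have c : (u n x - g (k + K)%N x) @[k --> \oo] --> u n x - f x.
      by apply: cvgB; [exact: cvg_cst|rewrite (cvg_shiftn K (g^~ x)); exact: gf].
    by rewrite expr2; apply: cvgM.
  have := fatou mu measurableT mh (fun k x _ => _).
  under eq_integral do rewrite hf.
  move=> H; apply: le_trans (H _) _; first by move=> k x; rewrite lee_fin sqr_ge0.
  rewrite limn_einf_lim; apply: lime_le; first exact: is_cvg_einfs.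
  apply: nearW => k; apply: (@le_trans _ _ (\int[mu]_x h k x)%E).
    by apply: ereal_inf_lbound; exists k => /=.
  apply: (@le_trans _ _ (sqn (u n \- u (s (k + K)%N)))%:E);
    last by rewrite lee_fin; exact: (ue k).
  rewrite sqnE; last exact: L2B.
  rewrite le_eqVlt; apply/orP; left; apply/eqP.
  apply: ae_eq_integral => //.
    by apply/measurable_EFinP/measurable_funX/measurable_funB; exact: L2_measurable.
  exists A; split => // x /= xn; apply: contrapT => nAx; apply: xn => _.
  by rewrite /h /g indicE mem_set// mulr1.
have key2 e n K : (forall k, sqn (u n \- u (s (k + K)%N)) <= e) -> L2 mu (u n \- f).
  move=> /key h; apply/L2P; split.
    by apply: measurable_funB => //; exact: L2_measurable.
  apply/integrableP; split.
    by apply/measurable_EFinP/measurable_funX/measurable_funB => //; exact: L2_measurable.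
  under eq_integral do rewrite /= ger0_norm ?sqr_ge0//.
  by apply: le_lt_trans h _; rewrite ltry.
have fL : L2 mu f.
  have Lf : L2 mu (u (M 0%N) \- f).
    apply: (@key2 1 _ 0%N) => k; rewrite addn0.
    apply: le_trans (MP 0%N _ _ _ _) _ => //.
    by rewrite (leq_trans (Ms 0%N))// s_nd.
  have -> : f = u (M 0%N) \- (u (M 0%N) \- f) by apply/funext => x /=; ring.
  exact: L2B.
exists f => //; apply/cvgrPdist_le => e e0.
have [j je] : exists j, 4^-1 ^+ j <= e.
  have : (@GRing.exp R 4^-1) @ \oo --> 0 by apply: cvg_expr; rewrite gtr0_norm; lra.
  move=> /cvgrPdist_le/(_ _ e0)[j _ /(_ j (leqnn j))]/=.
  by rewrite sub0r normrN ger0_norm//; exists j.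
exists (M j) => // n /= Mn; rewrite sub0r normrN ger0_norm ?sqn_ge0//.
rewrite -lee_fin sqnE//; last exact: L2B.
apply: (@key e n j) => k; apply: le_trans je.
by apply: MP => //; rewrite (leq_trans (Ms j))// s_nd// leq_addl.
Qed.

End L2_space.

(** * Measurability with respect to completed sigma-fields *)

Section measurable_wrt.
Context d (T : measurableType d) (R : realType) (mu : {measure set T -> \bar R}).
Variable G : set (set T).
Hypothesis nG : mu.-negligible `<=` G.

(** Subsets of a null set are negligible, hence generators: a change of [f] on a null set alters
    preimages by members of the sigma-field only. *)
Lemma measurable_wrt_ae (f g : T -> R) :
  measurable_wrt G f -> {ae mu, forall x, f x = g x} -> measurable_wrt G g.
Proof.
move=> mf [A [mA A0 fgA]] _ B mB; rewrite setTI.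
have GA C : C `<=` A -> <<s G >> C.
  by move=> CA; apply: sub_sigma_algebra; apply: nG; exists A.
have -> : g @^-1` B = (f @^-1` B `\` A) `|` (g @^-1` B `&` A).
  apply/seteqP; split => x /=.
    move=> gB; have [Ax|nAx] := pselect (A x); [by right|left; split => //].
    by rewrite (_ : f x = g x)//; apply: contrapT => h; apply: nAx; exact: fgA.
  by move=> [[fB nAx]|[]//]; rewrite -(_ : f x = g x)//; apply: contrapT => h;
    apply: nAx; exact: fgA.
apply: (@measurableU _ (g_sigma_algebraType G)); last first.
  by apply: GA => x [].
apply: (@measurableD _ (g_sigma_algebraType G)); last exact: GA.
by rewrite -[X in measurable X]setTI; exact: mf.
Qed.

(** A subsequence converges almost everywhere, and the exceptional null set belongs to the
    sigma-field. This carries noise measurability over to multiple integrals and Ito integrals. *)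
Lemma L2_cvg_measurable_wrt (u : nat -> T -> R) (f : T -> R) :
  (forall n, L2 mu (u n)) -> L2 mu f -> (forall n, measurable_wrt G (u n)) ->
  sqn mu (u n \- f) @[n --> \oo] --> 0 -> measurable_wrt G f.
Proof.
move=> uL fL um uf.
have /choice[s sP] k : exists n, sqn mu (u n \- f) <= 4^-1 ^+ k.
  have e0 : 0 < 4^-1 ^+ k :> R by rewrite exprn_gt0.
  move/cvgrPdist_le : uf => /(_ _ e0)[n _ /(_ n (leqnn n))]/=.
  by rewrite sub0r normrN ger0_norm ?sqn_ge0// => h; exists n.
have [A [mA A0 NA]] := ae_summable (fun k => L2B (uL (s k)) fL) sP.
have cA x : ~ A x -> u (s k) x @[k --> \oo] --> f x.
  move=> nAx; have : cvgn (series (fun k => `|(u (s k) \- f) x|)).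
    by apply: contrapT => nc; apply: nAx; exact: NA.
  move=> /cvg_series_cvg_0/cvgr0_norm_le h.
  apply/cvgrPdist_le => e e0.
  have := h _ e0; apply: filterS => k /=.
  by rewrite normr_id distrC.
have GA : <<s G >> (~` A).
  apply: (@measurableC _ (g_sigma_algebraType G)).
  by apply: sub_sigma_algebra; apply: nG; exists A; split.
pose g k x := u (s k) x * \1_(~` A) x.
have mg : measurable_wrt G (fun x => f x * \1_(~` A) x).
  apply: (@measurable_fun_cvg _ (g_sigma_algebraType G) R setT g) => [k|x _].
    apply: (@measurable_funM _ (g_sigma_algebraType G)); first exact: um.
    exact: (@measurable_indic _ (g_sigma_algebraType G)).
  have [Ax|nAx] := pselect (A x).
    rewrite indicE memNset ?mulr0; last by apply.
    have -> : g ^~ x = cst 0.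
      by apply/funext => k; rewrite /g indicE memNset ?mulr0//; apply.
    exact: cvg_cst.
  rewrite indicE mem_set// mulr1.
  have -> : g ^~ x = fun k => u (s k) x.
    by apply/funext => k; rewrite /g indicE mem_set// mulr1.
  exact: cA.
apply: (measurable_wrt_ae mg); exists A; split => // x /= h.
by apply: contrapT => nAx; apply: h; rewrite indicE mem_set// mulr1.
Qed.

End measurable_wrt.

Lemma measurable_wrt_sub (T : pointedType) (R : realType) (G G' : set (set T))
    (X : T -> R) : G `<=` <<s G' >> -> measurable_wrt G X -> measurable_wrt G' X.
Proof.
move=> GG' mX _ B mB; have := mX measurableT B mB.
by apply: smallest_sub => //; exact: smallest_sigma_algebra.
Qed.

Lemma measurable_wrt_measurable d (T : measurableType d) (R : realType)
    (G : set (set T)) (X : T -> R) :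
  G `<=` measurable -> measurable_wrt G X -> measurable_fun setT X.
Proof.
move=> GG' mX _ B mB; have := mX measurableT B mB.
by apply: smallest_sub => //; exact: sigma_algebra_measurable.
Qed.

(** * Independence of the noise on disjoint sets *)

Lemma measure_bigsetU_seq d (T : measurableType d) (R : realType)
    (mu : {measure set T -> \bar R}) (I : choiceType) (s : seq I) (p : pred I)
    (F : I -> set T) :
  uniq s -> (forall i, measurable (F i)) -> trivIset setT F ->
  mu (\big[setU/set0]_(i <- s | p i) F i) = (\sum_(i <- s | p i) mu (F i))%E.
Proof.
move=> us mF tF; elim: s us => [|i s ih]/=.
  by rewrite !big_nil measure0.
move=> /andP[is_ us]; rewrite !big_cons; case: ifPn => // pi; last exact: ih.
have mU : measurable (\big[setU/set0]_(j <- s | p j) F j) by apply: bigsetU_measurable.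
transitivity (mu (F i) + mu (\big[setU/set0]_(j <- s | p j) F j))%E; last first.
  by rewrite ih.
rewrite measureU//.
apply/seteqP; split => // x [Fix].
rewrite -bigcup_seq_cond => -[j /= /andP[js pj] Fjx].
have ij : i = j by apply: tF => //; exists x.
by move: is_; rewrite ij js.
Qed.

Section tensor.
Context d1 d2 (T1 : measurableType d1) (T2 : measurableType d2) (R : realType).
Variables (m1 : {sigma_finite_measure set T1 -> \bar R}) (m2 : {sigma_finite_measure set T2 -> \bar R}).

Lemma integral_tensor (X : T1 -> R) (Y : T2 -> R) :
  m1.-integrable setT (EFin \o X) -> m2.-integrable setT (EFin \o Y) ->
  (m1 \x m2)%E.-integrable setT (fun u => (X u.1 * Y u.2)%:E) /\
  Rintegral (m1 \x m2)%E setT (fun u => X u.1 * Y u.2) =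
    Rintegral m1 setT X * Rintegral m2 setT Y.
Proof.
move=> iX iY.
have mX : measurable_fun setT X by apply/measurable_EFinP; exact: measurable_int iX.
have mY : measurable_fun setT Y by apply/measurable_EFinP; exact: measurable_int iY.
have mXY : measurable_fun setT (fun u : T1 * T2 => (X u.1 * Y u.2)%:E).
  by apply/measurable_EFinP; apply: measurable_funM;
    [exact: (measurableT_comp mX)|exact: (measurableT_comp mY)].
have fabs d (T : measurableType d) (mu : {measure set T -> \bar R}) (Z : T -> R) :
    mu.-integrable setT (EFin \o Z) -> (\int[mu]_w `|Z w|%:E \is a fin_num)%E.
  move=> iZ; rewrite ge0_fin_numE; last by apply: integral_ge0.
  by case/integrableP : iZ.
have mabs d (T : measurableType d) (Z : T -> R) : measurable_fun setT Z ->
    measurable_fun setT (fun x => `|Z x|%:E).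
  by move=> mZ; apply/measurable_EFinP; exact: measurableT_comp.
have iXY : (m1 \x m2)%E.-integrable setT (fun u => (X u.1 * Y u.2)%:E).
  apply/integrable12ltyP => //=.
  under eq_integral => x _.
    under eq_integral => y _ do rewrite /= normrM EFinM.
    rewrite ge0_integralZl//; last exact: mabs.
    rewrite -(fineK (fabs _ _ _ _ iY)).
  over.
  rewrite ge0_integralZr//; [|exact: mabs|by rewrite lee_fin fine_ge0// integral_ge0].
  by rewrite -(fineK (fabs _ _ _ _ iX)) -EFinM ltry.
split => //; rewrite /Rintegral -integral12_prod_meas1// /fubini_F.
have fY := integrable_fin_num measurableT iY.
have fX := integrable_fin_num measurableT iX.
transitivity (fine (\int[m1]_x ((X x)%:E * \int[m2]_w (Y w)%:E)))%E.
  congr fine; apply: eq_integral => x _.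
  rewrite -(integralZl measurableT iY).
  by apply: eq_integral => y _; rewrite EFinM.
by rewrite -(fineK fY) integralZr//= fineM.
Qed.

Lemma L2_tensor (X : T1 -> R) (Y : T2 -> R) : L2 m1 X -> L2 m2 Y ->
  L2 (m1 \x m2)%E (fun u => X u.1 * Y u.2).
Proof.
move=> XL YL; have [i _] := integral_tensor (L2_integrableM XL XL) (L2_integrableM YL YL).
apply/L2P; split.
  by apply: measurable_funM; [apply: (measurableT_comp (L2_measurable XL))
    |apply: (measurableT_comp (L2_measurable YL))].
by apply: eq_integrable i => // u _ /=; congr EFin; ring.
Qed.

Lemma ip_tensor (X X' : T1 -> R) (Y Y' : T2 -> R) :
  L2 m1 X -> L2 m1 X' -> L2 m2 Y -> L2 m2 Y' ->
  ip (m1 \x m2)%E (fun u => X u.1 * Y u.2) (fun u => X' u.1 * Y' u.2) =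
  ip m1 X X' * ip m2 Y Y'.
Proof.
move=> XL XL' YL YL'.
have [_ <-] := integral_tensor (L2_integrableM XL XL') (L2_integrableM YL YL').
by apply: eq_Rintegral => u _; ring.
Qed.

End tensor.

Section independence.
Context d (T : measurableType d) (R : realType) (P : probability T R).

(** Both sides are finite measures in F that agree on a pi-system containing the whole space. *)
Lemma pi_system_indepl (G : set (set T)) (E : set T) :
  setI_closed G -> G setT -> G `<=` measurable -> measurable E ->
  (forall F, G F -> P (F `&` E) = P F * P E)%E ->
  forall F, <<s G >> F -> P (F `&` E) = (P F * P E)%E.
Proof.
move=> GI GT Gm mE GE F GF.
have k0 : 0 <= fine (P E) by rewrite fine_ge0.
suff : mrestr P mE F = mscale (NngNum k0) P F.
  by rewrite /mrestr /mscale /= fineK ?fin_num_measure// muleC.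
apply: (@g_sigma_algebra_measure_unique _ _ _ G Gm (fun=> setT) (fun=> GT)) GF => //.
- by rewrite bigcup_const//; exists 0%N.
- move=> A GA; rewrite /= /mrestr /mscale /= fineK ?fin_num_measure// muleC.
  exact: GE.
- by move=> _; rewrite /= /mrestr setTI (le_lt_trans (probability_le1 P mE))// ltry.
Qed.

(** [pi_system_indepl] is applied twice: with an event of the second sigma-field fixed, and then
    with a generator of the first one fixed. *)
Lemma pi_system_indep (G1 G2 : set (set T)) :
  setI_closed G1 -> G1 setT -> G1 `<=` measurable ->
  setI_closed G2 -> G2 setT -> G2 `<=` measurable ->
  (forall E1 E2, G1 E1 -> G2 E2 -> P (E1 `&` E2) = P E1 * P E2)%E ->
  forall E1 E2, <<s G1 >> E1 -> <<s G2 >> E2 -> P (E1 `&` E2) = (P E1 * P E2)%E.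
Proof.
move=> I1 T1 m1 I2 T2 m2 H E1 E2 GE1 GE2.
have mE2 : measurable E2.
  by apply: smallest_sub GE2 => //; exact: sigma_algebra_measurable.
apply: (@pi_system_indepl G1) => // F GF.
rewrite setIC muleC; apply: (@pi_system_indepl G2) => //; first exact: m1.
by move=> F' GF'; rewrite setIC muleC; exact: H.
Qed.

(** The joint law agrees with the product of the marginal laws on rectangles, hence everywhere;
    Fubini then factors the integral of the product of the coordinates. *)
Lemma indep_integral (X Y : T -> R) :
  P.-integrable setT (EFin \o X) -> P.-integrable setT (EFin \o Y) ->
  (forall A B, measurable A -> measurable B ->
    P (X @^-1` A `&` Y @^-1` B) = P (X @^-1` A) * P (Y @^-1` B))%E ->
  P.-integrable setT (EFin \o (fun w => X w * Y w)) /\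
  Rintegral P setT (fun w => X w * Y w) = Rintegral P setT X * Rintegral P setT Y.
Proof.
move=> iX iY XY.
have mX : measurable_fun setT X by apply/measurable_EFinP; exact: measurable_int iX.
have mY : measurable_fun setT Y by apply/measurable_EFinP; exact: measurable_int iY.
pose XY' w := (X w, Y w).
have mXY : measurable_fun setT XY' by apply/measurable_fun_pair.
pose PX := distribution P (mfun_Sub (mem_set mX)).
pose PY := distribution P (mfun_Sub (mem_set mY)).
pose PXY := distribution P (mfun_Sub (mem_set mXY)).
have E : forall S, measurable S -> (PX \x PY)%E S = PXY S.
  by apply: product_measure_unique => A B mA mB; rewrite /PXY/= /distribution /pushforward/= -XY.
pose f (z : R * R) : \bar R := (z.1 * z.2)%:E.
have EPXY : (\int[(PX \x PY)%E]_z f z = \int[PXY]_z f z)%E.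
  by apply: eq_measure_integral => A mA _; first [exact: E|exact/esym/E].
have integrable_dist Z (mZ : measurable_fun setT Z) : P.-integrable setT (EFin \o Z) ->
    (distribution P (mfun_Sub (mem_set mZ))).-integrable setT (EFin \o id).
  move=> /integrableP[_ Zoo]; apply/integrableP; split; first exact/measurable_EFinP.
  by rewrite ge0_integral_distribution//; exact/measurable_EFinP.
have integral_dist Z (mZ : measurable_fun setT Z) : P.-integrable setT (EFin \o Z) ->
    Rintegral (distribution P (mfun_Sub (mem_set mZ))) setT id = Rintegral P setT Z.
  move=> iZ; congr fine; rewrite (integral_distribution (f := EFin \o id))//.
    exact/measurable_EFinP.
have [iXY] := integral_tensor (integrable_dist _ mX iX) (integrable_dist _ mY iY).
rewrite !integral_dist// => EXY.
have iXY' : PXY.-integrable setT f.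
  have /integrableP[mf foo] := iXY; apply/integrableP; split => //.
  apply: le_lt_trans foo; rewrite le_eqVlt; apply/orP; left; apply/eqP.
  by apply: eq_measure_integral => A mA _; first [exact: E|exact/esym/E].
have mf : measurable_fun setT f by case/integrableP : iXY'.
have iP : P.-integrable setT (EFin \o (fun w => X w * Y w)).
  have /integrableP[_] := iXY'.
  rewrite ge0_integral_distribution//; last exact: measurableT_comp.
  move=> h; apply/integrableP; split => //.
  by apply/measurable_EFinP; exact: measurable_funM.
by split => //; rewrite -EXY; congr fine; rewrite EPXY integral_distribution.
Qed.

End independence.

Section noise.
Context d (Omega : measurableType d) d' (Z : measurableType d') (R : realType).
Variables (P : probability Omega R) (m : {sigma_finite_measure set Z -> \bar R}).
Variable N : R.-ker Omega ~> Z.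

Definition noise_on (S : set Z) : set (set Omega) :=
  [set E | exists A B, [/\ measurable A, A `<=` S, measurable B &
    E = (fun w => N w A) @^-1` B]] `|` P.-negligible.

Lemma noise_onS (S S' : set Z) : S `<=` S' -> noise_on S `<=` noise_on S'.
Proof.
move=> SS' E [[A [B [mA AS mB ->]]]|nE]; [left|by right].
by exists A, B; split => //; exact: subset_trans SS'.
Qed.

Hypothesis Pcomplete : measure_is_complete P.
Hypothesis prm : poisson_random_measure P m N.

Lemma noise_on_measurable S : noise_on S `<=` measurable.
Proof.
move=> E [[A [B [mA AS mB ->]]]|]; last exact: Pcomplete.
by rewrite -[X in measurable X]setTI; exact: (measurable_kernel N A mA).
Qed.

Lemma prm_independent_fin (I : finType) (A : I -> set Z) (B : I -> set (\bar R)) :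
  (forall i, measurable (A i)) -> trivIset setT A -> (forall i, measurable (B i)) ->
  P (\bigcap_i [set w | B i (N w (A i))]) = (\prod_i P [set w | B i (N w (A i))])%E.
Proof.
move=> mA tA mB.
have := @prm_independent _ _ _ _ _ _ _ _ prm #|I| (A \o enum_val) (B \o enum_val)
  (fun i => mA _) _ (fun i => mB _).
rewrite (reindex (@enum_val I predT)); last exact: onW_bij (enum_val_bij _).
move=> /= <-.
  congr (P _); apply/seteqP; split => w /= h i _; first exact: h.
  by rewrite -(enum_rankK i); exact: h.
move=> i j _ _ /= h; apply: enum_val_inj; exact: (tA _ _ Logic.I Logic.I h).
Qed.

Definition cylinders (I : finType) (D : I -> set Z) : set (set Omega) :=
  [set E | exists2 B : I -> set (\bar R), (forall i, measurable (B i)) &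
    E = \bigcap_i [set w | B i (N w (D i))]].

Lemma cylinders_setI_closed (I : finType) (D : I -> set Z) : setI_closed (cylinders D).
Proof.
move=> _ _ [B mB ->] [B' mB' ->]; exists (fun i => B i `&` B' i).
  by move=> i; exact: measurableI.
apply/seteqP; split => w /= h; first by move=> i _; split; apply h.
by split => i _; apply h.
Qed.

Lemma cylinders_setT (I : finType) (D : I -> set Z) : cylinders D setT.
Proof. by exists (fun=> setT) => //; apply/seteqP; split. Qed.

Lemma cylinders_measurable (I : finType) (D : I -> set Z) :
  (forall i, measurable (D i)) -> cylinders D `<=` measurable.
Proof.
move=> mD _ [B mB ->]; apply: fin_bigcap_measurable => // i _.
by rewrite -[X in measurable X]setTI; exact: (measurable_kernel N _ (mD i)).
Qed.

(** The two families together are still disjoint, so the product formula over the sum of the index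
    types splits into the two products. *)
Lemma cylinders_indep (I1 I2 : finType) (D1 : I1 -> set Z) (D2 : I2 -> set Z) :
  (forall i, measurable (D1 i)) -> trivIset setT D1 ->
  (forall i, measurable (D2 i)) -> trivIset setT D2 ->
  (forall i j, D1 i `&` D2 j = set0) ->
  forall E1 E2, <<s cylinders D1 >> E1 -> <<s cylinders D2 >> E2 ->
    P (E1 `&` E2) = (P E1 * P E2)%E.
Proof.
move=> mD1 tD1 mD2 tD2 D12; apply: pi_system_indep;
  try exact: cylinders_setI_closed; try exact: cylinders_setT;
  try exact: cylinders_measurable.
move=> _ _ [B1 mB1 ->] [B2 mB2 ->].
pose D (i : I1 + I2) := match i with inl j => D1 j | inr j => D2 j end.
pose B (i : I1 + I2) := match i with inl j => B1 j | inr j => B2 j end.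
have mD i : measurable (D i) by case: i => i /=.
have mB i : measurable (B i) by case: i => i /=.
have tD : trivIset setT D.
  move=> [i|i] [j|j] _ _ /=.
  - by move=> /(tD1 _ _ Logic.I Logic.I) ->.
  - by rewrite D12 => -[? []].
  - by rewrite setIC D12 => -[? []].
  - by move=> /(tD2 _ _ Logic.I Logic.I) ->.
have := prm_independent_fin mD tD mB.
rewrite big_sumType/= -!prm_independent_fin// => <-.
congr (P _); apply/seteqP; split => w /=.
  by move=> [h1 h2] [i|i] _ /=; [exact: h1|exact: h2].
by move=> h; split => i _; [exact: (h (inl i))|exact: (h (inr i))].
Qed.

Section atoms.
Variables (I : finType) (S : set Z) (A : I -> set Z).
Hypotheses (mS : measurable S) (mA : forall i, measurable (A i)) (AS : forall i, A i `<=` S).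

(** Counts of overlapping sets need not be independent. The atoms of the finite algebra generated by
    the [A i] inside [S] are disjoint; [c] records which of the [A i] contain the atom. *)
Definition atom (c : {set I}) : set Z :=
  S `&` \bigcap_i (if i \in c then A i else ~` A i).

Lemma measurable_atom c : measurable (atom c).
Proof.
apply: measurableI => //; apply: fin_bigcap_measurable => // i _.
by case: ifP => _; [|apply: measurableC].
Qed.

Lemma trivIset_atom : trivIset setT atom.
Proof.
move=> c c' _ _ [z [[_ h] [_ h']]]; apply/setP => i.
have := h i Logic.I; have := h' i Logic.I.
by case: (i \in c); case: (i \in c').
Qed.

Lemma bigcup_atom i : A i = \big[setU/set0]_(c : {set I} | i \in c) atom c.
Proof.
apply/seteqP; split => [z Az|z].
  rewrite -bigcup_seq_cond/=; exists [set j | `[< A j z >]]%SET => /=.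
    by rewrite mem_index_enum inE; apply/asboolP.
  split; first exact: AS Az.
  by move=> j _; rewrite inE; case: ifPn => /asboolP.
rewrite -bigcup_seq_cond/= => -[c /= /andP[_ ic]] [_ /(_ i Logic.I)].
by rewrite ic.
Qed.

Lemma kernel_atom w i : N w (A i) = (\sum_(c : {set I} | i \in c) N w (atom c))%E.
Proof.
rewrite {1}bigcup_atom measure_bigsetU_seq//.
- exact: index_enum_uniq.
- by move=> c; exact: measurable_atom.
- exact: trivIset_atom.
Qed.

(** Every count of an [A i] is a finite sum of counts of atoms, hence measurable with respect to the
    latter. *)
Lemma cylinders_atom (B : I -> set (\bar R)) : (forall i, measurable (B i)) ->
  <<s cylinders atom >> (\bigcap_i [set w | B i (N w (A i))]).
Proof.
move=> mB.
have mN c : measurable_fun setT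
    ((fun w => N w (atom c)) : g_sigma_algebraType (cylinders atom) -> \bar R).
  move=> _ C mC; rewrite setTI; apply: sub_sigma_algebra.
  exists (fun c' => if c' == c then C else setT).
    by move=> c'; case: ifP.
  apply/seteqP; split => w /=.
    by move=> Cw c' _; case: eqP => // ->.
  by move=> /(_ c Logic.I); rewrite eqxx.
apply: (@fin_bigcap_measurable _ (g_sigma_algebraType (cylinders atom))) => // i _.
rewrite [X in measurable X](_ : _ = (fun w => \sum_(c : {set I} | i \in c) N w (atom c))%E @^-1` B i).
  rewrite -[X in measurable X]setTI.
  suff : measurable_fun setT ((fun w => \sum_(c : {set I} | i \in c) N w (atom c))%E : g_sigma_algebraType (cylinders atom) -> \bar R).
    by apply.
  under eq_fun do rewrite big_mkcond/=.
  apply: (@emeasurable_sum _ (g_sigma_algebraType (cylinders atom))) => c.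
  by case ic: (i \in c) => //; exact: measurable_cst.
by apply/seteqP; split => w /=; rewrite kernel_atom.
Qed.

End atoms.

(** Finite intersections of count events, together with the negligible sets, form a pi-system
    containing the generators. The sets in such an intersection may overlap; cutting them into atoms
    gives two disjoint families, one inside each region. *)
Theorem noise_indep (S1 S2 : set Z) : measurable S1 -> measurable S2 -> S1 `&` S2 = set0 ->
  forall E1 E2, <<s noise_on S1 >> E1 -> <<s noise_on S2 >> E2 ->
    P (E1 `&` E2) = (P E1 * P E2)%E.
Proof.
move=> mS1 mS2 S12.
pose cyl S : set (set Omega) := [set E | exists (I : finType) (A : I -> set Z) (B : I -> set (\bar R)),
  [/\ forall i, measurable (A i), forall i, A i `<=` S, forall i, measurable (B i) &
      E = \bigcap_i [set w | B i (N w (A i))]]] `|` P.-negligible.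
have sub S : noise_on S `<=` cyl S.
  move=> E [[A [B [mA AS mB ->]]]|nE]; [left|by right].
  exists unit, (fun=> A), (fun=> B); split => //.
  by apply/seteqP; split => w /=; [move=> ? [] _|move=> h; exact: (h tt)].
have cylI S : setI_closed (cyl S).
  move=> E E' [cE|nE]; last first.
    by move=> _; right; apply: negligibleS nE => x [].
  move=> [cE'|nE]; last by right; apply: negligibleS nE => x [].
  case: cE => I [A [B [mA AS mB ->]]].
  case: cE' => I' [A' [B' [mA' AS' mB' ->]]]; left.
  exists (I + I')%type, (fun i => match i with inl j => A j | inr j => A' j end).
  exists (fun i => match i with inl j => B j | inr j => B' j end).
  split; try by case.
  apply/seteqP; split => w /=.
    by move=> [h1 h2] [i|i] _ /=; [exact: h1|exact: h2].
  by move=> h; split => i _; [exact: (h (inl i))|exact: (h (inr i))].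
have cylT S : cyl S setT.
  left; exists void, (fun=> set0), (fun=> set0); split; try by case.
  by apply/seteqP; split => w // _ [].
have cylm S : cyl S `<=` measurable.
  move=> E [[I [A [B [mA AS mB ->]]]]|]; last exact: Pcomplete.
  apply: fin_bigcap_measurable => // i _.
  by rewrite -[X in measurable X]setTI; exact: (measurable_kernel N _ (mA i)).
(* A negligible event is independent of every event. *)
have null E E' : P.-negligible E -> measurable E' -> P (E `&` E') = (P E * P E')%E.
  move=> nE mE'.
  have mE : measurable E by exact: Pcomplete.
  have -> : P E = 0%E by apply: measure_negligible.
  rewrite mul0e; apply: measure_negligible; first exact: measurableI.
  by apply: negligibleS nE => x [].
have main : forall E1 E2, <<s cyl S1 >> E1 -> <<s cyl S2 >> E2 ->
    P (E1 `&` E2) = (P E1 * P E2)%E.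
  apply: pi_system_indep => // E1 E2 [cE1|nE1] cE2; last by apply: null => //; exact: cylm cE2.
  case: cE2 => [cE2|nE2]; last first.
    by rewrite setIC muleC; apply: null => //; apply: (cylm S1); left.
  case: cE1 => I [A [B [mA AS mB ->]]].
  case: cE2 => I' [A' [B' [mA' AS' mB' ->]]].
  apply: (@cylinders_indep _ _ (atom S1 A) (atom S2 A')).
  - exact: measurable_atom.
  - exact: trivIset_atom.
  - exact: measurable_atom.
  - exact: trivIset_atom.
  - move=> i j; apply/seteqP; split => // z [[z1 _] [z2 _]].
    by rewrite -S12.
  - exact: cylinders_atom.
  - exact: cylinders_atom.
move=> E1 E2 h1 h2; apply: main.
  by apply: smallest_sub h1; [exact: smallest_sigma_algebra|move=> E /sub; exact: sub_sigma_algebra].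
by apply: smallest_sub h2; [exact: smallest_sigma_algebra|move=> E /sub; exact: sub_sigma_algebra].
Qed.

Lemma noise_indep_integral (S1 S2 : set Z) (X Y : Omega -> R) :
  measurable S1 -> measurable S2 -> S1 `&` S2 = set0 ->
  measurable_wrt (noise_on S1) X -> measurable_wrt (noise_on S2) Y ->
  P.-integrable setT (EFin \o X) -> P.-integrable setT (EFin \o Y) ->
  P.-integrable setT (EFin \o (fun w => X w * Y w)) /\
  Rintegral P setT (fun w => X w * Y w) = Rintegral P setT X * Rintegral P setT Y.
Proof.
move=> mS1 mS2 S12 mX mY iX iY; apply: indep_integral => // A B mA mB.
apply: (noise_indep mS1 mS2 S12).
  by have := mX measurableT A mA; rewrite setTI.
by have := mY measurableT B mB; rewrite setTI.
Qed.

End noise.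

(** * Moments of the compensated noise *)

Section poisson_moments.
Context (R : realType) (lam : R).
Hypothesis lam0 : 0 <= lam.
Let q (k : nat) : \bar R := poisson_prob lam 0%N [set k].

(** The ratio of consecutive Poisson weights, in a form that also covers rate 0, where the law is
    the Dirac mass at 0. Both moments follow from it by a shift of the index. *)
Lemma poisson_prob_rec k : (k.+1%:R%:E * q k.+1 = lam%:E * q k)%E.
Proof.
rewrite /q /poisson_prob; case: ifPn => lamp.
  rewrite !esum_set1 ?lee_fin ?poisson_pmf_ge0// -!EFinM /poisson_pmf lamp.
  congr EFin; rewrite factS natrM exprS.
  have : k`!%:R != 0 :> R by rewrite pnatr_eq0 -lt0n fact_gt0.
  have : k.+1%:R != 0 :> R by rewrite pnatr_eq0.
  move: (k.+1%:R) (k`!%:R) => a b a0 b0.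
  by field; rewrite a0 b0.
have -> : lam = 0 by apply/eqP; rewrite eq_le lam0 leNgt lamp.
by rewrite mul0e diracE memNset ?mule0.
Qed.

Lemma poisson_prob_total : (\sum_(k <oo) q k = 1)%E.
Proof.
rewrite -(@probability_setT _ _ _ (poisson_prob lam 0%N)).
have -> : [set: nat] = \bigcup_k [set k].
  by apply/seteqP; split => // k _; exists k.
rewrite measure_semi_bigcup// => i j _ _ [x [/= -> ->]].
by [].
Qed.

Lemma nneseries_shift (a : nat -> \bar R) : (forall k, 0 <= a k)%E -> a 0%N = 0%E ->
  (\sum_(k <oo) a k = \sum_(k <oo) a k.+1)%E.
Proof.
move=> a0 a00; rewrite (nneseries_split 0 1)//= add0n big_nat1 a00 add0e.
rewrite -nneseries_addn//; apply: eq_eseriesr => k _.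
by rewrite addn1.
Qed.

Lemma poisson_mean : (\sum_(k <oo) k%:R%:E * q k = lam%:E)%E.
Proof.
rewrite nneseries_shift; last 2 first.
  by move=> k; rewrite mule_ge0// lee_fin.
  by rewrite mul0e.
under eq_eseriesr do rewrite poisson_prob_rec.
by rewrite nneseriesZl// poisson_prob_total mule1.
Qed.

(** By the recursion, the second moment is [lam] times the mean of the count plus 1. *)
Lemma poisson_moment2 :
  (\sum_(k <oo) (k%:R ^+ 2)%:E * q k = (lam ^+ 2 + lam)%:E)%E.
Proof.
rewrite nneseries_shift; last 2 first.
  by move=> k; rewrite mule_ge0// lee_fin exprn_ge0.
  by rewrite expr0n mul0e.
under eq_eseriesr => k _.
  rewrite expr2 EFinM -muleA poisson_prob_rec muleCA -natr1 EFinD.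
  rewrite ge0_muleDl ?lee_fin// mul1e.
over.
rewrite nneseriesZl; last by move=> k _; rewrite adde_ge0// mule_ge0// lee_fin.
rewrite nneseriesD//; last by move=> k _; rewrite mule_ge0// lee_fin.
by rewrite poisson_mean poisson_prob_total -EFinD -EFinM mulrDr mulr1 expr2.
Qed.

End poisson_moments.

Section compensated.
Context d (Omega : measurableType d) d' (Z : measurableType d') (R : realType).
Variables (P : probability Omega R) (m : {sigma_finite_measure set Z -> \bar R}).
Variable N : R.-ker Omega ~> Z.
Hypothesis Pcomplete : measure_is_complete P.
Hypothesis prm : poisson_random_measure P m N.
Implicit Types A B S : set Z.

Let lam A := fine (m A).

Lemma measurable_count A : measurable A -> measurable_fun setT (fun w => N w A).
Proof. by move=> mA; exact: measurable_kernel. Qed.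

Let E A k := [set w | N w A = k%:R%:E].

Let mE A k : measurable A -> measurable (E A k).
Proof.
move=> mA; rewrite -[X in measurable X]setTI.
exact: (measurable_count mA) measurableT [set k%:R%:E] (emeasurable_set1 _).
Qed.

Let tE A : trivIset setT (E A).
Proof.
move=> i j _ _ [w []]; rewrite /E/= => -> [] /eqP.
by rewrite eqr_nat => /eqP.
Qed.

Let lam_ge0 A : 0 <= lam A.
Proof. by rewrite /lam fine_ge0. Qed.

Lemma count_ae A : measurable A -> (m A < +oo)%E ->
  P (~` \bigcup_k E A k) = 0%E.
Proof.
move=> mA Aoo; rewrite probability_setC; last by apply: bigcupT_measurable => k; exact: mE.
rewrite measure_semi_bigcup//; last by apply: bigcupT_measurable => k; exact: mE.
  rewrite (eq_eseriesr (fun k _ => prm_law prm mA Aoo k)).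
  by rewrite poisson_prob_total subee.
by move=> k; exact: mE.
Qed.

Lemma count_fin_num A : measurable A -> (m A < +oo)%E ->
  {ae P, forall w, N w A \is a fin_num}.
Proof.
move=> mA Aoo; exists (~` \bigcup_k E A k); split.
- by apply: measurableC; apply: bigcupT_measurable => k; exact: mE.
- exact: count_ae.
- by move=> w /= h [k _]; rewrite /E/= => Ek; apply: h; rewrite Ek.
Qed.

(** The Poisson weights sum to 1, so the count is almost surely a natural number, and the
    expectation splits over its values. *)
Lemma count_integral A (h : R -> R) : measurable A -> (m A < +oo)%E ->
  measurable_fun setT h -> (forall x, 0 <= h x) ->
  (\int[P]_w (h (fine (N w A)))%:E = \sum_(k <oo) (h k%:R)%:E * poisson_prob (lam A) 0%N [set k])%E.
Proof.
move=> mA Aoo mh h0.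
have mU : measurable (\bigcup_k E A k) by apply: bigcupT_measurable => k; exact: mE.
have mhN : measurable_fun setT (fun w => (h (fine (N w A)))%:E).
  apply/measurable_EFinP; apply: (measurableT_comp mh).
  by apply: measurableT_comp; [exact: fine_measurable|exact: measurable_count].
rewrite (@ge0_negligible_integral _ _ _ P setT (~` \bigcup_k E A k))//; last 3 first.
- exact: measurableC.
- by move=> w _; rewrite lee_fin.
- exact: count_ae.
rewrite setTD setCK ge0_integral_bigcup//; last 3 first.
- by move=> k; exact: mE.
- exact: measurable_funTS.
- by move=> w _; rewrite lee_fin.
apply: eq_eseriesr => k _.
rewrite -(prm_law prm mA Aoo) -/(E A k) -integral_cst; last exact: mE.
by apply: eq_integral => w; rewrite inE /E/= => ->.
Qed.

Lemma L2_count A : measurable A -> (m A < +oo)%E -> L2 P (fun w => fine (N w A)).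
Proof.
move=> mA Aoo; apply/L2P; have mf : measurable_fun setT (fun w => fine (N w A)).
  by apply: measurableT_comp; [exact: fine_measurable|exact: measurable_count].
split => //; apply/integrableP; split.
  by apply/measurable_EFinP; exact: measurable_funX.
under eq_integral do rewrite /= ger0_norm ?sqr_ge0//.
rewrite (count_integral (h := fun x => x ^+ 2))//; last by move=> x; exact: sqr_ge0.
by rewrite poisson_moment2// ltry.
Qed.

Lemma mean_count A : measurable A -> (m A < +oo)%E ->
  (\int[P]_w (fine (N w A))%:E = (lam A)%:E)%E.
Proof.
move=> mA Aoo; rewrite -(poisson_mean (lam_ge0 A)).
transitivity (\int[P]_w (`|fine (N w A)|)%:E)%E.
  by apply: eq_integral => w _; rewrite ger0_norm// fine_ge0.
rewrite (count_integral (h := fun x => `|x|))//.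
by apply: eq_eseriesr => k _; rewrite ger0_norm.
Qed.

Lemma moment2_count A : measurable A -> (m A < +oo)%E ->
  (\int[P]_w (fine (N w A) ^+ 2)%:E = (lam A ^+ 2 + lam A)%:E)%E.
Proof.
move=> mA Aoo; rewrite (count_integral (h := fun x => x ^+ 2))//; last by move=> x; exact: sqr_ge0.
by rewrite poisson_moment2.
Qed.

Local Notation NH := (compensated m N).

Lemma L2_cst c : L2 P (cst c).
Proof. exact: Lfun_cst. Qed.

Lemma Rintegral_cst_prob (c : R) : Rintegral P setT (fun=> c) = c.
Proof.
rewrite /Rintegral (_ : (fun=> c%:E) = cst c%:E)// integral_cst//.
by rewrite [X in (_ * X)%E](_ : _ = 1%E) ?mule1//; exact: probability_setT.
Qed.

Lemma L2_compensated A : measurable A -> (m A < +oo)%E -> L2 P (NH A).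
Proof. by move=> mA Aoo; apply: (L2B (L2_count mA Aoo) (L2_cst _)). Qed.

Lemma L2_integrable (f : Omega -> R) : L2 P f -> P.-integrable setT (EFin \o f).
Proof.
move=> fL; have := L2_integrableM fL (L2_cst 1).
by apply: eq_integrable => // w _ /=; rewrite mulr1.
Qed.

Lemma Rintegral_compensated A : measurable A -> (m A < +oo)%E ->
  Rintegral P setT (NH A) = 0.
Proof.
move=> mA Aoo; rewrite RintegralB//; last 2 first.
- exact: (L2_integrable (L2_count mA Aoo)).
- exact: (L2_integrable (L2_cst _)).
by rewrite Rintegral_cst_prob /Rintegral mean_count// subrr.
Qed.

Lemma sqn_compensated A : measurable A -> (m A < +oo)%E -> sqn P (NH A) = lam A.
Proof.
move=> mA Aoo; rewrite sqnB//; [|exact: L2_count|exact: L2_cst].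
have -> : sqn P (fun w => fine (N w A)) = lam A ^+ 2 + lam A.
  by apply: EFin_inj; rewrite sqnE; [exact: moment2_count|exact: L2_count].
have -> : ip P (fun w => fine (N w A)) (cst (lam A)) = lam A ^+ 2.
  rewrite /ip RintegralZr//; last exact: (L2_integrable (L2_count mA Aoo)).
  by rewrite /Rintegral mean_count.
have -> : sqn P (cst (lam A)) = lam A ^+ 2.
  by rewrite expr2 -[RHS]Rintegral_cst_prob.
ring.
Qed.

(** Only almost sure: [fine] is additive on finite values, and the counts may be infinite on a null
    set. *)
Lemma compensatedU A B : measurable A -> measurable B -> A `&` B = set0 ->
  (m A < +oo)%E -> (m B < +oo)%E ->
  {ae P, forall w, NH (A `|` B) w = NH A w + NH B w}.
Proof.
move=> mA mB AB Aoo Boo.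
apply: filterS2 (count_fin_num mA Aoo) (count_fin_num mB Boo) => w fA fB.
have fmA : m A \is a fin_num by rewrite ge0_fin_numE.
have fmB : m B \is a fin_num by rewrite ge0_fin_numE.
by rewrite /compensated !measureU// !fineD//; ring.
Qed.

Lemma compensated_sum (I : choiceType) (s : seq I) (F : I -> set Z) :
  uniq s -> (forall i, measurable (F i)) -> trivIset setT F ->
  (forall i, m (F i) < +oo)%E ->
  {ae P, forall w, NH (\big[setU/set0]_(i <- s) F i) w = \sum_(i <- s) NH (F i) w}.
Proof.
move=> us mF tF Foo; elim: s us => [_|i s ih]/=.
  apply: aeW => w; rewrite !big_nil /compensated !measure0 subrr//.
move=> /andP[is_ us]; have := ih us.
have mU : measurable (\big[setU/set0]_(i <- s) F i) by apply: bigsetU_measurable.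
have dis : F i `&` \big[setU/set0]_(i <- s) F i = set0.
  apply/seteqP; split => // x [Fix]; rewrite -bigcup_seq => -[j /= js Fjx].
  have ij : i = j by apply: tF => //; exists x.
  by move: is_; rewrite ij js.
have Uoo : (m (\big[setU/set0]_(i <- s) F i) < +oo)%E.
  rewrite measure_bigsetU_seq//; apply: lte_sum_pinfty => j _; exact: Foo.
have := compensatedU (mF i) mU dis (Foo i) Uoo.
by apply: filterS2 => w; rewrite !big_cons => -> ->.
Qed.

Lemma measurable_wrt_compensated A S : measurable A -> A `<=` S ->
  measurable_wrt (noise_on P N S) (NH A).
Proof.
move=> mA AS.
apply: (@measurable_funB _ (g_sigma_algebraType (noise_on P N S))); last exact: measurable_cst.
move=> _ B mB; rewrite setTI; apply: sub_sigma_algebra; left.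
exists A, (fine @^-1` B); split => //.
by rewrite -[X in measurable X]setTI; exact: fine_measurable.
Qed.

Lemma integral_mul_compensated B (X : Omega -> R) : measurable B -> (m B < +oo)%E ->
  measurable_wrt (noise_on P N (~` B)) X -> P.-integrable setT (EFin \o X) ->
  P.-integrable setT (EFin \o (fun w => X w * NH B w)) /\
  Rintegral P setT (fun w => X w * NH B w) = 0.
Proof.
move=> mB Boo mX iX.
have := noise_indep_integral Pcomplete prm (measurableC mB) mB (setICl B) mX
  (measurable_wrt_compensated mB (fun _ => id)) iX (L2_integrable (L2_compensated mB Boo)).
by rewrite Rintegral_compensated// mulr0.
Qed.

Lemma integral_mul_compensated2 B (X : Omega -> R) : measurable B -> (m B < +oo)%E ->
  measurable_wrt (noise_on P N (~` B)) X -> P.-integrable setT (EFin \o X) ->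
  P.-integrable setT (EFin \o (fun w => X w * (NH B w * NH B w))) /\
  Rintegral P setT (fun w => X w * (NH B w * NH B w)) = Rintegral P setT X * lam B.
Proof.
move=> mB Boo mX iX.
have mN := measurable_wrt_compensated mB (fun _ => id).
have mN2 : measurable_wrt (noise_on P N B) (fun w => NH B w * NH B w).
  exact: (@measurable_funM _ (g_sigma_algebraType (noise_on P N B))).
have NL := L2_compensated mB Boo.
have := noise_indep_integral Pcomplete prm (measurableC mB) mB (setICl B) mX
  mN2 iX (L2_integrableM NL NL).
by rewrite -/(ip P (NH B) (NH B)) -/(sqn P (NH B)) sqn_compensated.
Qed.

(** The squares of the two factors are integrable and independent, so their product is integrable
    and its mean factors. *)
Lemma L2_mul_compensated B (X : Omega -> R) : measurable B -> (m B < +oo)%E ->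
  measurable_wrt (noise_on P N (~` B)) X -> L2 P X ->
  L2 P (fun w => X w * NH B w) /\ sqn P (fun w => X w * NH B w) = sqn P X * lam B.
Proof.
move=> mB Boo mX XL.
have mX2 : measurable_wrt (noise_on P N (~` B)) (fun w => X w * X w).
  exact: (@measurable_funM _ (g_sigma_algebraType (noise_on P N (~` B)))).
have [i2 e2] := integral_mul_compensated2 mB Boo mX2 (L2_integrableM XL XL).
split.
  apply/L2P; split.
    by apply: measurable_funM; [exact: L2_measurable XL|exact: L2_measurable (L2_compensated mB Boo)].
  by apply: eq_integrable i2 => // w _ /=; congr EFin; ring.
rewrite /sqn /ip -[RHS]e2.
by apply: eq_Rintegral => w _; ring.
Qed.

End compensated.

(** * Products of compensated counts over disjoint cells *)

Section products.
Context d (Omega : measurableType d) d' (Z : measurableType d') (R : realType).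
Variables (P : probability Omega R) (m : {sigma_finite_measure set Z -> \bar R}).
Variable N : R.-ker Omega ~> Z.
Hypothesis Pcomplete : measure_is_complete P.
Hypothesis prm : poisson_random_measure P m N.
Local Notation NH := (compensated m N).

Lemma measurable_noise_wrt S (X : Omega -> R) :
  measurable_wrt (noise_on P N S) X -> measurable_fun setT X.
Proof. by apply: measurable_wrt_measurable; exact: noise_on_measurable. Qed.

Lemma measurable_noise_wrtS S S' (X : Omega -> R) : S `<=` S' ->
  measurable_wrt (noise_on P N S) X -> measurable_wrt (noise_on P N S') X.
Proof.
by move=> SS'; apply: measurable_wrt_sub => E /(noise_onS SS'); exact: sub_sigma_algebra.
Qed.

Lemma measurable_wrtM (G : set (set Omega)) (X Y : Omega -> R) :
  measurable_wrt G X -> measurable_wrt G Y -> measurable_wrt G (fun w => X w * Y w).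
Proof. by move=> mX mY; exact: (@measurable_funM _ (g_sigma_algebraType G)). Qed.

Lemma measurable_wrt_sum (G : set (set Omega)) (I : Type) (s : seq I) (X : I -> Omega -> R) :
  (forall i, measurable_wrt G (X i)) -> measurable_wrt G (fun w => \sum_(i <- s) X i w).
Proof. by move=> mX; apply: (@measurable_sum _ (g_sigma_algebraType G)). Qed.

Section family.
Variables (I : choiceType) (A : I -> set Z).
Hypotheses (mA : forall i, measurable (A i)) (tA : trivIset setT A).
Hypothesis (Aoo : forall i, (m (A i) < +oo)%E).

Lemma measurable_wrt_prod (s : seq I) (p : pred I) S : (forall i, i \in s -> p i -> A i `<=` S) ->
  measurable_wrt (noise_on P N S) (fun w => \prod_(i <- s | p i) NH (A i) w).
Proof.
move=> AS.
have -> : (fun w => \prod_(i <- s | p i) NH (A i) w) =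
    (fun w => \prod_(i <- s) (if p i then NH (A i) w else 1)).
  by apply/funext => w; rewrite big_mkcond.
apply: (@measurable_prod _ (g_sigma_algebraType (noise_on P N S))) => i si.
case pi: (p i); last exact: measurable_cst.
by apply: measurable_wrt_compensated => //; exact: AS.
Qed.

Let disjA i j : i != j -> A j `<=` ~` A i.
Proof.
by move=> /eqP ij z Ajz Aiz; apply: ij; apply: tA => //; exists z.
Qed.

(** Induction on [s]: since entries do not repeat, the cell that is split off is disjoint from the
    others, and its factor is independent of their product. *)
Lemma L2_prod_compensated (s : seq I) (p : pred I) : uniq s ->
  L2 P (fun w => \prod_(i <- s | p i) NH (A i) w) /\
  sqn P (fun w => \prod_(i <- s | p i) NH (A i) w) = \prod_(i <- s | p i) fine (m (A i)).
Proof.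
elim: s => [_|i s ih /= /andP[is_ us]].
  under eq_fun do rewrite big_nil; rewrite big_nil.
  split; first exact: L2_cst.
  by rewrite /sqn /ip Rintegral_cst_prob mulr1.
have [iL iS] := ih us.
have ms : measurable_wrt (noise_on P N (~` A i)) (fun w => \prod_(i <- s | p i) NH (A i) w).
  apply: measurable_wrt_prod => j js _; apply: disjA.
  by apply: contraNneq is_ => ->.
have [L S] := L2_mul_compensated Pcomplete prm (mA i) (Aoo i) ms iL.
case pi: (p i); last first.
  under eq_fun do rewrite big_cons pi.
  by rewrite big_cons pi.
have -> : (fun w => \prod_(j <- i :: s | p j) NH (A j) w) =
    (fun w => (\prod_(j <- s | p j) NH (A j) w) * NH (A i) w).
  by apply/funext => w; rewrite big_cons pi mulrC.
by rewrite S iS big_cons pi mulrC.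
Qed.

(** The factor of [A j] occurs exactly once and is centred, and all the other factors only see the
    noise off [A j]. *)
Lemma ip_prod_orth (s t : seq I) (j : I) : uniq s -> uniq t -> j \in t -> j \notin s ->
  ip P (fun w => \prod_(i <- s) NH (A i) w) (fun w => \prod_(i <- t) NH (A i) w) = 0.
Proof.
move=> us ut jt js.
have [sL _] := L2_prod_compensated predT us.
have [tL _] := L2_prod_compensated (predC1 j) ut.
have mX : measurable_wrt (noise_on P N (~` A j)) (fun w =>
   (\prod_(i <- s) NH (A i) w) * (\prod_(i <- t | i != j) NH (A i) w)).
  apply: measurable_wrtM; apply: measurable_wrt_prod => i.
    by move=> si _; apply: disjA; apply: contraNneq js => ->.
  by move=> _ ij; apply: disjA; rewrite eq_sym.
have [_ <-] := integral_mul_compensated Pcomplete prm (mA j) (Aoo j) mX (L2_integrableM sL tL).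
apply: eq_Rintegral => w _.
by rewrite -mulrA; congr (_ * _); rewrite (bigD1_seq j)//= mulrC.
Qed.

Variables (S : set Z) (Y : Omega -> R) (M : R).
Hypotheses (mY : measurable_wrt (noise_on P N S) Y) (YM : forall w, `|Y w| <= M).

(* Split B along the A_j; each piece B n A_j is then split off NH (A_j). *)
Lemma prod_compensated_ibp (s : seq I) (B : set Z) : uniq s ->
  measurable B -> (m B < +oo)%E -> B `<=` ~` S ->
  ip P (fun w => Y w * \prod_(i <- s) NH (A i) w) (NH B) =
  \sum_(j <- s) Rintegral P setT (fun w => Y w * \prod_(i <- s | i != j) NH (A i) w)
                * fine (m (A j `&` B)).
Proof.
move=> us mB Boo BS.
have YmM : measurable_fun setT Y by exact: measurable_noise_wrt mY.
(* The part of [B] covered by the cells of [s]. What remains of [B] is disjoint from these cells and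
   from [S], so that its compensated count contributes 0. *)
pose U := \big[setU/set0]_(i <- s) (A i `&` B).
have mAB i : measurable (A i `&` B) by exact: measurableI.
have ABoo i : (m (A i `&` B) < +oo)%E.
  by apply: le_lt_trans Boo; apply: le_measure; rewrite ?inE.
have tAB : trivIset setT (fun i => A i `&` B).
  by move=> i j _ _ [z [[Ai _] [Aj _]]]; apply: tA => //; exists z.
have mU : measurable U by apply: bigsetU_measurable.
have UB : U `<=` B by rewrite /U -bigcup_seq => z [j _ []].
have mB0 : measurable (B `\` U) by exact: measurableD.
have B0oo : (m (B `\` U) < +oo)%E.
  by apply: le_lt_trans Boo; apply: le_measure; rewrite ?inE.
have Uoo : (m U < +oo)%E.
  by apply: le_lt_trans Boo; apply: le_measure; rewrite ?inE.
have B0A i : i \in s -> A i `<=` ~` (B `\` U).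
  move=> si z Az [Bz]; apply; rewrite /U -bigcup_seq; exists i => //.
have L2NH := @L2_compensated _ _ _ _ _ P m N prm.
have eB : {ae P, forall w, NH B w = NH (B `\` U) w + \sum_(j <- s) NH (A j `&` B) w}.
  have := compensatedU prm mB0 mU (setDKI _ _) B0oo Uoo.
  rewrite setUC setDUK//; have := compensated_sum prm us mAB tAB ABoo.
  by apply: filterS2 => w; rewrite -/U => <-.
pose X w := Y w * \prod_(i <- s) NH (A i) w.
pose Q j w := \prod_(i <- s | i != j) NH (A i) w.
have [sL _] := L2_prod_compensated predT us.
have QL j : L2 P (Q j) by have [] := L2_prod_compensated (predC1 j) us.
have XL : L2 P X by exact: (L2_boundedM YmM YM sL).
have SL : L2 P (fun w => \sum_(j <- s) NH (A j `&` B) w).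
  by apply: L2_sum => i _; exact: L2NH.
rewrite -/X (@ip_ae _ _ _ _ X (NH B) X (NH (B `\` U) \+ (fun w => \sum_(j <- s) NH (A j `&` B) w)))//; last 3 first.
- exact: L2NH.
- by apply: L2D => //; exact: L2NH.
- exact: aeW.
rewrite ipC ipDl//; last exact: L2NH.
have -> : ip P (NH (B `\` U)) X = 0.
  rewrite ipC.
  have mX : measurable_wrt (noise_on P N (~` (B `\` U))) X.
    apply: measurable_wrtM.
      by apply: measurable_noise_wrtS mY => z Sz [/BS nS _]; exact: nS.
    by apply: measurable_wrt_prod => i si _; exact: B0A.
  by have [_] := integral_mul_compensated Pcomplete prm mB0 B0oo mX (L2_integrable XL).
rewrite add0r ip_suml//; last by move=> i _; exact: L2NH.
apply: eq_big_seq => j js.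
have mAj : measurable (A j `\` B) by exact: measurableD.
have Ajoo : (m (A j `\` B) < +oo)%E.
  by apply: le_lt_trans (Aoo j); apply: le_measure; rewrite ?inE//; exact: subDsetl.
have mQ C : C `<=` A j -> measurable_wrt (noise_on P N (~` C)) (Q j).
  move=> CA; apply: measurable_wrt_prod => i _ ij.
  apply: (@subset_trans _ (~` A j)); last exact: subsetC.
  by apply: disjA; rewrite eq_sym.
have [L1 _] := L2_mul_compensated Pcomplete prm (mAB j) (ABoo j) (mQ _ (@subIsetl _ _ _)) (QL j).
have [L2' _] := L2_mul_compensated Pcomplete prm mAj Ajoo (mQ _ (@subDsetl _ _ _)) (QL j).
(* The factor of [A j] is itself split along [B]. Its part off [B] leaves the piece in [B]
   independent and centred; its part in [B] produces the square of that piece, whose mean is the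
   mass. *)
pose X1 w := Y w * (Q j w * NH (A j `&` B) w).
pose X2 w := Y w * (Q j w * NH (A j `\` B) w).
have X1L : L2 P X1 by exact: (L2_boundedM YmM YM L1).
have X2L : L2 P X2 by exact: (L2_boundedM YmM YM L2').
rewrite ipC (@ip_ae _ _ _ _ X (NH (A j `&` B)) (X1 \+ X2) (NH (A j `&` B)))//; last 5 first.
- exact: L2NH.
- exact: L2D.
- exact: L2NH.
- have dis : (A j `&` B) `&` (A j `\` B) = set0.
    by apply/seteqP; split => // z [[_ Bz] []].
  have := compensatedU prm (mAB j) mAj dis (ABoo j) Ajoo.
  rewrite setUIDK; apply: filterS => w e.
  by rewrite /X (bigD1_seq j)//= e /X1 /X2 /Q; ring.
- exact: aeW.
rewrite ipDl//; last exact: L2NH.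
have mYB : measurable_wrt (noise_on P N (~` (A j `&` B))) Y.
  by apply: measurable_noise_wrtS mY => z Sz [_ /BS]; apply.
have -> : ip P X2 (NH (A j `&` B)) = 0.
  have mX2 : measurable_wrt (noise_on P N (~` (A j `&` B))) X2.
    apply: measurable_wrtM => //; apply: measurable_wrtM.
      by apply: mQ; exact: subIsetl.
    by apply: measurable_wrt_compensated => // z [_ nB] [].
  by have [_] := integral_mul_compensated Pcomplete prm (mAB j) (ABoo j) mX2 (L2_integrable X2L).
rewrite addr0.
have YQL : L2 P (fun w => Y w * Q j w) by exact: (L2_boundedM YmM YM (QL j)).
have mYQ : measurable_wrt (noise_on P N (~` (A j `&` B))) (fun w => Y w * Q j w).
  by apply: measurable_wrtM => //; apply: mQ; exact: subIsetl.
have [_ <-] := integral_mul_compensated2 Pcomplete prm (mAB j) (ABoo j) mYQ (L2_integrable YQL).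
by apply: eq_Rintegral => w _; rewrite /X1; ring.
Qed.

End family.
End products.

(** * Elementary kernels and multiple integrals *)

Section indicators.
Context d (T : measurableType d) (R : realType) (mu : {measure set T -> \bar R}).

Lemma L2_indic (A : set T) : measurable A -> (mu A < +oo)%E -> L2 mu (\1_A : T -> R).
Proof.
move=> mA Aoo; apply/L2P; split; first exact: measurable_indic.
have -> : (fun x => ((\1_A x : R) ^+ 2)%:E) = EFin \o \1_A.
  by apply/funext => x /=; rewrite indicE; case: (_ \in _); rewrite ?expr1n ?expr0n.
apply/integrableP; split; first by apply/measurable_EFinP; exact: measurable_indic.
under eq_integral do rewrite /= ger0_norm//.
by rewrite integral_indic// setIT.
Qed.

Lemma ip_indic (A B : set T) : measurable A -> measurable B ->
  ip mu (\1_A : T -> R) (\1_B : T -> R) = fine (mu (A `&` B)).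
Proof.
move=> mA mB; rewrite /ip /Rintegral.
have -> : (fun x => (\1_A x * \1_B x : R)%:E) = EFin \o \1_(A `&` B).
  by apply/funext => x /=; rewrite indicI.
by rewrite integral_indic ?setIT//; exact: measurableI.
Qed.

End indicators.

Section power_measure_theory.
Context d (Z : measurableType d) (R : realType) (m : {sigma_finite_measure set Z -> \bar R}).
Local Notation mm n := (power_measure m n : {measure set (n.-tuple Z) -> \bar R}).

Definition box n (A : 'I_n -> set Z) : set (n.-tuple Z) :=
  [set t | forall i, A i (tnth t i)].

Lemma measurable_box n (A : 'I_n -> set Z) : (forall i, measurable (A i)) -> measurable (box A).
Proof.
move=> mA; have -> : box A = \bigcap_(i in setT) (fun t => tnth t i) @^-1` A i.
  by apply/seteqP; split => t /= h i; [move=> _|]; exact: h.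
apply: fin_bigcap_measurable => // i _.
by rewrite -[X in measurable X]setTI; exact: measurable_tnth.
Qed.

Lemma power_measure_box n (A : 'I_n -> set Z) : (forall i, measurable (A i)) ->
  mm n (box A) = (\prod_(i < n) m (A i))%E.
Proof.
elim: n A => [A mA|n ih A mA].
  rewrite big_ord0 /= diracE mem_set//.
  by case.
rewrite big_ord_recr/= /rcons_measure /pushforward.
have -> : tuple_rcons (n:=n) @^-1` box A =
    box (fun i => A (widen_ord (leqnSn n) i)) `*` A ord_max.
  apply/seteqP; split => -[t z] /=.
    move=> h; split => /=.
      move=> i; have := h (widen_ord (leqnSn n) i).
      by rewrite !(tnth_nth z)/= nth_rcons size_tuple ltn_ord.
    by have := h ord_max; rewrite (tnth_nth z)/= nth_rcons size_tuple ltnn eqxx.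
  move=> [h1 h2] i; rewrite (tnth_nth z)/= nth_rcons size_tuple.
  have [ltin|lein] := ltnP i n.
    have := h1 (Ordinal ltin); rewrite (tnth_nth z)/=.
    by rewrite (_ : widen_ord _ _ = i)//; exact: val_inj.
  have -> : i = ord_max by apply: val_inj => /=; apply/eqP; rewrite eqn_leq lein -ltnS ltn_ord.
  by rewrite eqxx.
rewrite product_measure1E//; last exact: measurable_box.
by congr (_ * _)%E; exact: ih.
Qed.

Lemma integral_power_measureS n (h : n.+1.-tuple Z -> \bar R) :
  measurable_fun setT h -> (forall t, 0 <= h t)%E ->
  (\int[mm n.+1]_t h t = \int[m]_z \int[mm n]_t h (tuple_rcons (t, z)))%E.
Proof.
move=> mh h0.
transitivity (\int[(mm n \x m)%E]_u (h \o @tuple_rcons _ Z n) u)%E.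
  rewrite /= /rcons_measure ge0_integral_pushforward//.
  exact: measurable_tuple_rcons.
rewrite fubini_tonelli2//; last by move=> u; exact: h0.
by apply: measurableT_comp => //; exact: measurable_tuple_rcons.
Qed.

Lemma integral_power_measure1 (h : 1.-tuple Z -> \bar R) :
  measurable_fun setT h -> (forall t, 0 <= h t)%E ->
  (\int[mm 1%N]_t h t = \int[m]_z h [tuple z])%E.
Proof.
move=> mh h0; rewrite integral_power_measureS//.
apply: eq_integral => z _ /=; rewrite integral_dirac//.
  by rewrite diracT mul1e; congr h; apply: val_inj.
apply: measurableT_comp => //.
by apply: (measurableT_comp (@measurable_tuple_rcons _ Z 0%N)); exact: measurable_pair2.
Qed.

Definition tuple_perm n (s : 'S_n) (t : n.-tuple Z) : n.-tuple Z :=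
  [tuple tnth t (s i) | i < n].

Lemma measurable_tuple_perm n (s : 'S_n) : measurable_fun setT (@tuple_perm n s).
Proof.
apply/measurable_fun_tnthP => i.
rewrite (_ : _ \o _ = fun t => tnth t (s i)); first exact: measurable_tnth.
by apply/funext => t /=; rewrite tnth_mktuple.
Qed.

(** Boxes form a pi-system generating the sigma-field of tuples, and boxes with all sides equal to
    one set of a sigma-finite exhaustion have finite mass. This frees [power_measure] from the order
    in which coordinates are adjoined. *)
Lemma measure_box_unique n (mu : {measure set (n.-tuple Z) -> \bar R}) :
  (forall A : 'I_n -> set Z, (forall i, measurable (A i)) -> mu (box A) = (\prod_(i < n) m (A i))%E) ->
  forall E, measurable E -> mm n E = mu E.
Proof.
move=> muE.
have /sigma_finiteP[F [TF ndF Foo]] := sigma_finiteT m.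
pose G := [set E : set (n.-tuple Z) | exists2 A, (forall i, measurable (A i)) & E = box A].
pose g k : set (n.-tuple Z) := box (fun=> F k).
have Gg k : G (g k) by exists (fun=> F k) => // i; have [] := Foo k.
have GG : measurable = <<s G >>.
  apply/seteqP; split; last first.
    apply: smallest_sub; first exact: sigma_algebra_measurable.
    by move=> _ [A mA ->]; exact: measurable_box.
  apply: smallest_sub; first exact: smallest_sigma_algebra.
  move=> E; rewrite -bigcup_seq => -[i /= _ [B mB <-]].
  apply: sub_sigma_algebra; exists (fun j => if j == i then B else setT).
    by move=> j; case: ifP.
  rewrite setTI; apply/seteqP; split => t /=.
    by move=> Bt j; case: eqP => // ->.
  by move=> /(_ i); rewrite eqxx.
apply: (measure_unique G g GG) => //.
- move=> _ _ [A mA ->] [B mB ->]; exists (fun i => A i `&` B i).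
    by move=> i; exact: measurableI.
  apply/seteqP; split => t /=; first by move=> [h1 h2] i; split.
  by move=> h; split => i; have [] := h i.
- apply/seteqP; split => // t _.
  have /choice[k kP] i : exists k, F k (tnth t i).
    by have : [set: Z] (tnth t i) by []; rewrite TF => -[k _ ?]; exists k.
  exists (\max_(i < n) k i)%N => // i; move: (tnth t i) (kP i).
  apply/subsetPset/ndF; exact: leq_bigmax.
- by move=> _ [A mA ->]; exact: etrans (power_measure_box mA) (esym (muE _ mA)).
- move=> k; have [mFk Fk] := Foo k.
  apply: (@le_lt_trans _ _ (\prod_(i < n) m (F k))%E).
    by rewrite le_eqVlt; apply/orP; left; apply/eqP; exact: power_measure_box.
  have fk : m (F k) \is a fin_num by rewrite ge0_fin_numE.
  by rewrite -(fineK fk) -(big_morph EFin (@EFinM R) erefl) ltry.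
Qed.

(** The preimage of a box is the box with permuted sides, which has the same product of masses. *)
Lemma power_measure_perm n (s : 'S_n) (E : set (n.-tuple Z)) : measurable E ->
  mm n E = pushforward (mm n) (@tuple_perm n s) E.
Proof.
have mp := @measurable_tuple_perm n s.
pose mu := @pushforward _ _ _ _ _ (mm n) (mfun_Sub (mem_set mp)).
have mubox (A : 'I_n -> set Z) : (forall i, measurable (A i)) ->
    mu (box A) = (\prod_(i < n) m (A i))%E.
  move=> mA; rewrite /mu /pushforward/=.
  have -> : tuple_perm s @^-1` box A = box (fun i => A ((s^-1)%g i)).
    apply/seteqP; split => t /= h i.
      by have := h ((s^-1)%g i); rewrite tnth_mktuple permKV.
    by have := h (s i); rewrite permK tnth_mktuple.
  rewrite power_measure_box//.
  by rewrite [RHS](reindex_inj (@perm_inj _ (s^-1)%g)).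
exact: (measure_box_unique mubox).
Qed.

Lemma sqn_tuple_perm n (s : 'S_n) (f : n.-tuple Z -> R) : L2 (mm n) f ->
  L2 (mm n) (f \o tuple_perm s) /\ sqn (mm n) (f \o tuple_perm s) = sqn (mm n) f.
Proof.
move=> fL; have mf := L2_measurable fL.
have mp := @measurable_tuple_perm n s.
have E : (\int[mm n]_t ((f \o tuple_perm s) t ^+ 2)%:E = \int[mm n]_t (f t ^+ 2)%:E)%E.
  transitivity (\int[pushforward (mm n) (mfun_Sub (mem_set mp))]_t (f t ^+ 2)%:E)%E.
    rewrite ge0_integral_pushforward//.
      by apply/measurable_EFinP; exact: measurable_funX.
    by move=> t _; rewrite lee_fin sqr_ge0.
  by apply: eq_measure_integral => A mA _; first [exact: power_measure_perm|exact/esym/power_measure_perm].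
have sL : L2 (mm n) (f \o tuple_perm s).
  apply/L2P; split; first exact: measurableT_comp.
  apply/integrableP; split.
    by apply/measurable_EFinP/measurable_funX; exact: measurableT_comp.
  under eq_integral do rewrite /= ger0_norm ?sqr_ge0//.
  by rewrite E -sqnE// ltry.
by split => //; apply: EFin_inj; rewrite !sqnE.
Qed.

Section elementary_norm.
Variables (n : nat) (e : elementary Z R n).
Hypothesis ele : is_elementary m e.
Implicit Types tau sigma : n.-tuple 'I_(el_size e).

Definition cell tau : set (n.-tuple Z) := box (fun j => el_set (tnth tau j)).

Lemma elementary_funE t :
  elementary_fun e t = \sum_tau el_coef tau * \1_(cell tau) t.
Proof.
apply: eq_bigr => tau _; congr (_ * _); rewrite indicE.
have [h|h] := pselect (cell tau t).
  rewrite mem_set// big1// => j _; rewrite indicE mem_set//; exact: h.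
rewrite memNset//.
have [j hj] : exists j, ~ el_set (tnth tau j) (tnth t j).
  by apply/existsNP => h'; apply: h => j; exact: h'.
by rewrite (bigD1 j)//= indicE memNset// mul0r.
Qed.

Let mA i : measurable (el_set (e := e) i). Proof. by case: ele => /(_ i)[]. Qed.
Let Aoo i : (m (el_set (e := e) i) < +oo)%E. Proof. by case: ele => /(_ i)[]. Qed.
Let tA : trivIset setT (el_set (e := e)). Proof. by case: ele. Qed.

Lemma power_measure_cell tau :
  mm n (cell tau) = (\prod_(j < n) fine (m (el_set (tnth tau j))))%:E.
Proof.
rewrite power_measure_box// (big_morph EFin (@EFinM R) erefl); apply: eq_bigr => j _.
by rewrite fineK// ge0_fin_numE.
Qed.

Lemma measurable_cell tau : measurable (cell tau).
Proof. exact: measurable_box. Qed.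

Lemma cell_disj tau sigma : tau != sigma -> cell tau `&` cell sigma = set0.
Proof.
move=> ts; apply/seteqP; split => // t [h1 h2].
move/eqP : ts; apply; apply: eq_from_tnth => j.
by apply: tA => //; exists (tnth t j); split; [exact: h1|exact: h2].
Qed.

Lemma L2_cell tau : L2 (mm n) (\1_(cell tau) : _ -> R).
Proof. by apply: L2_indic; [exact: measurable_cell|rewrite power_measure_cell ltry]. Qed.

Lemma L2_elementary_fun : L2 (mm n) (elementary_fun e).
Proof.
rewrite (_ : elementary_fun e = fun t => \sum_tau el_coef tau * \1_(cell tau) t).
  by apply: L2_sum => tau _; apply: L2Z; exact: L2_cell.
by apply/funext => t; exact: elementary_funE.
Qed.

(** The boxes of distinct index tuples are disjoint, so only the diagonal of the double sum
    survives. *)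
Lemma sqn_elementary_fun : sqn (mm n) (elementary_fun e) =
  \sum_(tau : n.-tuple 'I_(el_size e))
    el_coef tau ^+ 2 * \prod_(j < n) fine (m (el_set (tnth tau j))).
Proof.
rewrite /sqn (eq_ip _ (f' := fun t => \sum_tau el_coef tau * \1_(cell tau) t)
  (g' := elementary_fun e))//; last exact: elementary_funE.
rewrite ip_suml//; last 2 first.
- by move=> tau _; apply: L2Z; exact: L2_cell.
- exact: L2_elementary_fun.
apply: eq_bigr => tau _; rewrite ipZl//; last 2 first.
- exact: L2_cell.
- exact: L2_elementary_fun.
rewrite ipC (eq_ip _ (f' := fun t => \sum_sigma el_coef sigma * \1_(cell sigma) t)
  (g' := \1_(cell tau)))//; last exact: elementary_funE.
rewrite ip_suml//; last 2 first.
- by move=> sigma _; apply: L2Z; exact: L2_cell.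
- exact: L2_cell.
rewrite (bigD1 tau)//= big1 ?addr0 => [|sigma st]; last first.
  rewrite ipZl; [|exact: L2_cell..].
  rewrite ip_indic; [|exact: measurable_cell..].
  by rewrite cell_disj// measure0 mulr0.
rewrite ipZl; [|exact: L2_cell..].
rewrite ip_indic; [|exact: measurable_cell..].
by rewrite setIid power_measure_cell/= mulrA -expr2.
Qed.

End elementary_norm.

End power_measure_theory.

(** The rearrangements of [t] are the image of the symmetric group acting on positions. This is the
    origin of the factor n! in the bound on elementary integrals. *)
Lemma card_perm_eq n k (t : n.-tuple 'I_k) :
  (#|[pred s : n.-tuple 'I_k | perm_eq t s]| <= n`!)%N.
Proof.
rewrite -card_Sn.
apply: (leq_trans _ (leq_imset_card (fun p : 'S_n => [tuple tnth t (p i) | i < n]) 'S_n)).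
apply: subset_leq_card; apply/fintype.subsetP => s.
rewrite inE seq.perm_sym => /tuple_permP[p sp].
by apply/imsetP; exists p; [rewrite inE|exact: val_inj].
Qed.

Section tuple_sums.
Variable R : realType.

Lemma prod_sum_tuple n (J : finType) (F : 'I_n -> J -> R) :
  \prod_(i < n) \sum_(j : J) F i j = \sum_(t : n.-tuple J) \prod_(i < n) F i (tnth t i).
Proof.
rewrite bigA_distr_bigA/= (reindex (fun t : n.-tuple J => [ffun i => tnth t i])).
  by apply: eq_bigr => t _; apply: eq_bigr => i _; rewrite ffunE.
exists (fun f : {ffun 'I_n -> J} => [tuple f i | i < n]) => [t|f] _.
  by apply: eq_from_tnth => i; rewrite tnth_mktuple ffunE.
by apply/ffunP => i; rewrite ffunE tnth_mktuple.
Qed.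

(** The coefficient a (pi s_1, ..., pi s_n), read as 0 when some pi s_j is [None]: at most one [r]
    contributes to the sum. Here [pi] sends a part of a refinement to the cell that contains it, if
    any. *)
Definition lift_coef n k (J : finType) (pi : J -> option 'I_k)
    (a : n.-tuple 'I_k -> R) (s : n.-tuple J) : R :=
  \sum_(r : n.-tuple 'I_k) a r * \prod_(j < n) (pi (tnth s j) == Some (tnth r j))%:R.

(** Expansion of a product of sums. With [x] and [y] either indicators or compensated counts, it
    rewrites both the kernel and its integral over a refinement. *)
Lemma lift_coef_sum n k (J : finType) (pi : J -> option 'I_k)
    (a : n.-tuple 'I_k -> R) (x : 'I_n -> 'I_k -> R) (y : 'I_n -> J -> R) :
  (forall j i, x j i = \sum_(t | pi t == Some i) y j t) ->
  \sum_(r : n.-tuple 'I_k) a r * \prod_(j < n) x j (tnth r j) =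
  \sum_(s : n.-tuple J) lift_coef pi a s * \prod_(j < n) y j (tnth s j).
Proof.
move=> xy.
under [RHS]eq_bigr do rewrite /lift_coef mulr_suml.
rewrite exchange_big/=; apply: eq_bigr => r _.
under [RHS]eq_bigr do rewrite -mulrA -big_split/=.
rewrite -mulr_sumr -(prod_sum_tuple (fun j t => (pi t == Some (tnth r j))%:R * y j t)); congr (_ * _); apply: eq_bigr => j _.
rewrite xy big_mkcond/=; apply: eq_bigr => t _.
by case: ifP => _; rewrite ?mul1r ?mul0r.
Qed.

(** Equal entries of [s] have equal images under [pi], so a repetition in [s] forces one in the
    tuple of cells. *)
Lemma lift_coef_diag n k (J : finType) (pi : J -> option 'I_k)
    (a : n.-tuple 'I_k -> R) (s : n.-tuple J) :
  (forall r : n.-tuple 'I_k, ~~ uniq r -> a r = 0) -> ~~ uniq s -> lift_coef pi a s = 0.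
Proof.
move=> a0 us; rewrite /lift_coef big1// => r _.
have [ur|/a0->] := boolP (uniq r); last by rewrite mul0r.
have [[i j] /= ij sij] : exists2 p : 'I_n * 'I_n, p.1 != p.2 & tnth s p.1 = tnth s p.2.
  apply: contrapT => h; move/negP : us; apply; apply/tuple_uniqP => i j sij.
  by apply/eqP/negPn/negP => ij; apply: h; exists (i, j).
have [h|/negPf h] := boolP [forall j, pi (tnth s j) == Some (tnth r j)].
  move/forallP : h => h.
  have : tnth r i = tnth r j.
    by apply/eqP; have /eqP := h i; rewrite sij (eqP (h j)) => -[->].
  by move/tuple_uniqP : ur => /[apply] /eqP; rewrite (negbTE ij).
move/negbT : h; rewrite negb_forall => /existsP[l /negbTE hl].
by rewrite (bigD1 l)//= hl mul0r mulr0.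
Qed.


End tuple_sums.

Section elementary_integrals.
Context d (Omega : measurableType d) d' (Z : measurableType d') (R : realType).
Variables (P : probability Omega R) (m : {sigma_finite_measure set Z -> \bar R}).
Variable N : R.-ker Omega ~> Z.
Hypothesis Pcomplete : measure_is_complete P.
Hypothesis prm : poisson_random_measure P m N.
Local Notation NH := (compensated m N).
Local Notation mm n := (power_measure m n : {measure set (n.-tuple Z) -> \bar R}).

Section isometry.
Variables (n : nat) (e : elementary Z R n).
Hypothesis ele : is_elementary m e.

Let mA i : measurable (el_set (e := e) i). Proof. by case: ele => /(_ i)[]. Qed.
Let Aoo i : (m (el_set (e := e) i) < +oo)%E. Proof. by case: ele => /(_ i)[]. Qed.
Let tA : trivIset setT (el_set (e := e)). Proof. by case: ele. Qed.
Let a0 (tau : n.-tuple 'I_(el_size e)) : ~~ uniq tau -> el_coef tau = 0.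
Proof. by case: ele => _ _; apply. Qed.

Let M (tau : n.-tuple 'I_(el_size e)) w := \prod_(j < n) NH (el_set (tnth tau j)) w.
Let L (tau : n.-tuple 'I_(el_size e)) := \prod_(j < n) fine (m (el_set (tnth tau j))).

Let ME tau w : M tau w = \prod_(i <- tau) NH (el_set i) w.
Proof. by rewrite big_tuple. Qed.

Let LE tau : L tau = \prod_(i <- tau) fine (m (el_set i)).
Proof. by rewrite big_tuple. Qed.

Let L_ge0 tau : 0 <= L tau.
Proof. by apply: prodr_ge0 => j _; rewrite fine_ge0. Qed.

Lemma L2_elementary_term (tau : n.-tuple 'I_(el_size e)) :
  L2 P (fun w => el_coef tau * \prod_(j < n) NH (el_set (tnth tau j)) w).
Proof.
have [ut|/a0 ->] := boolP (uniq tau); last first.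
  by under eq_fun do rewrite mul0r; exact: L2_0.
apply: L2Z; have [+ _] := L2_prod_compensated Pcomplete prm mA tA Aoo predT ut.
by under [X in L2 P X -> _]eq_fun do rewrite -ME.
Qed.

Lemma L2_elementary_integral : L2 P (elementary_integral m N e).
Proof. by apply: L2_sum => tau _; exact: L2_elementary_term. Qed.

Lemma elementary_integral_noise : measurable_wrt (noise_on P N setT) (elementary_integral m N e).
Proof.
apply: measurable_wrt_sum => tau; apply: measurable_wrtM.
  exact: (@measurable_cst _ _ (g_sigma_algebraType (noise_on P N setT))).
have := measurable_wrt_prod (P := P) (N := N) m mA (s := tau) (p := predT) (S := setT) (fun _ _ _ _ _ => I).
by under [X in measurable_wrt _ X -> _]eq_fun do rewrite -ME.
Qed.

(** Two terms are orthogonal unless their index tuples are rearrangements of each other. In that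
    case the masses agree, and a b <= (a^2 + b^2) / 2 bounds the pairing by diagonal terms, each of
    which is met at most n! times. Without symmetry of the kernel, this inequality takes the place
    of the isometry. *)
Lemma sqn_elementary_integral_le :
  sqn P (elementary_integral m N e) <= n`!%:R * sqn (mm n) (elementary_fun e).
Proof.
rewrite sqn_elementary_fun// /sqn.
rewrite ip_suml; [|by move=> tau _; exact: L2_elementary_term|exact: L2_elementary_integral].
pose F tau := el_coef tau ^+ 2 * L tau.
have F0 tau : 0 <= F tau by rewrite mulr_ge0// sqr_ge0.
have H tau sigma : ip P (fun w => el_coef tau * M tau w) (fun w => el_coef sigma * M sigma w)
    <= (perm_eq tau sigma)%:R * (F tau / 2 + F sigma / 2).
  have rhs0 : 0 <= (perm_eq tau sigma)%:R * (F tau / 2 + F sigma / 2).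
    by rewrite mulr_ge0// addr_ge0// divr_ge0.
  have [ut|/a0 t0] := boolP (uniq tau); last first.
    rewrite (eq_ip _ (f' := fun=> 0) (g' := fun w => el_coef sigma * M sigma w))//.
      by rewrite ip0l.
    by move=> w; rewrite t0 mul0r.
  have [us|/a0 s0] := boolP (uniq sigma); last first.
    rewrite ipC (eq_ip _ (f' := fun=> 0) (g' := fun w => el_coef tau * M tau w))//.
      by rewrite ip0l.
    by move=> w; rewrite s0 mul0r.
  have [Mt st] := L2_prod_compensated Pcomplete prm mA tA Aoo predT ut.
  have [Ms _] := L2_prod_compensated Pcomplete prm mA tA Aoo predT us.
  have -> : ip P (fun w => el_coef tau * M tau w) (fun w => el_coef sigma * M sigma w) =
      el_coef tau * el_coef sigma * ip P (fun w => \prod_(i <- tau) NH (el_set i) w)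
        (fun w => \prod_(i <- sigma) NH (el_set i) w).
    rewrite -mulrA -ipZr// -ipZl//; last exact: L2Z.
    by apply: eq_ip => w; rewrite ME.
  (* Two tuples of the same length without repetitions that are not rearrangements of each other
     differ by an entry, which gives orthogonality. *)
  have [ts|nts] := boolP (perm_eq tau sigma); last first.
    suff [j js jt] : exists2 j, j \in sigma & j \notin tau.
      by rewrite (ip_prod_orth Pcomplete prm mA tA Aoo ut us js jt) mulr0 mul0r.
    apply: contrapT => h; move/negP : nts; apply; rewrite seq.perm_sym.
    have sub : {subset sigma <= tau}.
      by move=> j js; apply/negPn/negP => jt; apply: h; exists j.
    have [] := uniq_min_size us sub; first by rewrite !size_tuple.
    by move=> _ /(uniq_perm us ut).
  have -> : ip P (fun w => \prod_(i <- tau) NH (el_set i) w)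
        (fun w => \prod_(i <- sigma) NH (el_set i) w) = L tau.
    rewrite LE -st /sqn; apply: eq_ip => // w.
    by apply: perm_big; rewrite seq.perm_sym.
  have LL : L sigma = L tau by rewrite !LE; apply: perm_big; rewrite seq.perm_sym.
  rewrite mul1r /F LL; have := L_ge0 tau.
  have := sqr_ge0 (el_coef tau - el_coef sigma).
  move: (el_coef tau) (el_coef sigma) (L tau) => x y z; nra.
have -> : \sum_(i : n.-tuple 'I_(el_size e))
   ip P (fun w => el_coef i * M i w) (elementary_integral m N e) =
   \sum_(tau : n.-tuple 'I_(el_size e)) \sum_(sigma : n.-tuple 'I_(el_size e))
    ip P (fun w => el_coef tau * M tau w) (fun w => el_coef sigma * M sigma w).
  apply: eq_bigr => tau _; rewrite ipC ip_suml; last exact: L2_elementary_term.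
    by apply: eq_bigr => sigma _; rewrite ipC.
  by move=> sigma _; exact: L2_elementary_term.
apply: (@le_trans _ _ (\sum_(tau : n.-tuple 'I_(el_size e)) \sum_(sigma : n.-tuple 'I_(el_size e))
    (perm_eq tau sigma)%:R * (F tau / 2 + F sigma / 2))).
  by apply: ler_sum => tau _; apply: ler_sum => sigma _; exact: H.
have card (tau : n.-tuple 'I_(el_size e)) : \sum_(sigma : n.-tuple 'I_(el_size e)) (perm_eq tau sigma)%:R <= n`!%:R :> R.
  rewrite -natr_sum ler_nat (leq_trans _ (card_perm_eq tau))// -sum1_card.
  by rewrite big_mkcond/= [leqRHS]big_mkcond/= leq_sum// => s _; rewrite inE; case: perm_eq.
have half : \sum_(tau : n.-tuple 'I_(el_size e)) \sum_(sigma : n.-tuple 'I_(el_size e))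
    (perm_eq tau sigma)%:R * (F tau / 2) <= n`!%:R * (\sum_(tau : n.-tuple 'I_(el_size e)) F tau) / 2.
  rewrite -mulrA mulr_suml mulr_sumr; apply: ler_sum => tau _.
  by rewrite -mulr_suml ler_wpM2r// divr_ge0.
under eq_bigr do under eq_bigr do rewrite mulrDr.
under eq_bigr do rewrite big_split/=.
rewrite big_split/= [X in _ + X <= _]exchange_big/=.
have half2 : \sum_(j : n.-tuple 'I_(el_size e)) \sum_(i : n.-tuple 'I_(el_size e))
    (perm_eq i j)%:R * (F j / 2) <= n`!%:R * (\sum_(tau : n.-tuple 'I_(el_size e)) F tau) / 2.
  by under eq_bigr do under eq_bigr do rewrite seq.perm_sym.
apply: le_trans (lerD half half2) _.
by rewrite -splitr.
Qed.

End isometry.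

End elementary_integrals.

Lemma indic_bigsetU (T : Type) (R : pzRingType) (J : choiceType) (s : seq J) (p : pred J) (C : J -> set T) (z : T) :
  uniq s -> trivIset setT C ->
  \1_(\big[setU/set0]_(t <- s | p t) C t) z = \sum_(t <- s | p t) \1_(C t) z :> R.
Proof.
move=> us tC; have [|h] := pselect ((\big[setU/set0]_(t <- s | p t) C t) z).
  move=> Uz; rewrite [LHS]indicE mem_set//=; move: Uz.
  rewrite -bigcup_seq_cond => -[t /= /andP[ts pt] Ctz].
  rewrite big_mkcond (bigD1_seq t)//= pt indicE mem_set//= big1 ?addr0// => u ut.
  case: ifP => // _; rewrite indicE memNset// => Cuz; move/eqP : ut; apply.
  by apply: tC => //; exists z.
rewrite indicE memNset//= big_seq_cond big1// => t /andP[ts pt].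
rewrite indicE memNset// => Ctz; apply: h; rewrite -bigcup_seq_cond.
by exists t => //=; rewrite ts.
Qed.

Section lincomb.
Context d (Omega : measurableType d) d' (Z : measurableType d') (R : realType).
Variables (P : probability Omega R) (m : {sigma_finite_measure set Z -> \bar R}).
Variable N : R.-ker Omega ~> Z.
Hypothesis Pcomplete : measure_is_complete P.
Hypothesis prm : poisson_random_measure P m N.
Local Notation NH := (compensated m N).
Local Notation mm n := (power_measure m n : {measure set (n.-tuple Z) -> \bar R}).

Section refinement.
Variables (k k' : nat) (A : 'I_k -> set Z) (A' : 'I_k' -> set Z).
Hypotheses (mA : forall i, measurable (A i) /\ (m (A i) < +oo)%E) (tA : trivIset setT A).
Hypotheses (mA' : forall i, measurable (A' i) /\ (m (A' i) < +oo)%E) (tA' : trivIset setT A').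

Let J := (option 'I_k * option 'I_k')%type.

Let part k (A : 'I_k -> set Z) (o : option 'I_k) : set Z :=
  if o is Some i then A i else ~` \bigcup_i A i.

(* The parts of the common refinement; [None] stands for what the other family leaves uncovered,
   and [(None, None)] is emptied since it may have infinite measure. *)
Definition common_part (c : J) : set Z :=
  if c == (None, None) then set0 else part A c.1 `&` part A' c.2.

Let mpart l (B : 'I_l -> set Z) : (forall i, measurable (B i)) -> forall o, measurable (part B o).
Proof.
move=> mB [i|] //=; apply: measurableC.
by apply: fin_bigcup_measurable => //; exact: finite_finset.
Qed.

Let tpart l (B : 'I_l -> set Z) : trivIset setT B -> trivIset setT (part B).
Proof.
move=> tB [i|] [j|] _ _ [z []] /=.
- by move=> Bi Bj; congr Some; apply: tB => //; exists z.
- by move=> Bi; case; exists i.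
- by move=> nB Bj; case: nB; exists j.
- by [].
Qed.

Lemma measurable_common_part c : measurable (common_part c) /\ (m (common_part c) < +oo)%E.
Proof.
have m1 : measurable (common_part c).
  rewrite /common_part; case: ifP => // _.
  by apply: measurableI; apply: mpart => i; [have [] := mA i|have [] := mA' i].
split => //; move: m1; rewrite /common_part; case: ifP => [_ _|]; first by rewrite measure0 ltry.
case: c => -[i|] [j|]//= _ mc.
- have [mi ioo] := mA i; apply: le_lt_trans ioo; apply: le_measure; rewrite ?inE//.
- have [mi ioo] := mA i; apply: le_lt_trans ioo; apply: le_measure; rewrite ?inE//.
- have [mi ioo] := mA' j; apply: le_lt_trans ioo; apply: le_measure; rewrite ?inE//.
Qed.

Lemma trivIset_common_part : trivIset setT common_part.
Proof.
move=> [a b] [a' b'] _ _ [z []]; rewrite /common_part.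
case: ifP => // _; case: ifP => // _ /= [Aa Ab] [Aa' Ab'].
by congr (_, _); [apply: (tpart tA)|apply: (tpart tA')] => //; exists z.
Qed.

Lemma common_part1 i :
  A i = \big[setU/set0]_(c : 'I_#|{: J}| | (enum_val c).1 == Some i) common_part (enum_val c).
Proof.
apply/seteqP; split => z.
  move=> Az; rewrite -bigcup_seq_cond.
  have [[j Aj]|nA'] := pselect ((\bigcup_j A' j) z).
    move=> A'z; exists (enum_rank (Some i, Some j)); rewrite /= ?mem_index_enum enum_rankK//=.
  exists (enum_rank (Some i, None)); rewrite /= ?mem_index_enum enum_rankK//=.
rewrite -bigcup_seq_cond => -[c /=]; case: (enum_val c) => [a b] /=.
by move=> /andP[_ /eqP ->]; rewrite /common_part/= => -[].
Qed.

Lemma common_part2 i :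
  A' i = \big[setU/set0]_(c : 'I_#|{: J}| | (enum_val c).2 == Some i) common_part (enum_val c).
Proof.
apply/seteqP; split => z.
  move=> Az; rewrite -bigcup_seq_cond.
  have [[j Aj]|nA'] := pselect ((\bigcup_j A j) z).
    move=> A'z; exists (enum_rank (Some j, Some i)); rewrite /= ?mem_index_enum enum_rankK//=.
  exists (enum_rank (None, Some i)); rewrite /= ?mem_index_enum enum_rankK//=.
rewrite -bigcup_seq_cond => -[c /=]; case: (enum_val c) => [a b] /=.
by move=> /andP[_ /eqP ->]; rewrite /common_part; case: ifP => [/eqP[]//|_ []].
Qed.

End refinement.

(** Both kernels are elementary over the parts of the common refinement, with lifted coefficients.
    For the integrals the identity is almost sure only, like the additivity of the compensated
    count. *)
Lemma elementary_lincomb n (e e' : elementary Z R n) (c c' : R) :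
  is_elementary m e -> is_elementary m e' ->
  exists e'' : elementary Z R n, [/\ is_elementary m e'',
    forall t, elementary_fun e'' t = c * elementary_fun e t + c' * elementary_fun e' t &
    {ae P, forall w, elementary_integral m N e'' w =
       c * elementary_integral m N e w + c' * elementary_integral m N e' w}].
Proof.
move=> [mA tA a0] [mA' tA' a0'].
pose J := (option 'I_(el_size e) * option 'I_(el_size e'))%type.
pose C (j : 'I_#|{: J}|) := common_part (el_set (e := e)) (el_set (e := e')) (enum_val j).
have mC j : measurable (C j) /\ (m (C j) < +oo)%E by exact: measurable_common_part.
have tC : trivIset setT C.
  by move=> i j _ _ h; apply: enum_val_inj; exact: (trivIset_common_part tA tA' I I h).
pose pi1 (j : 'I_#|{: J}|) := (enum_val j).1.
pose pi2 (j : 'I_#|{: J}|) := (enum_val j).2.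
exists (Elementary C (fun s => c * lift_coef pi1 (el_coef (e := e)) s
                             + c' * lift_coef pi2 (el_coef (e := e')) s)).
split.
- split => //= s us; rewrite !lift_coef_diag// !mulr0 addr0//.
- move=> t; rewrite /elementary_fun/=.
  under eq_bigr do rewrite mulrDl -!mulrA.
  rewrite big_split/= -!mulr_sumr; congr (_ * _ + _ * _); apply/esym.
    apply: (@lift_coef_sum _ _ _ _ pi1 (el_coef (e := e)) (fun j i => \1_(el_set i) (tnth t j))
      (fun j i => \1_(C i) (tnth t j))) => j i.
    rewrite (common_part1 (el_set (e := e)) (el_set (e := e')) i) indic_bigsetU//.
    exact: index_enum_uniq.
  apply: (@lift_coef_sum _ _ _ _ pi2 (el_coef (e := e')) (fun j i => \1_(el_set i) (tnth t j))
    (fun j i => \1_(C i) (tnth t j))) => j i.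
  rewrite (common_part2 (el_set (e := e)) (el_set (e := e')) i) indic_bigsetU//.
  exact: index_enum_uniq.
have cs (p : pred 'I_#|{: J}|) : {ae P, forall w, NH (\big[setU/set0]_(j | p j) C j) w = \sum_(j | p j) NH (C j) w}.
  have := compensated_sum prm (filter_uniq p (index_enum_uniq _)) (fun j => (mC j).1) tC (fun j => (mC j).2).
  by apply: filterS => w; rewrite !big_filter.
have H1 : {ae P, forall w, forall i : 'I_(el_size e), NH (el_set i) w = \sum_(j | pi1 j == Some i) NH (C j) w}.
  apply: filter_forall => i; have := cs (fun j => pi1 j == Some i).
  by rewrite -(common_part1 (el_set (e := e)) (el_set (e := e')) i).
have H2 : {ae P, forall w, forall i : 'I_(el_size e'), NH (el_set i) w = \sum_(j | pi2 j == Some i) NH (C j) w}.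
  apply: filter_forall => i; have := cs (fun j => pi2 j == Some i).
  by rewrite -(common_part2 (el_set (e := e)) (el_set (e := e')) i).
apply: filterS2 H1 H2 => w h1 h2; rewrite /elementary_integral/=.
under eq_bigr do rewrite mulrDl -!mulrA.
rewrite big_split/= -!mulr_sumr; congr (_ * _ + _ * _); apply/esym.
  by apply: (@lift_coef_sum _ _ _ _ pi1 (el_coef (e := e)) (fun j i => NH (el_set i) w)
    (fun j i => NH (C i) w)) => j i.
by apply: (@lift_coef_sum _ _ _ _ pi2 (el_coef (e := e')) (fun j i => NH (el_set i) w)
  (fun j i => NH (C i) w)) => j i.
Qed.

Lemma sqn_ae d1 (T : measurableType d1) (mu : {measure set T -> \bar R}) (f g : T -> R) :
  L2 mu f -> L2 mu g -> {ae mu, forall x, f x = g x} -> sqn mu f = sqn mu g.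
Proof. by move=> fL gL fg; exact: ip_ae. Qed.

Lemma sqn_elementary_integralB n (e e' : elementary Z R n) :
  is_elementary m e -> is_elementary m e' ->
  sqn P (elementary_integral m N e \- elementary_integral m N e') <=
    n`!%:R * sqn (mm n) (elementary_fun e \- elementary_fun e').
Proof.
move=> ele ele'; have [e'' [ele'' fE IE]] := elementary_lincomb 1 (-1) ele ele'.
have := sqn_elementary_integral_le Pcomplete prm ele''.
rewrite (_ : elementary_fun e'' = elementary_fun e \- elementary_fun e'); last first.
  by apply/funext => t; rewrite fE mul1r mulN1r.
rewrite (@sqn_ae _ _ _ _ (elementary_integral m N e \- elementary_integral m N e'))//.
- exact: L2_elementary_integral.
- by apply: L2B; exact: L2_elementary_integral.
- by apply: filterS IE => w ->; rewrite mul1r mulN1r.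
Qed.

Lemma sqn_cvg d1 (T : measurableType d1) (mu : {measure set T -> \bar R}) (u : nat -> T -> R) f g :
  (forall k, L2 mu (u k)) -> L2 mu f -> L2 mu g ->
  sqn mu (u k \- f) @[k --> \oo] --> 0 -> sqn mu (u k \- g) @[k --> \oo] --> sqn mu (f \- g).
Proof.
move=> uL fL gL uf.
have E k : (u k \- g) \- (f \- g) = u k \- f by apply/funext => x /=; ring.
apply: ip_cvg; try (by move=> k; exact: L2B); try exact: L2B.
  by under eq_fun do rewrite E.
by under eq_fun do rewrite E.
Qed.

Lemma multiple_integralP n (f : n.-tuple Z -> R) (G : Omega -> R) :
  is_multiple_integral P m N f G <->
  [/\ L2 (mm n) f, L2 P G & exists e : nat -> elementary Z R n,
    [/\ forall k, is_elementary m (e k),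
        sqn (mm n) (elementary_fun (e k) \- f) @[k --> \oo] --> 0 &
        sqn P (elementary_integral m N (e k) \- G) @[k --> \oo] --> 0]].
Proof.
split=> -[fL GL [e [ele c1 c2]]]; split => //; exists e; split => //.
- by apply/L2_normP => // k; apply: L2B => //; exact: L2_elementary_fun.
- by apply/L2_normP => // k; apply: L2B => //; exact: L2_elementary_integral.
- by apply/L2_normP => // k; apply: L2B => //; exact: L2_elementary_fun.
- by apply/L2_normP => // k; apply: L2B => //; exact: L2_elementary_integral.
Qed.

(** The bound between two elementary kernels passes to the limit in one of them. Hence any
    elementary kernels that converge to [f] have integrals converging to [G], whichever sequence
    defined [G]. *)
Lemma sqn_multiple_integralB n (f : n.-tuple Z -> R) (G : Omega -> R) (e : elementary Z R n) :
  is_multiple_integral P m N f G -> is_elementary m e ->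
  sqn P (G \- elementary_integral m N e) <= n`!%:R * sqn (mm n) (f \- elementary_fun e).
Proof.
move=> /multiple_integralP[fL GL [ek [elek c1 c2]]] ele.
have fe := L2_elementary_fun ele; have ie := L2_elementary_integral Pcomplete prm ele.
have fek k := L2_elementary_fun (elek k); have iek k := L2_elementary_integral Pcomplete prm (elek k).
have h1 := sqn_cvg fek fL fe c1.
have h2 := sqn_cvg iek GL ie c2.
have h3 : n`!%:R * sqn (mm n) (elementary_fun (ek k) \- elementary_fun e) @[k --> \oo] -->
    n`!%:R * sqn (mm n) (f \- elementary_fun e) by apply: cvgMl_tmp.
rewrite -(cvg_lim _ h2)// -(cvg_lim _ h3)//; apply: ler_lim.
- by apply/cvg_ex; eexists; exact: h2.
- by apply/cvg_ex; eexists; exact: h3.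
- by apply: nearW => k; exact: sqn_elementary_integralB.
Qed.

Lemma multiple_integral_noise n (f : n.-tuple Z -> R) (G : Omega -> R) :
  is_multiple_integral P m N f G -> measurable_wrt (noise_on P N setT) G.
Proof.
move=> /multiple_integralP[fL GL [e [ele _ c]]].
apply: (L2_cvg_measurable_wrt (mu := P) _ (fun k => L2_elementary_integral Pcomplete prm (ele k)) GL _ c).
  by move=> E nE; right.
by move=> k; exact: elementary_integral_noise.
Qed.

End lincomb.

Section duality.
Context d (Omega : measurableType d) d' (Z : measurableType d') (R : realType).
Variables (P : probability Omega R) (m : {sigma_finite_measure set Z -> \bar R}).
Variable N : R.-ker Omega ~> Z.
Hypothesis Pcomplete : measure_is_complete P.
Hypothesis prm : poisson_random_measure P m N.
Local Notation NH := (compensated m N).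
Local Notation mm n := (power_measure m n : {measure set (n.-tuple Z) -> \bar R}).
Local Notation II := (elementary_integral m N).

Lemma L2_power1 (f : 1.-tuple Z -> R) : L2 (mm 1) f ->
  L2 m (fun z => f [tuple z]) /\ sqn m (fun z => f [tuple z]) = sqn (mm 1) f.
Proof.
move=> fL; have mf := L2_measurable fL.
have mt : measurable_fun setT (fun z : Z => [tuple z]).
  by apply/measurable_fun_tnthP => i; rewrite (_ : _ \o _ = id)//;
    apply/funext => z /=; rewrite ord1.
have E : (\int[mm 1]_t (f t ^+ 2)%:E = \int[m]_z (f [tuple z] ^+ 2)%:E)%E.
  apply: integral_power_measure1; first by apply/measurable_EFinP; exact: measurable_funX.
  by move=> t; rewrite lee_fin sqr_ge0.
have L : L2 m (fun z => f [tuple z]).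
  apply/L2P; split; first exact: measurableT_comp mf mt.
  apply/integrableP; split.
    by apply/measurable_EFinP/measurable_funX; exact: measurableT_comp mf mt.
  under eq_integral do rewrite /= ger0_norm ?sqr_ge0//.
  by rewrite -E -sqnE// ltry.
by split => //; apply: EFin_inj; rewrite !sqnE.
Qed.

Lemma L2_power1_inv (g : Z -> R) : L2 m g -> L2 (mm 1) (fun t => g (tnth t ord0)).
Proof.
move=> /L2P[mg ig].
have mf : measurable_fun setT (fun t : 1.-tuple Z => g (tnth t ord0)).
  by apply: (measurableT_comp mg); exact: measurable_tnth.
apply/L2P; split => //; apply/integrableP; split.
  by apply/measurable_EFinP/measurable_funX.
under eq_integral do rewrite /= ger0_norm ?sqr_ge0//.
rewrite integral_power_measure1; last 2 first.
- by apply/measurable_EFinP/measurable_funX.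
- by move=> t; rewrite lee_fin sqr_ge0.
move/integrableP : ig => [_]; apply: le_lt_trans; rewrite le_eqVlt; apply/orP; left.
by apply/eqP; apply: eq_integral => z _ /=; rewrite ger0_norm ?sqr_ge0.
Qed.

Section order1.
Variable h : elementary Z R 1.
Hypothesis elh : is_elementary m h.

Definition order1_fun (z : Z) : R := elementary_fun h [tuple z].

Lemma order1_funE z : order1_fun z =
  \sum_(r : 1.-tuple 'I_(el_size h)) el_coef r * \1_(el_set (tnth r ord0)) z.
Proof. by apply: eq_bigr => r _; rewrite big_ord1. Qed.

Lemma order1_integralE w : II h w =
  \sum_(r : 1.-tuple 'I_(el_size h)) el_coef r * NH (el_set (tnth r ord0)) w.
Proof. by apply: eq_bigr => r _; rewrite big_ord1. Qed.

Definition restrict_elementary (S : set Z) : elementary Z R 1 :=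
  Elementary (fun i => el_set (e := h) i `\` S) (el_coef (e := h)).

Lemma is_elementary_restrict S : measurable S -> is_elementary m (restrict_elementary S).
Proof.
move=> mS; case: elh => mA tA a0; split => //= [i|i j _ _ [z [[Ai _] [Aj _]]]].
  have [mi ioo] := mA i; split; first exact: measurableD.
  by apply: le_lt_trans ioo; apply: le_measure; rewrite ?inE//; exact: measurableD.
by apply: tA => //; exists z.
Qed.

End order1.

Lemma order1_fun_restrict (h : elementary Z R 1) S z :
  order1_fun (restrict_elementary h S) z = order1_fun h z * \1_(~` S) z.
Proof.
rewrite !order1_funE mulr_suml; apply: eq_bigr => r _.
by rewrite -mulrA /= setDE indicI.
Qed.

(** Since [g] vanishes on [S], removing [S] from the cells of an approximation can only bring it
    closer to [g]; the integrals follow by [sqn_multiple_integralB]. *)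
Lemma order1_approx (g : Z -> R) (L : Omega -> R) (S : set Z) : measurable S ->
  (forall z, S z -> g z = 0) ->
  is_multiple_integral P m N (fun t : 1.-tuple Z => g (tnth t ord0)) L ->
  exists h : nat -> elementary Z R 1,
    [/\ forall k, is_elementary m (h k), forall k i, el_set (e := h k) i `<=` ~` S,
        sqn m (order1_fun (h k) \- g) @[k --> \oo] --> 0 &
        sqn P (II (h k) \- L) @[k --> \oo] --> 0].
Proof.
move=> mS gS gL; have [fL LL [e [ele c1 _]]] := (multiple_integralP Pcomplete prm _ _).1 gL.
have elr k := is_elementary_restrict (ele k) mS.
exists (fun k => restrict_elementary (e k) S); split => //.
- by move=> k i z [].
- have [gL2 _] := L2_power1 fL.
  have c k : sqn m (order1_fun (restrict_elementary (e k) S) \- g) <=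
      sqn (mm 1) (elementary_fun (e k) \- (fun t => g (tnth t ord0))).
    have [L1 <-] := L2_power1 (L2B (L2_elementary_fun (ele k)) fL).
    have [L2' _] := L2_power1 (L2_elementary_fun (elr k)).
    apply: sqn_le => //; first exact: L2B.
    move=> z; rewrite /= -/(order1_fun (restrict_elementary (e k) S) z) -/(order1_fun (e k) z).
    rewrite order1_fun_restrict indicE; have [Sz|nSz] := pselect (S z).
      by rewrite memNset/= ?mulr0 ?gS ?subr0 ?normr0//; apply.
    by rewrite mem_set// mulr1.
  apply: (squeeze_cvgr _ (cvg_cst 0) c1).
  by apply: nearW => k; rewrite sqn_ge0/=; exact: c.
have c k : sqn P (II (restrict_elementary (e k) S) \- L) <=
     sqn (mm 1) (elementary_fun (e k) \- (fun t => g (tnth t ord0))).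
  rewrite sqnBC (le_trans (sqn_multiple_integralB Pcomplete prm gL (elr k)))//.
  rewrite mul1r sqnBC.
  have fr := L2_elementary_fun (elr k).
  apply: sqn_le; [exact: L2B|by apply: L2B => //; exact: L2_elementary_fun|].
  move=> t /=.
  have tE : t = [tuple tnth t ord0].
    by apply: eq_from_tnth => i; rewrite ord1.
  have := order1_fun_restrict (e k) S (tnth t ord0); rewrite /order1_fun -tE => ->.
  rewrite indicE; have [Sz|nSz] := pselect (S (tnth t ord0)).
    by rewrite memNset/= ?mulr0 ?gS ?subr0 ?normr0//; apply.
  by rewrite mem_set// mulr1.
apply: (squeeze_cvgr _ (cvg_cst 0) c1).
by apply: nearW => k; rewrite sqn_ge0/=; exact: c.
Qed.

End duality.

(** * Duality on a cell *)

Section tuple_reindex.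
Variables (R : realType) (J : finType).

Lemma tnth_rcons_widen n (r : n.-tuple J) (i : J) (l : 'I_n) :
  tnth [tuple of rcons r i] (widen_ord (leqnSn n) l) = tnth r l.
Proof. by rewrite !(tnth_nth i)/= nth_rcons size_tuple ltn_ord. Qed.

Lemma tnth_rcons_last n (r : n.-tuple J) (i : J) : tnth [tuple of rcons r i] ord_max = i.
Proof. by rewrite (tnth_nth i)/= nth_rcons size_tuple ltnn eqxx. Qed.

Lemma sum_tuple_rcons n (F : n.+1.-tuple J -> R) :
  \sum_(t : n.+1.-tuple J) F t = \sum_(r : n.-tuple J) \sum_(i : J) F [tuple of rcons r i].
Proof.
rewrite pair_big/= (reindex (fun p : n.-tuple J * J => [tuple of rcons p.1 p.2]))//.
exists (fun t => ([tuple tnth t (widen_ord (leqnSn n) i) | i < n], tnth t ord_max)).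
  move=> [r i] _ /=; rewrite tnth_rcons_last; congr (_, _).
  by apply: eq_from_tnth => l; rewrite tnth_mktuple tnth_rcons_widen.
move=> t _; apply: eq_from_tnth => l /=.
have [ln|nl] := ltnP l n.
  have -> : l = widen_ord (leqnSn n) (Ordinal ln) by exact: val_inj.
  by rewrite tnth_rcons_widen tnth_mktuple.
have -> : l = ord_max by apply: val_inj => /=; apply/eqP; rewrite eqn_leq nl -ltnS ltn_ord.
by rewrite tnth_rcons_last.
Qed.

Lemma sum_tuple_perm n (s : 'S_n) (F : n.-tuple J -> R) :
  \sum_(t : n.-tuple J) F t = \sum_(t : n.-tuple J) F [tuple tnth t (s i) | i < n].
Proof.
rewrite (reindex (fun t : n.-tuple J => [tuple tnth t (s i) | i < n]))//.
exists (fun t : n.-tuple J => [tuple tnth t ((s^-1)%g i) | i < n]) => t _.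
  by apply: eq_from_tnth => l; rewrite !tnth_mktuple permKV.
by apply: eq_from_tnth => l; rewrite !tnth_mktuple permK.
Qed.

End tuple_reindex.

Section duality.
Context d (Omega : measurableType d) d' (Z : measurableType d') (R : realType).
Variables (P : probability Omega R) (m : {sigma_finite_measure set Z -> \bar R}).
Variable N : R.-ker Omega ~> Z.
Hypothesis Pcomplete : measure_is_complete P.
Hypothesis prm : poisson_random_measure P m N.
Local Notation NH := (compensated m N).
Local Notation mm n := (power_measure m n : {measure set (n.-tuple Z) -> \bar R}).
Local Notation II := (elementary_integral m N).

Definition perm_elementary n (s : 'S_n) (e : elementary Z R n) : elementary Z R n :=
  Elementary (el_set (e := e)) (fun t => el_coef (e := e) [tuple tnth t (s i) | i < n]).

Lemma is_elementary_perm n (s : 'S_n) (e : elementary Z R n) :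
  is_elementary m e -> is_elementary m (perm_elementary s e).
Proof.
case=> mA tA a0; split => //= t ut; apply: a0; apply: contra ut => us.
apply/tuple_uniqP => i j tij; apply: (@perm_inj _ (s^-1)%g).
move/tuple_uniqP : us; apply; rewrite !tnth_mktuple !permKV//.
Qed.

Lemma perm_elementary_fun n (s : 'S_n) (e : elementary Z R n) t :
  elementary_fun (perm_elementary s e) t = elementary_fun e (tuple_perm s t).
Proof.
rewrite /elementary_fun/= [RHS](sum_tuple_perm s); apply: eq_bigr => tau _.
congr (_ * _); rewrite (reindex_inj (@perm_inj _ s))/=.
by apply: eq_bigr => j _; rewrite !tnth_mktuple.
Qed.

(** The power measure is invariant under permutations and [f] is symmetric, so a permuted
    approximation is exactly as close to [f] as the original one. *)
Lemma sqn_perm_elementary n (s : 'S_n) (e : elementary Z R n) f : is_elementary m e ->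
  L2 (mm n) f -> symmetric_kernel m f ->
  sqn (mm n) (elementary_fun (perm_elementary s e) \- f) = sqn (mm n) (elementary_fun e \- f).
Proof.
move=> ele fL fs; have eL := L2_elementary_fun ele.
have [sL <-] := sqn_tuple_perm s (L2B eL fL).
apply: sqn_ae => //.
  by apply: L2B => //; apply: L2_elementary_fun; exact: is_elementary_perm.
have := fs s; apply: filterS => t ft.
by rewrite /= perm_elementary_fun -[in LHS]ft.
Qed.

Section slice.
Variables (n : nat) (e : elementary Z R n.+1).
Hypothesis ele : is_elementary m e.

Let mA i : measurable (el_set (e := e) i). Proof. by case: ele => /(_ i)[]. Qed.
Let Aoo i : (m (el_set (e := e) i) < +oo)%E. Proof. by case: ele => /(_ i)[]. Qed.
Let tA : trivIset setT (el_set (e := e)). Proof. by case: ele. Qed.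
Let a0 (tau : n.+1.-tuple 'I_(el_size e)) : ~~ uniq tau -> el_coef tau = 0.
Proof. by case: ele => _ _; apply. Qed.

(** The last variable is frozen at [z]. The cells are kept and [z] enters the coefficients only, so
    that the integral of the slice is a finite sum of products of a function on Omega and a function
    on Z. *)
Definition slice (z : Z) : elementary Z R n :=
  Elementary (el_set (e := e))
    (fun r => \sum_(i : 'I_(el_size e)) el_coef [tuple of rcons r i] * \1_(el_set i) z).

Lemma is_elementary_slice z : is_elementary m (slice z).
Proof.
split => //= r ur; rewrite big1// => i _; rewrite a0 ?mul0r//=.
by apply: contra ur; rewrite rcons_uniq => /andP[].
Qed.

Lemma slice_fun z t : elementary_fun (slice z) t = elementary_fun e (tuple_rcons (t, z)).
Proof.
rewrite /elementary_fun/= sum_tuple_rcons; apply: eq_bigr => r _.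
rewrite mulr_suml; apply: eq_bigr => i _; rewrite -mulrA; congr (_ * _).
have tl : tnth (tuple_rcons (t, z)) ord_max = z.
  by rewrite (tnth_nth z)/= nth_rcons size_tuple ltnn eqxx.
have tw j : tnth (tuple_rcons (t, z)) (widen_ord (leqnSn n) j) = tnth t j.
  by rewrite !(tnth_nth z)/= nth_rcons size_tuple ltn_ord.
rewrite big_ord_recr/= tnth_rcons_last tl mulrC; congr (_ * _).
by apply: eq_bigr => j _; rewrite tnth_rcons_widen tw.
Qed.

Definition slice_integral (u : Omega * Z) : R := II (slice u.2) u.1.

Let M (r : n.-tuple 'I_(el_size e)) w := \prod_(l < n) NH (el_set (tnth r l)) w.

Let L2M (r : n.-tuple 'I_(el_size e)) : uniq r -> L2 P (M r).
Proof.
move=> ur; have [+ _] := L2_prod_compensated Pcomplete prm mA tA Aoo predT ur.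
by rewrite (_ : (fun w => _) = M r)//; apply/funext => w; rewrite big_tuple.
Qed.

Lemma slice_integralE u : slice_integral u =
  \sum_(r : n.-tuple 'I_(el_size e)) \sum_(i : 'I_(el_size e))
    el_coef [tuple of rcons r i] * (M r u.1 * \1_(el_set i) u.2).
Proof.
apply: eq_bigr => r _; rewrite mulr_suml; apply: eq_bigr => i _.
by rewrite -mulrA [\1_ _ _ * _]mulrC.
Qed.

Let Lterm (r : n.-tuple 'I_(el_size e)) (i : 'I_(el_size e)) : L2 (P \x m)%E
  (fun u => el_coef [tuple of rcons r i] * (M r u.1 * \1_(el_set (e := e) i) u.2)).
Proof.
have [u|/a0 u] := boolP (uniq [tuple of rcons r i]); last first.
  by under eq_fun do rewrite u mul0r; exact: L2_0.
apply: L2Z; apply: L2_tensor; first by apply: L2M; move: u; rewrite rcons_uniq => /andP[].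
exact: (L2_indic (mA i) (Aoo i)).
Qed.

Lemma L2_slice_integral : L2 (P \x m)%E slice_integral.
Proof.
rewrite (_ : slice_integral = fun u => \sum_(r : n.-tuple 'I_(el_size e))
  \sum_(i : 'I_(el_size e)) el_coef [tuple of rcons r i] * (M r u.1 * \1_(el_set i) u.2)).
  by apply: L2_sum => r _; apply: L2_sum => i _; exact: Lterm.
by apply/funext => u; rewrite slice_integralE.
Qed.

(** Each term is a tensor product, so its pairing splits into an expectation without the factor of
    the last cell and an integral of [q] over that cell. *)
Lemma ip_slice_integral (Y : Omega -> R) (q : Z -> R) : L2 P Y -> L2 m q ->
  ip (P \x m)%E slice_integral (fun u => Y u.1 * q u.2) =
  \sum_(t : n.+1.-tuple 'I_(el_size e)) el_coef t *
    (Rintegral P setT (fun w => Y w * \prod_(l < n.+1 | l != ord_max) NH (el_set (tnth t l)) w)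
     * ip m (\1_(el_set (tnth t ord_max))) q).
Proof.
move=> YL qL; have YqL := L2_tensor YL qL.
rewrite (eq_ip _ slice_integralE (fun u => erefl)) ip_suml//; last first.
  by move=> r _; apply: L2_sum => i _; exact: Lterm.
rewrite sum_tuple_rcons; apply: eq_bigr => r _; rewrite ip_suml//.
apply: eq_bigr => i _.
have [u|/a0 u] := boolP (uniq [tuple of rcons r i]); last first.
  rewrite u mul0r (eq_ip _ (f' := fun=> 0) (fun u => _) (fun u => erefl)) ?ip0l// => v.
  by rewrite mul0r.
have rL : L2 P (M r) by apply: L2M; move: u; rewrite rcons_uniq => /andP[].
have iL : L2 m (\1_(el_set (e := e) i) : Z -> R) by exact: (L2_indic (mA i) (Aoo i)).
rewrite ipZl//; last exact: L2_tensor.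
rewrite ip_tensor// tnth_rcons_last; congr (_ * (_ * _)).
apply: eq_Rintegral => w _; rewrite mulrC; congr (_ * _).
rewrite /M [RHS]big_mkcond/= big_ord_recr/= eqxx mulr1.
apply: eq_bigr => l _; rewrite tnth_rcons_widen ifT//.
by rewrite -val_eqE/= neq_ltn ltn_ord.
Qed.

End slice.

(** For almost every z, the bound of order n applies to f(., z) and the slice at z; integrated over
    z, its right-hand side becomes a norm of order n + 1 by Tonelli. *)
Lemma sqn_slice_integral n (f : n.+1.-tuple Z -> R) (W : Omega * Z -> R) (e : elementary Z R n.+1) :
  is_elementary m e -> L2 (mm n.+1) f -> L2 (P \x m)%E W ->
  {ae m, forall z, is_multiple_integral P m N (fun t => f (tuple_rcons (t, z))) (fun w => W (w, z))} ->
  sqn (P \x m)%E (W \- slice_integral e) <= n`!%:R * sqn (mm n.+1) (f \- elementary_fun e).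
Proof.
move=> ele fL WL Wf.
have eL := L2_elementary_fun ele; have sL := L2_slice_integral ele.
have feL := L2B fL eL; have WsL := L2B WL sL.
have mF : measurable_fun setT (fun t => ((f \- elementary_fun e) t ^+ 2)%:E).
  by apply/measurable_EFinP/measurable_funX; exact: L2_measurable feL.
have mG : measurable_fun setT (fun u => ((W \- slice_integral e) u ^+ 2)%:E).
  by apply/measurable_EFinP/measurable_funX; exact: L2_measurable WsL.
rewrite -lee_fin EFinM !sqnE// integral_power_measureS//; last by move=> t; rewrite lee_fin sqr_ge0.
rewrite fubini_tonelli2//=; last by move=> u; rewrite lee_fin sqr_ge0.
have mH : measurable_fun setT (fun z => \int[mm n]_t ((f (tuple_rcons (t, z)) - elementary_fun e (tuple_rcons (t, z))) ^+ 2)%:E)%E.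
  apply: (@measurable_fun_fubini_tonelli_G _ _ _ _ _ (mm n) (fun u => ((f \- elementary_fun e) (tuple_rcons u) ^+ 2)%:E)).
    by apply: measurableT_comp mF _; exact: measurable_tuple_rcons.
  by move=> u; rewrite lee_fin sqr_ge0.
rewrite -ge0_integralZl//; last first.
  by move=> z _; apply: integral_ge0 => t _; rewrite lee_fin sqr_ge0.
apply: ae_ge0_le_integral => //.
- by move=> z _; apply: integral_ge0 => t _; rewrite lee_fin sqr_ge0.
- apply: (@measurable_fun_fubini_tonelli_G _ _ _ _ _ P (fun u => ((W \- slice_integral e) u ^+ 2)%:E)) => //.
  by move=> u; rewrite lee_fin sqr_ge0.
- by move=> z _; rewrite mule_ge0 ?lee_fin//; apply: integral_ge0 => t _; rewrite lee_fin sqr_ge0.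
- exact: measurable_funeM.
apply: filterS Wf => z Wz _.
have els := is_elementary_slice ele z.
have := sqn_multiple_integralB Pcomplete prm Wz els.
have [fz Wz' _] := (multiple_integralP Pcomplete prm _ _).1 Wz.
rewrite -lee_fin EFinM !sqnE; last 2 first.
- by apply: L2B => //; exact: L2_elementary_fun.
- by apply: L2B => //; exact: L2_elementary_integral.
by under [X in (_ <= _ * X)%E -> _]eq_integral do rewrite /= slice_fun.
Qed.

Section cell.
Variables (S : set Z) (Y : Omega -> R) (M : R).
Hypotheses (mS : measurable S) (mY : measurable_wrt (noise_on P N S) Y) (YM : forall w, `|Y w| <= M).

Let mY' : measurable_fun setT Y. Proof. exact: measurable_noise_wrt mY. Qed.

Let YL : L2 P Y.
Proof.
have := L2_boundedM mY' YM (L2_cst P 1).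
by rewrite (_ : (fun w => _) = Y)//; apply/funext => w; rewrite mulr1.
Qed.

(** [prod_compensated_ibp] gives one summand for each position j: the j-th factor disappears and its
    cell is paired with [h]. Exchanging j with the last position turns the summand into a pairing
    with a slice. *)
Lemma elementary_duality n (e : elementary Z R n.+1) (h : elementary Z R 1) :
  is_elementary m e -> is_elementary m h -> (forall i, el_set (e := h) i `<=` ~` S) ->
  ip P (II e) (fun w => Y w * II h w) =
  \sum_(j < n.+1) ip (P \x m)%E (slice_integral (perm_elementary (tperm j ord_max) e))
    (fun u => Y u.1 * order1_fun h u.2).
Proof.
move=> ele elh hS; have := ele => -[mA tA a0]; have := elh => -[mB _ _].
have hL : L2 P (II h) by exact: L2_elementary_integral.
have YhL : L2 P (fun w => Y w * II h w) by exact: (L2_boundedM mY' YM).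
have [qL _] := L2_power1 (L2_elementary_fun elh).
rewrite -/(order1_fun h) in qL.
pose G i := ip m (\1_(el_set (e := e) i)) (order1_fun h).
pose Q (t : n.+1.-tuple 'I_(el_size e)) j :=
  Rintegral P setT (fun w => Y w * \prod_(l < n.+1 | l != j) NH (el_set (tnth t l)) w).
have GE i : G i = \sum_(r : 1.-tuple 'I_(el_size h))
    el_coef r * fine (m (el_set i `&` el_set (tnth r ord0))).
  have iL : L2 m (\1_(el_set (e := e) i) : Z -> R) by apply: L2_indic; have [] := mA i.
  have jL r : L2 m (\1_(el_set (e := h) r) : Z -> R) by apply: L2_indic; have [] := mB r.
  rewrite /G ipC (eq_ip _ (order1_funE h) (fun u => erefl)) ip_suml//; last first.
    by move=> r _; exact: L2Z.
  apply: eq_bigr => r _; rewrite ipZl// ip_indic; [|by have [] := mB (tnth r ord0)|by have [] := mA i].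
  by rewrite setIC.
transitivity (\sum_(t : n.+1.-tuple 'I_(el_size e)) el_coef t * \sum_(j < n.+1) Q t j * G (tnth t j)).
  rewrite ip_suml//; last by move=> t _; exact: L2_elementary_term.
  apply: eq_bigr => t _.
  have [u|/a0 u] := boolP (uniq t); last first.
    rewrite u mul0r (eq_ip _ (f' := fun=> 0) (fun u => _) (fun u => erefl)) ?ip0l// => v.
    by rewrite mul0r.
  have [tL _] := L2_prod_compensated Pcomplete prm (fun i => (mA i).1) tA (fun i => (mA i).2) predT u.
  have tL' : L2 P (fun w => \prod_(j < n.+1) NH (el_set (tnth t j)) w).
    by move: tL; rewrite (_ : (fun w => _) = (fun w => \prod_(j < n.+1) NH (el_set (tnth t j)) w))//;
      apply/funext => w; rewrite big_tuple.
  rewrite ipZl//; congr (_ * _).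
  transitivity (ip P (fun w => \sum_(r : 1.-tuple 'I_(el_size h)) el_coef r * NH (el_set (tnth r ord0)) w)
                     (fun w => Y w * \prod_(i <- t) NH (el_set i) w)).
    rewrite ipC /ip; apply: eq_Rintegral => w _.
    by rewrite order1_integralE big_tuple; ring.
  have YtL : L2 P (fun w => Y w * \prod_(i <- t) NH (el_set i) w) by exact: (L2_boundedM mY' YM).
  have NL r : L2 P (NH (el_set (e := h) r)) by apply: L2_compensated => //; have [] := mB r.
  rewrite ip_suml//; last by move=> r _; exact: L2Z.
  transitivity (\sum_(r : 1.-tuple 'I_(el_size h)) \sum_(j < n.+1)
     Q t j * (el_coef r * fine (m (el_set (tnth t j) `&` el_set (tnth r ord0))))).
    apply: eq_bigr => r _; rewrite ipZl// ipC.
    have [mBr Broo] := mB (tnth r ord0).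
    rewrite (prod_compensated_ibp Pcomplete prm (fun i => (mA i).1) tA (fun i => (mA i).2) mY YM u mBr Broo (hS _)).
    rewrite big_tuple mulr_sumr; apply: eq_bigr => j _.
    rewrite mulrCA; congr (_ * _); apply: eq_Rintegral => w _; congr (_ * _).
    rewrite big_tuple; apply: eq_bigl => l; congr negb.
    by apply/eqP/eqP => [|->//]; move/tuple_uniqP : u; apply.
  rewrite exchange_big/=; apply: eq_bigr => j _.
  by rewrite GE mulr_sumr.
under eq_bigr do rewrite mulr_sumr.
rewrite exchange_big/=; apply: eq_bigr => j _.
have elp := is_elementary_perm (tperm j ord_max) ele.
rewrite ip_slice_integral//=.
(* The transposition is an involution: applied to the summation index as well, it restores the
   coefficients of [e]. *)
rewrite [RHS](sum_tuple_perm (tperm j ord_max)); apply: eq_bigr => t _.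
congr (_ * (_ * _)).
- congr el_coef; apply: eq_from_tnth => i; rewrite !tnth_mktuple tpermK//.
- apply: eq_Rintegral => w _; congr (_ * _).
  rewrite [RHS](reindex_inj (@perm_inj _ (tperm j ord_max)))/=.
  apply: eq_big => [l|l _]; last by rewrite !tnth_mktuple tpermK.
  by rewrite -{2}(tpermL j ord_max) (inj_eq perm_inj).
- by rewrite tnth_mktuple tpermR.
Qed.

(** The permuted kernels all converge to [f], so the n + 1 terms of [elementary_duality] have a
    common limit; this is the factor n + 1. The bound on [Y] makes the products with [Y] converge in
    L^2. *)
Lemma cell_duality n (f : n.+1.-tuple Z -> R) (J : Omega -> R) (W : Omega * Z -> R)
    (g : Z -> R) (L : Omega -> R) :
  symmetric_kernel m f -> is_multiple_integral P m N f J -> L2 (P \x m)%E W ->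
  {ae m, forall z, is_multiple_integral P m N (fun t => f (tuple_rcons (t, z))) (fun w => W (w, z))} ->
  (forall z, S z -> g z = 0) ->
  is_multiple_integral P m N (fun t : 1.-tuple Z => g (tnth t ord0)) L ->
  n.+1%:R * ip (P \x m)%E W (fun u => Y u.1 * g u.2) = ip P J (fun w => Y w * L w).
Proof.
move=> fs fJ WL Wf gS gL.
have [fL JL [e [ele c1 c2]]] := (multiple_integralP Pcomplete prm _ _).1 fJ.
have [h [elh hS c3 c4]] := order1_approx Pcomplete prm mS gS gL.
have [gL1 LL _] := (multiple_integralP Pcomplete prm _ _).1 gL.
have [gL2 _] := L2_power1 gL1.
have hqL k : L2 m (order1_fun (h k)) by have [] := L2_power1 (L2_elementary_fun (elh k)).
have hL k : L2 P (II (h k)) by exact: L2_elementary_integral.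
have YLL (X : Omega -> R) : L2 P X -> L2 P (fun w => Y w * X w).
  by move=> XL; exact: (L2_boundedM mY' YM).
have lhs : ip P (II (e k)) (fun w => Y w * II (h k) w) @[k --> \oo] --> ip P J (fun w => Y w * L w).
  apply: ip_cvg => //.
  - by move=> k; exact: L2_elementary_integral.
  - by move=> k; exact: YLL.
  - exact: YLL.
  - have c k : sqn P ((fun w => Y w * II (h k) w) \- (fun w => Y w * L w)) <= M ^+ 2 * sqn P (II (h k) \- L).
      rewrite -sqnZ; last exact: L2B.
      apply: sqn_le; [by apply: L2B; exact: YLL|by apply: L2Z; exact: L2B|].
      move=> w /=; rewrite -mulrBr !normrM ler_wpM2r//.
      by rewrite (le_trans (YM w))// ler_norm.
    have c' : M ^+ 2 * sqn P (II (h k) \- L) @[k --> \oo] --> 0.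
      by rewrite -[X in _ --> X](mulr0 (M ^+ 2)); apply: cvgMl_tmp.
    apply: (squeeze_cvgr _ (cvg_cst 0) c').
    by apply: nearW => k; rewrite sqn_ge0/=; exact: c.
have rhs : \sum_(j < n.+1) ip (P \x m)%E (slice_integral (perm_elementary (tperm j ord_max) (e k)))
    (fun u => Y u.1 * order1_fun (h k) u.2) @[k --> \oo] -->
   \sum_(j < n.+1) ip (P \x m)%E W (fun u => Y u.1 * g u.2).
  apply: cvg_big => [|j _]; first exact: add_continuous.
  have elp k := is_elementary_perm (tperm j ord_max) (ele k).
  apply: ip_cvg => //.
  - by move=> k; exact: L2_slice_integral.
  - by move=> k; exact: L2_tensor.
  - exact: L2_tensor.
  - have c' : n`!%:R * sqn (mm n.+1) (elementary_fun (e k) \- f) @[k --> \oo] --> 0.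
      by rewrite -[X in _ --> X](mulr0 n`!%:R); apply: cvgMl_tmp.
    apply: (squeeze_cvgr _ (cvg_cst 0) c'); apply: nearW => k; rewrite sqn_ge0/=.
    rewrite sqnBC -(sqn_perm_elementary (tperm j ord_max) (ele k) fL fs) [X in _ <= _ * X]sqnBC.
    exact: sqn_slice_integral.
  - have c k : sqn (P \x m)%E ((fun u => Y u.1 * order1_fun (h k) u.2) \- (fun u => Y u.1 * g u.2)) =
        sqn P Y * sqn m (order1_fun (h k) \- g).
      rewrite -ip_tensor//; [|exact: L2B..].
      by apply: eq_ip => u /=; rewrite mulrBr.
    rewrite (_ : (fun k => sqn _ _) = (fun k => sqn P Y * sqn m (order1_fun (h k) \- g))); last first.
      by apply/funext => k; exact: c.
    by rewrite -[X in _ --> X](mulr0 (sqn P Y)); apply: cvgMl_tmp.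
have E k := elementary_duality (ele k) (elh k) (hS k).
rewrite (funext E) in lhs.
have -> := cvg_unique _ lhs rhs => //.
by rewrite sumr_const card_ord mulr_natl.
Qed.

End cell.

End duality.

(** * Density in L^2 *)

Section L2_dominated.
Context d (T : measurableType d) (R : realType) (mu : {measure set T -> \bar R}).

Lemma L2_dominated (u : nat -> T -> R) (f g : T -> R) :
  (forall n, L2 mu (u n)) -> L2 mu f -> L2 mu g ->
  (forall n x, `|u n x - f x| <= `|g x|) -> (forall x, u n x @[n --> \oo] --> f x) ->
  sqn mu (u n \- f) @[n --> \oo] --> 0.
Proof.
move=> uL fL gL ug uf.
have ufL n : L2 mu (u n \- f) by exact: L2B.
have ae1 : {ae mu, forall x, setT x -> ((u n \- f) x ^+ 2)%:E @[n --> \oo] --> 0%E}.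
  apply: aeW => x _; apply: cvg_EFin; first exact: nearW.
  have h : (u n \- f) x @[n --> \oo] --> 0.
    by rewrite -(subrr (f x)); apply: cvgB => //; exact: cvg_cst.
  rewrite -[X in _ --> X](mulr0 0).
  rewrite (_ : _ \o _ = (fun n => (u n \- f) x * (u n \- f) x)); first exact: cvgM.
  by apply/funext => n /=; rewrite expr2.
have ae2 : {ae mu, forall x n, setT x -> (`|((u n \- f) x ^+ 2)%:E| <= (g x ^+ 2)%:E)%E}.
  apply: aeW => x n _; rewrite lee_fin ger0_norm ?sqr_ge0//.
  rewrite -(real_normK (num_real ((u n \- f) x))) -(real_normK (num_real (g x))).
  by rewrite ler_pXn2r ?nnegrE//; exact: ug.
have [_ _] := @dominated_convergence _ _ _ mu setT measurableT
  (fun n x => ((u n \- f) x ^+ 2)%:E) (cst 0%E) (fun x => (g x ^+ 2)%:E)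
  (fun n => (measurable_EFinP _ _).2 (measurable_funX 2 (L2_measurable (ufL n))))
  (measurable_cst _) ae1 (proj2 ((L2P mu g).1 gL)) ae2.
rewrite integral0 => H.
have {}H : (sqn mu (u n \- f))%:E @[n --> \oo] --> 0%E.
  rewrite (_ : (fun n => _) = (fun n => \int[mu]_x ((u n \- f) x ^+ 2)%:E)%E)//.
  by apply/funext => n; rewrite sqnE.
by have /fine_cvgP[] := H.
Qed.

End L2_dominated.

Section L2_closure.
Context d (T : measurableType d) (R : realType) (mu : {measure set T -> \bar R}).
Variable E : (T -> R) -> Prop.

Definition L2_closure (f : T -> R) : Prop :=
  forall e, 0 < e -> exists2 h, E h & sqn mu (h \- f) <= e.

Lemma sub_L2_closure (h : T -> R) : E h -> L2_closure h.
Proof. by move=> Eh e e0; exists h; rewrite ?sqn_diag ?ltW. Qed.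

Hypothesis EL2 : forall h, E h -> L2 mu h.
Hypothesis Elin : forall c h k, E h -> E k -> E (fun x => c * h x + k x).

Lemma L2_closure_lin c (f g : T -> R) : L2 mu f -> L2 mu g ->
  L2_closure f -> L2_closure g -> L2_closure (fun x => c * f x + g x).
Proof.
move=> fL gL Df Dg e e0.
(* The summand 1 keeps the constant positive when c = 0. Both squared errors are then at most e / 4,
   before the factor 2 of [sqn_tri]. *)
have c1 : 0 < 4 * (c ^+ 2 + 1) by rewrite mulr_gt0// ltr_wpDl ?sqr_ge0.
have [h Eh hf] := Df _ (divr_gt0 e0 c1).
have [k Ek kg] := Dg _ (divr_gt0 e0 (ltr0Sn R 3)).
exists (fun x => c * h x + k x); first exact: Elin.
have [hL kL] := (EL2 Eh, EL2 Ek); have [cfL chL] := (L2Z c fL, L2Z c hL).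
apply: (le_trans (sqn_tri (L2D chL kL) (L2D cfL kL) (L2D cfL gL))).
rewrite (_ : _ \- ((fun x => c * f x) \+ _) = fun x => c * (h \- f) x); last first.
  by apply/funext => x /=; ring.
rewrite (_ : _ \- ((fun x => c * f x) \+ _) = k \- g); last by apply/funext => x /=; ring.
rewrite sqnZ; last exact: L2B.
have : c ^+ 2 * sqn mu (h \- f) <= c ^+ 2 * (e / (4 * (c ^+ 2 + 1))).
  by rewrite ler_wpM2l// sqr_ge0.
have : c ^+ 2 * (e / (4 * (c ^+ 2 + 1))) <= e / 4.
  rewrite mulrA ler_pdivrMr// mulrA divfK// mulrC ler_wpM2l ?ltW//.
  by rewrite ltrDl.
lra.
Qed.

Lemma L2_closure_lim (u : nat -> T -> R) (f : T -> R) : (forall k, L2 mu (u k)) ->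
  L2 mu f -> (forall k, L2_closure (u k)) -> sqn mu (u k \- f) @[k --> \oo] --> 0 ->
  L2_closure f.
Proof.
move=> uL fL Du uf e e0; have e4 : 0 < e / 4 by rewrite divr_gt0.
move/cvgrPdist_le : uf => /(_ _ e4)[k _ /(_ k (leqnn k))]/=.
rewrite sub0r normrN ger0_norm ?sqn_ge0// => uk.
have [h Eh hu] := Du k _ e4; exists h => //.
by apply: (le_trans (sqn_tri (EL2 Eh) (uL k) fL)); lra.
Qed.

Import HBNNSimple.
Variable G : set (set T).
Hypothesis Gm : G `<=` measurable.
Hypothesis E0 : E (fun=> 0).
Hypothesis Eindic : forall A, <<s G >> A -> (mu A < +oo)%E -> L2_closure (\1_A).

Let D := L2_closure.
Let Dlin := L2_closure_lin.
Let Dlim := L2_closure_lim.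

Let sGm : <<s G >> `<=` measurable.
Proof. by apply: smallest_sub Gm; exact: sigma_algebra_measurable. Qed.

(** The condition bears on nonzero coefficients because the zero level set of a simple function may
    have infinite measure. *)
Let Dsum (I : Type) (s : seq I) (c : I -> R) (A : I -> set T) :
  (forall i, c i != 0 -> <<s G >> (A i) /\ (mu (A i) < +oo)%E) ->
  L2 mu (fun x => \sum_(i <- s) c i * \1_(A i) x) /\ D (fun x => \sum_(i <- s) c i * \1_(A i) x).
Proof.
move=> cA; elim: s => [|i s [ihL ihD]].
  by under eq_fun do rewrite big_nil; split; [exact: L2_0|exact: sub_L2_closure].
have -> : (fun x => \sum_(j <- i :: s) c j * \1_(A j) x) =
   (fun x => c i * \1_(A i) x + \sum_(j <- s) c j * \1_(A j) x).
  by apply/funext => x; rewrite big_cons.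
have [ci0|/cA[sA Aoo]] := eqVneq (c i) 0.
  by under eq_fun do rewrite ci0 mul0r add0r.
have AL : L2 mu (\1_(A i) : T -> R) by apply: L2_indic => //; exact: sGm.
split; first by apply: L2D => //; exact: L2Z.
by apply: Dlin => //; exact: Eindic.
Qed.

Let measurable_wrt_T (f : T -> R) : measurable_wrt G f -> measurable_fun setT f.
Proof. exact: measurable_wrt_measurable. Qed.

(** Simple functions measurable for the sigma-field of [G] increase to [f], and [f] itself dominates
    the error. *)
Let density_ge0 (f : T -> R) : L2 mu f -> measurable_wrt G f -> (forall x, 0 <= f x) -> D f.
Proof.
move=> fL mf f0.
have mEf : measurable_fun setT (EFin \o f : g_sigma_algebraType G -> \bar R).
  exact/measurable_EFinP.
pose u n : {nnsfun (g_sigma_algebraType G) >-> R} := nnsfun_approx measurableT mEf n.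
have u_le n x : u n x <= f x.
  rewrite -lee_fin /u nnsfun_approxE.
  by apply: (@le_approx _ _ _ setT (EFin \o f) n x) => // y _; rewrite lee_fin.
have u_cvg x : u n x @[n --> \oo] --> f x.
  rewrite /u (_ : (fun n => _) = (fun n => approx setT (EFin \o f) n x)); last first.
    by apply/funext => n; rewrite nnsfun_approxE.
  have := @cvg_approx _ _ _ setT (EFin \o f) x (fun y _ => _) I.
  by move=> /(_ (fun y => f0 y)) /=; apply; rewrite ltry.
have mu_n n : measurable_wrt G (u n : T -> R) by exact: (@measurable_funPT _ _ _ _ (u n)).
have uL n : L2 mu (u n : T -> R).
  apply: (le_L2 _ fL); first exact: measurable_wrt_T.
  by move=> x; rewrite !ger0_norm//; exact: u_le.
apply: (Dlim uL fL) => [n|]; last first.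
  apply: (L2_dominated uL fL fL) => // n x.
  by rewrite distrC ger0_norm ?subr_ge0// ger0_norm// gerBl.
have uE : (u n : T -> R) = fun x => \sum_(y <- finmap.enum_fset (fset_set (range (u n)))) y * \1_(u n @^-1` [set y]) x.
  by apply/funext => x; rewrite (fimfunE (u n)) fsbig_finite.
suff h y : id y != 0 -> <<s G >> (u n @^-1` [set y]) /\ (mu (u n @^-1` [set y]) < +oo)%E.
  have [_] := @Dsum R (finmap.enum_fset (fset_set (range (u n)))) id (fun y => u n @^-1` [set y]) h.
  by rewrite -uE.
move=> /= y0.
have mA : <<s G >> (u n @^-1` [set y]).
  by have := mu_n n measurableT _ (measurable_set1 y); rewrite setTI.
split => //.
(* Chebyshev: the square of [u n] equals y^2 on the level set at y, so a nonzero level has finite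
   measure. *)
have /L2P[_ /integrableP[_ ioo]] := uL n.
have c2 : 0 < y ^+ 2 by rewrite exprn_even_gt0.
have mA' := sGm mA.
have : ((y ^+ 2)%:E * mu (u n @^-1` [set y]) < +oo)%E.
  apply: le_lt_trans ioo.
  have -> : mu (u n @^-1` [set y]) = (\int[mu]_x (\1_(u n @^-1` [set y]) x)%:E)%E.
    by rewrite integral_indic// setIT.
  rewrite -ge0_integralZl_EFin//; last 2 first.
  - by apply/measurable_EFinP; exact: measurable_indic.
  - exact: sqr_ge0.
  apply: ge0_le_integral => //.
  - by move=> x _; rewrite mule_ge0// lee_fin// sqr_ge0.
  - by apply: measurable_funeM; apply/measurable_EFinP; exact: measurable_indic.
  - apply: measurableT_comp => //; apply/measurable_EFinP/measurable_funX.
    exact: measurable_wrt_T (mu_n n).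
  move=> x _; rewrite /= ger0_norm ?sqr_ge0// -EFinM lee_fin indicE.
  case: (boolP (x \in _)) => [|_] /=; last by rewrite mulr0 sqr_ge0.
  by rewrite inE /= => ->; rewrite mulr1.
move=> h; rewrite ltey; apply/eqP => Aoo; move: h.
by rewrite Aoo gt0_muley ?lte_fin// ltxx.
Qed.

Lemma L2_closure_dense (f : T -> R) : L2 mu f -> measurable_wrt G f -> L2_closure f.
Proof.
move=> fL mf.
have mp : measurable_wrt G (fun x => Num.max (f x) 0).
  exact: (@measurable_maxr _ (g_sigma_algebraType G)).
have mn : measurable_wrt G (fun x => Num.max (- f x) 0).
  apply: (@measurable_maxr _ (g_sigma_algebraType G)) => //.
  rewrite (_ : (fun x => - f x) = (fun x => -1 * f x)); last first.
    by apply/funext => x; rewrite mulN1r.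
  exact: (@measurable_funM _ (g_sigma_algebraType G)).
have pL : L2 mu (fun x => Num.max (f x) 0).
  apply: (le_L2 _ fL); first exact: measurable_wrt_T.
  by move=> x; rewrite maxEle; case: ifP; rewrite ?normr0.
have nL : L2 mu (fun x => Num.max (- f x) 0).
  apply: (le_L2 _ fL); first exact: measurable_wrt_T.
  by move=> x; rewrite maxEle; case: ifP; rewrite ?normr0 ?normrN.
have -> : f = (fun x => -1 * Num.max (- f x) 0 + Num.max (f x) 0).
  apply/funext => x; have [f0|f0] := leP 0 (f x).
    by rewrite (max_idPr _) ?oppr_le0// mulr0 add0r.
  by rewrite (max_idPl _) ?oppr_ge0 ?ltW// mulN1r opprK addr0.
by apply: Dlin => //; apply: density_ge0 => // x; rewrite le_max lexx orbT.
Qed.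

End L2_closure.

Lemma cvg_geometric_4 (R : realType) : @GRing.exp R 4^-1 @ \oo --> 0.
Proof. by apply: cvg_expr; rewrite gtr0_norm; lra. Qed.

(** Domination by the distances of a convergent sequence makes [u] a Cauchy sequence. With the
    isometries as the bound, this is how the integrals are constructed. *)
Lemma L2_cauchy_transfer d1 d2 (T1 : measurableType d1) (T2 : measurableType d2) (R : realType)
    (mu : {measure set T1 -> \bar R}) (mu' : {measure set T2 -> \bar R})
    (u : nat -> T1 -> R) (v : nat -> T2 -> R) (l : T2 -> R) :
  (forall n, L2 mu (u n)) -> (forall n, L2 mu' (v n)) -> L2 mu' l ->
  (forall i j, sqn mu (u i \- u j) <= sqn mu' (v i \- v j)) ->
  sqn mu' (v n \- l) @[n --> \oo] --> 0 ->
  exists2 f, L2 mu f & sqn mu (u n \- f) @[n --> \oo] --> 0.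
Proof.
move=> uL vL lL uv vl; apply: L2_complete => // e e0.
have e4 : 0 < e / 4 by rewrite divr_gt0.
move/cvgrPdist_le : vl => /(_ _ e4)[k _ kP]; exists k => i j ki kj.
apply: (le_trans (uv i j)); apply: (le_trans (sqn_tri (vL i) lL (vL j))).
have := kP _ ki; have := kP _ kj; rewrite /= !sub0r !normrN !ger0_norm ?sqn_ge0//.
by rewrite [sqn _ (l \- _)]sqnBC; lra.
Qed.

(** * Integrals of order one: existence, isometry and mean *)

Section order1.
Context d (Omega : measurableType d) d' (Z : measurableType d') (R : realType).
Variables (P : probability Omega R) (m : {sigma_finite_measure set Z -> \bar R}).
Variable N : R.-ker Omega ~> Z.
Hypothesis Pcomplete : measure_is_complete P.
Hypothesis prm : poisson_random_measure P m N.
Local Notation NH := (compensated m N).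
Local Notation mm n := (power_measure m n : {measure set (n.-tuple Z) -> \bar R}).
Local Notation II := (elementary_integral m N).

Let order1 (h : Z -> R) := exists2 e : elementary Z R 1, is_elementary m e & h = order1_fun e.

(** There is no diagonal in order 1: the indicator of a set of finite mass is itself elementary. *)
Lemma order1_dense (g : Z -> R) : L2 m g -> L2_closure m order1 g.
Proof.
move=> gL; apply: (@L2_closure_dense _ _ _ m order1 _ _ measurable) => //.
- by move=> _ [e ele ->]; have [] := L2_power1 (L2_elementary_fun ele).
- move=> c _ _ [e ele ->] [e' ele' ->].
  have [f [elf fE _]] := elementary_lincomb prm c 1 ele ele'.
  by exists f => //; apply/funext => z; rewrite /order1_fun fE mul1r.
- exists (Elementary (fun _ : 'I_0 => set0) (fun=> 0)); first by split => //; case.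
  by apply/funext => z; rewrite /order1_fun /elementary_fun/= big1// => t _; rewrite mul0r.
- move=> A mA Aoo; apply: sub_L2_closure.
  have {}mA : measurable A by move: mA; apply: smallest_sub; [exact: sigma_algebra_measurable|].
  exists (Elementary (fun _ : 'I_1 => A) (fun=> 1)).
    split => //= [i j _ _ _|t]; first by rewrite !ord1.
    by case: t => -[|x [|? ?]].
  apply/funext => z; rewrite order1_funE/= (bigD1 [tuple ord0])//= big1 => [|t /eqP tn].
    by rewrite mul1r addr0.
  by exfalso; apply: tn; apply: eq_from_tnth => i; rewrite !ord1.
- by move=> _ B mB; apply: sub_sigma_algebra; exact: (L2_measurable gL).
Qed.

(** The factor n! is 1 here, so the integrals of elementary approximations form a Cauchy sequence.
    This supplies the versions of L(A) in the simple integrals. *)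
Lemma order1_exists (g : Z -> R) : L2 m g ->
  exists L, is_multiple_integral P m N (fun t : 1.-tuple Z => g (tnth t ord0)) L.
Proof.
move=> gL.
have /choice[h hP] k : exists h : elementary Z R 1,
    is_elementary m h /\ sqn m (order1_fun h \- g) <= 4^-1 ^+ k.
  have e0 : 0 < 4^-1 ^+ k :> R by rewrite exprn_gt0.
  by have [_ [h elh ->]] := order1_dense gL e0; exists h.
have elh k := (hP k).1.
have g1L := L2_power1_inv gL.
have hg : sqn (mm 1) (elementary_fun (h k) \- (fun t => g (tnth t ord0))) @[k --> \oo] --> 0.
  apply: (squeeze_cvgr _ (cvg_cst 0) (@cvg_geometric_4 R)); apply: nearW => k; rewrite sqn_ge0/=.
  have [_ <-] := L2_power1 (L2B (L2_elementary_fun (elh k)) g1L).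
  exact: (hP k).2.
have hL k := L2_elementary_integral Pcomplete prm (elh k).
have hh i j : sqn P (II (h i) \- II (h j)) <=
    sqn (mm 1) (elementary_fun (h i) \- elementary_fun (h j)).
  have := sqn_elementary_integralB Pcomplete prm (elh i) (elh j).
  by rewrite mul1r.
have [L LL Lh] := L2_cauchy_transfer hL (fun k => L2_elementary_fun (elh k)) g1L hh hg.
by exists L; apply/(multiple_integralP Pcomplete prm); split => //; exists h; split.
Qed.

(** The empty tuple is the only index in order 0. This case feeds [cell_duality] at n = 0. *)
Lemma multiple_integral0 (c : R) :
  is_multiple_integral P m N (fun _ : 0.-tuple Z => c) (fun=> c).
Proof.
pose e : elementary Z R 0 := Elementary (fun _ : 'I_0 => set0) (fun=> c).
have ele : is_elementary m e.
  split; [by case|by case|].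
  by move=> t; rewrite /= (size0nil (size_tuple t)).
have fE : elementary_fun e = fun=> c.
  apply/funext => t; rewrite /elementary_fun (bigD1 [tuple])//= big_ord0 big1 => [|s /eqP sn].
    by rewrite mulr1 addr0.
  by exfalso; apply: sn; apply: eq_from_tnth => -[].
have iE : II e = fun=> c.
  apply/funext => w; rewrite /elementary_integral (bigD1 [tuple])//= big_ord0 big1 => [|s /eqP sn].
    by rewrite mulr1 addr0.
  by exfalso; apply: sn; apply: eq_from_tnth => -[].
apply/(multiple_integralP Pcomplete prm); split.
- by rewrite -fE; exact: L2_elementary_fun.
- exact: L2_cst.
exists (fun=> e); split => //.
  by rewrite fE sqn_diag; exact: cvg_cst.
by rewrite iE sqn_diag; exact: cvg_cst.
Qed.

(** The duality at n = 0, for the kernel [g], the later region [S'] and the coefficient [Y Y'],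
    which is measurable with respect to the noise on [S'] because [S] lies in [S']. *)
Lemma cell_isometry (S S' : set Z) (Y Y' : Omega -> R) (M M' : R) (g g' : Z -> R) (L L' : Omega -> R) :
  measurable S' -> S `<=` S' ->
  measurable_wrt (noise_on P N S) Y -> (forall w, `|Y w| <= M) ->
  measurable_wrt (noise_on P N S') Y' -> (forall w, `|Y' w| <= M') ->
  (forall z, S' z -> g' z = 0) ->
  is_multiple_integral P m N (fun t : 1.-tuple Z => g (tnth t ord0)) L ->
  is_multiple_integral P m N (fun t : 1.-tuple Z => g' (tnth t ord0)) L' ->
  ip P (fun w => Y w * L w) (fun w => Y' w * L' w) =
  ip (P \x m)%E (fun u => Y u.1 * g u.2) (fun u => Y' u.1 * g' u.2).
Proof.
move=> mS' SS' mY YM mY' YM' gS gL gL'.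
have mYY : measurable_wrt (noise_on P N S') (fun w => Y w * Y' w).
  by apply: measurable_wrtM => //; exact: measurable_noise_wrtS mY.
have YYM w : `|Y w * Y' w| <= M * M' by rewrite normrM ler_pM.
have [g1L _ _] := (multiple_integralP Pcomplete prm _ _).1 gL.
have [gZ _] := L2_power1 g1L.
pose W (u : Omega * Z) := g u.2.
have WL : L2 (P \x m)%E W.
  have := L2_tensor (L2_cst P 1) gZ; congr (L2 _ _).
  by apply/funext => u; rewrite mul1r.
have Wg : {ae m, forall z, is_multiple_integral P m N
    (fun t : 0.-tuple Z => g (tnth (tuple_rcons (t, z)) ord0)) (fun w => W (w, z))}.
  apply: aeW => z; rewrite (_ : (fun t => _) = fun=> g z); first exact: multiple_integral0.
  apply/funext => t; congr g; rewrite (tnth_nth z)/=.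
  by rewrite (size0nil (size_tuple t)).
have sg : symmetric_kernel m (fun t : 1.-tuple Z => g (tnth t ord0)).
  by move=> s; apply: aeW => t; rewrite tnth_mktuple ord1.
have := cell_duality Pcomplete prm mS' mYY YYM sg gL WL Wg gS gL'.
rewrite mul1r => E.
transitivity (ip P L (fun w => Y w * Y' w * L' w)).
  by apply: eq_Rintegral => w _; ring.
by rewrite -E; apply: eq_Rintegral => u _; rewrite /W; ring.
Qed.

(** In an approximation with cells off [S], each compensated count is centred and independent of
    [Y]. *)
Lemma cell_mean (S : set Z) (Y : Omega -> R) (M : R) (g : Z -> R) (L : Omega -> R) :
  measurable S -> measurable_wrt (noise_on P N S) Y -> (forall w, `|Y w| <= M) ->
  (forall z, S z -> g z = 0) ->
  is_multiple_integral P m N (fun t : 1.-tuple Z => g (tnth t ord0)) L ->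
  ip P Y L = 0.
Proof.
move=> mS mY YM gS gL.
have YL : L2 P Y.
  have := L2_boundedM (measurable_noise_wrt Pcomplete mY) YM (L2_cst P 1).
  by congr (L2 _ _); apply/funext => w; rewrite mulr1.
have [h [elh hS _ c]] := order1_approx Pcomplete prm mS gS gL.
have [_ LL _] := (multiple_integralP Pcomplete prm _ _).1 gL.
have hL k := L2_elementary_integral Pcomplete prm (elh k).
have lim : ip P Y (II (h k)) @[k --> \oo] --> ip P Y L.
  exact: ip_cvgr.
have z k : ip P Y (II (h k)) = 0.
  rewrite ipC (eq_ip _ (order1_integralE m N (h k)) (fun w => erefl)).
  have [mA _ _] := elh k.
  have NL r : L2 P (NH (el_set (e := h k) r)) by apply: L2_compensated => //; have [] := mA r.
  rewrite ip_suml//; last by move=> r _; exact: L2Z.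
  rewrite big1// => r _; rewrite ipZl//.
  have [mr roo] := mA (tnth r ord0).
  have mYr : measurable_wrt (noise_on P N (~` el_set (tnth r ord0))) Y.
    by apply: measurable_noise_wrtS mY => z Sz /hS; apply.
  have [_] := integral_mul_compensated Pcomplete prm mr roo mYr (L2_integrable YL).
  by rewrite ipC /ip => ->; rewrite mulr0.
rewrite (funext z) in lim.
by have := cvg_unique _ lim (cvg_cst 0) => ->.
Qed.

End order1.

(** * Simple and predictable processes *)

Section simple_processes.
Context d (Omega : measurableType d) (R : realType) (P : probability Omega R).
Variable N : R.-ker Omega ~> (measurableTypeR R * R0 R)%type.
Hypothesis Pcomplete : measure_is_complete P.
Local Notation FF := (filtration_events P N).
Local Notation PL := ((P \x @lebesgue_measure R)%E : {measure set (Omega * measurableTypeR R)%type -> \bar R}).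

Lemma filtration_le (a b : R) : a <= b -> FF a `<=` FF b.
Proof.
move=> ab E [[a' [b' [S [B [? ba ? ? ->]]]]]|nE]; [left|by right].
by exists a', b', S, B; split => //; exact: le_trans ab.
Qed.

Lemma filtration_noise_on (a : R) : FF a `<=` noise_on P N [set z | z.1 <= a].
Proof.
move=> E [[a' [b' [S [B [ab' ba [mS _] mB ->]]]]]|nE]; [left|by right].
exists (`[a', b']%classic `*` S), B; split => //.
- by apply: measurableX => //; exact: measurable_itv.
- by move=> z [/=]; rewrite in_itv/= => /andP[_ zb] _; exact: le_trans ba.
Qed.

Lemma noise_on_events S : noise_on P N S `<=` noise_events P N.
Proof.
move=> E [[A [B [mA _ mB ->]]]|nE]; [left|by right].
by exists A, B; split.
Qed.

Lemma filtration_measurable (a : R) : FF a `<=` measurable.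
Proof. by move=> E /filtration_noise_on; exact: noise_on_measurable. Qed.

Lemma indic_itvoc (a b x : R) : \1_(`]a, b]%classic) x = ((a < x) && (x <= b))%:R :> R.
Proof.
rewrite indicE; congr (nat_of_bool _)%:R.
by apply/idP/idP; rewrite inE/= in_itv.
Qed.

(** The intervals may overlap or be empty, whereas a simple process has consecutive cells. All end
    points are sorted into knots; between two of them the sum is constant, so its value at the right
    knot serves as coefficient. *)
Lemma step_simple (I : finType) (a b : I -> R) (Y : I -> Omega -> R) :
  (forall i, exists M : R, forall w, `|Y i w| <= M) ->
  (forall i, measurable_wrt (FF (a i)) (Y i)) ->
  exists2 s, is_simple P N s &
    forall x w, sp_fun s x w = \sum_i Y i w * \1_(`]a i, b i]%classic) x.
Proof.
move=> Yb Ym.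
pose f x w := \sum_i Y i w * \1_(`]a i, b i]%classic) x.
pose T := sort <=%O (undup (map a (enum I) ++ map b (enum I))).
have Tlt : sorted <%O T by rewrite sort_lt_sorted undup_uniq.
have aT i : a i \in T by rewrite mem_sort mem_undup mem_cat map_f ?mem_enum.
have bT i : b i \in T by rewrite mem_sort mem_undup mem_cat orbC map_f ?mem_enum.
pose k j := nth 0 T j.
have klt j : (j.+1 < size T)%N -> k j < k j.+1.
  by move=> jT; rewrite /k (lt_sorted_ltn_nth 0 Tlt)// inE ltnW.
have kle i j : (i <= j)%N -> (j < size T)%N -> k i <= k j.
  by move=> ij jT; rewrite /k (lt_sorted_leq_nth 0 Tlt)// inE (leq_ltn_trans ij).
(* No end point lies strictly between two consecutive knots. *)
have dich c j : (j.+1 < size T)%N -> c \in T -> c <= k j \/ k j.+1 <= c.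
  move=> jT cT; have cE : k (index c T) = c by exact: nth_index.
  have ci : (index c T < size T)%N by rewrite index_mem.
  rewrite -cE; have [cj|jc] := leqP (index c T) j; [left|right].
    by apply: kle => //; exact: ltnW.
  exact: kle.
have fE j x w : (j.+1 < size T)%N -> k j < x -> x <= k j.+1 -> f x w = f (k j.+1) w.
  move=> jT jx xj; have jj := klt _ jT.
  apply: eq_bigr => i _; congr (_ * _); rewrite !indic_itvoc; congr (nat_of_bool (_ && _))%:R.
    have [h|h] := dich _ _ jT (aT i).
      by rewrite (le_lt_trans h)// (le_lt_trans h).
    by rewrite ltNge (le_trans xj h) ltNge h.
  have [h|h] := dich _ _ jT (bT i).
    by rewrite leNgt (le_lt_trans h)// leNgt (le_lt_trans h jj).
  by rewrite h (le_trans xj h).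
pose s : simple_process Omega R := SimpleProcess (size T).-1 k (fun j w => f (k j.+1) w).
exists s.
  move=> j; rewrite /= -ltnS => jT'.
  have jT : (j.+1 < size T)%N by case: (size T) jT'.
  split; first exact: klt.
    have /choice[M MP] := Yb; exists (\sum_i M i) => w.
    apply: (le_trans (ler_norm_sum _ _ _)); apply: ler_sum => i _.
    rewrite normrM -[leRHS]mulr1 ler_pM//; rewrite indic_itvoc.
    by case: (_ && _); rewrite ?normr1 ?normr0.
  apply: measurable_wrt_sum => i; rewrite indic_itvoc.
  (* An interval that contributes on this cell starts at or before the left knot, where its
     coefficient is already measurable; any other one contributes 0. *)
  have [h|h] := dich _ _ jT (aT i).
    apply: measurable_wrtM; last exact: (@measurable_cst _ _ (g_sigma_algebraType (FF (k j)))).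
    apply: measurable_wrt_sub (Ym i) => E /(filtration_le h); exact: sub_sigma_algebra.
  rewrite ltNge h/=.
  have -> : (fun w => Y i w * 0%:R) = cst 0 by apply/funext => w; rewrite mulr0.
  exact: (@measurable_cst _ _ (g_sigma_algebraType (FF (k j)))).
move=> x w; rewrite -[RHS]/(f x w) /sp_fun /=.
(* [f] is constant between consecutive knots, and the indicators of these cells telescope. *)
transitivity (\sum_(0 <= j < (size T).-1) f x w * (- (k j.+1 < x)%R%:R - - (k j < x)%R%:R)).
  rewrite big_mkord; apply: eq_bigr => -[j /= jT'] _.
  have jT : (j.+1 < size T)%N by rewrite -ltnS in jT'; case: (size T) jT'.
  rewrite /sp_cell/= indic_itvoc; have jj := klt _ jT.
  have [xj|xj] := ltP (k j) x => /=; last first.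
    by rewrite ltNge (le_trans xj (ltW jj)) /= oppr0 subrr !mulr0.
  have [xj'|xj'] := leP x (k j.+1); last by rewrite mulr0 /= mulr1n subrr mulr0.
  by rewrite /= oppr0 add0r opprK !mulr1 -(fE j x w).
rewrite -mulr_sumr telescope_sumr//.
have [->|/eqP f0] := eqVneq (f x w) 0; first by rewrite mul0r.
have [i iP] : exists i, (a i < x) && (x <= b i).
  apply: contra_notP f0 => h; rewrite /f big1// => i _.
  by rewrite indic_itvoc; case: (boolP (_ && _)) => [?|_]; [exfalso; apply: h; exists i|rewrite mulr0].
have [ax xb] := andP iP.
have sT : (0 < size T)%N by case: (T) (aT i).
have -> : k 0 < x.
  apply: le_lt_trans ax; rewrite -[a i](nth_index 0 (aT i)).
  by apply: kle => //; rewrite index_mem.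
have -> : (k (size T).-1 < x) = false.
  apply/negbTE; rewrite -leNgt (le_trans xb)// -[b i](nth_index 0 (bT i)).
  by apply: kle; rewrite ?prednK// -ltnS prednK// index_mem.
by rewrite oppr0 add0r opprK mulr1.
Qed.

Lemma simple_lincomb (c : R) s s' : is_simple P N s -> is_simple P N s' ->
  exists2 s'', is_simple P N s'' &
    forall x w, sp_fun s'' x w = c * sp_fun s x w + sp_fun s' x w.
Proof.
move=> ss ss'.
pose I := ('I_(sp_size s) + 'I_(sp_size s'))%type.
pose a (i : I) := match i with inl i => sp_knot s i | inr i => sp_knot s' i end.
pose b (i : I) := match i with inl i => sp_knot s i.+1 | inr i => sp_knot s' i.+1 end.
pose Y (i : I) w := match i with inl i => c * sp_coef s i w | inr i => sp_coef s' i w end.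
have Yb i : exists M : R, forall w, `|Y i w| <= M.
  case: i => i /=; last by have [] := ss' i (ltn_ord i).
  have [_ [M MP] _] := ss i (ltn_ord i); exists (`|c| * M) => w.
  by rewrite normrM ler_wpM2l.
have Ym i : measurable_wrt (FF (a i)) (Y i).
  case: i => i /=; last by have [] := ss' i (ltn_ord i).
  have [_ _ m] := ss i (ltn_ord i); apply: measurable_wrtM => //.
  exact: (@measurable_cst _ _ (g_sigma_algebraType _)).
have [t tS tE] := step_simple b Yb Ym; exists t => // x w.
rewrite tE big_sumType/= mulr_sumr; congr (_ + _).
by apply: eq_bigr => i _; rewrite mulrA.
Qed.

Lemma measurable_coef a (Y : Omega -> R) : measurable_wrt (FF a) Y -> measurable_fun setT Y.
Proof. by apply: measurable_wrt_measurable; exact: filtration_measurable. Qed.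

Lemma L2_bounded_coef a (Y : Omega -> R) (M : R) : measurable_wrt (FF a) Y ->
  (forall w, `|Y w| <= M) -> L2 P Y.
Proof.
move=> mY YM; have := L2_boundedM (measurable_coef mY) YM (L2_cst P 1).
by congr (L2 _ _); apply/funext => w; rewrite mulr1.
Qed.

Lemma lebesgue_itvoc_lty (a b : R) : (@lebesgue_measure R `]a, b]%classic < +oo)%E.
Proof. by rewrite lebesgue_measure_itv/=; case: ifP => // _; rewrite -EFinB ltry. Qed.

Lemma L2_simple s : is_simple P N s -> L2 PL (fun u => sp_fun s u.2 u.1).
Proof.
move=> ss; apply: L2_sum => i _; have [_ [M MP] mY] := ss i (ltn_ord i).
apply: (L2_tensor (L2_bounded_coef mY MP)); apply: L2_indic.
  exact: measurable_itv.
exact: lebesgue_itvoc_lty.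
Qed.

(** The classical predictable rectangles. They form a pi-system, on which the Dynkin argument for
    density relies. *)
Definition predictable_rects : set (set (Omega * measurableTypeR R)) :=
  [set E | exists A a b, <<s FF a >> A /\ E = A `*` `]a, b]%classic].

Lemma predictable_rectsI : setI_closed predictable_rects.
Proof.
move=> _ _ [A [a [b [sA ->]]]] [A' [a' [b' [sA' ->]]]].
exists (A `&` A'), (Num.max a a'), (Num.min b b'); split.
  apply: (@measurableI _ (g_sigma_algebraType (FF (Num.max a a')))).
    by apply: sub_sigma_algebra2 sA; apply: filtration_le; rewrite le_max lexx.
  by apply: sub_sigma_algebra2 sA'; apply: filtration_le; rewrite le_max lexx orbT.
rewrite -setXI; congr (_ `*` _).
apply/seteqP; split => x /=; rewrite !in_itv/= gt_max le_min.
  by move=> [/andP[-> ->] /andP[-> ->]].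
by move=> /andP[/andP[-> ->] /andP[-> ->]].
Qed.

Lemma predictable_rects_measurable : predictable_rects `<=` measurable.
Proof.
move=> _ [A [a [b [sA ->]]]]; apply: measurableX; last exact: measurable_itv.
by move: sA; apply: smallest_sub; [exact: sigma_algebra_measurable|exact: filtration_measurable].
Qed.

(** A term of a simple process vanishes off a strip, so the preimage of a set avoiding 0 is a
    rectangle; a set containing 0 is treated through its complement. *)
Lemma predictable_rects_wrt X : predictable P N X ->
  measurable_wrt predictable_rects (fun u : Omega * measurableTypeR R => X u.2 u.1).
Proof.
apply: measurable_wrt_sub => _ [s [B [ss mB ->]]].
suff h : measurable_wrt predictable_rects (fun u : Omega * measurableTypeR R => sp_fun s u.2 u.1).
  by have := h measurableT _ mB; rewrite setTI.
apply: (@measurable_sum _ (g_sigma_algebraType predictable_rects)) => i.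
have [_ _ mY] := ss i (ltn_ord i).
have base (C : set R) : measurable C -> ~ C 0 ->
    <<s predictable_rects >> ((fun u : Omega * measurableTypeR R =>
      sp_coef s i u.1 * \1_(sp_cell s i) u.2) @^-1` C).
  move=> mC C0; apply: sub_sigma_algebra.
  exists (sp_coef s i @^-1` C), (sp_knot s i), (sp_knot s i.+1); split.
    by have := mY measurableT _ mC; rewrite setTI.
  apply/seteqP; split => -[w x] /=; rewrite indic_itvoc in_itv/=.
    by case: (_ && _); rewrite ?mulr0 ?mulr1.
  by move=> [Cw ->]; rewrite mulr1.
move=> _ C mC; rewrite setTI.
have [C0|C0] := pselect (C 0); last exact: base.
rewrite -[C]setCK preimage_setC.
apply: (@measurableC _ (g_sigma_algebraType predictable_rects)).
exact: (base (~` C) (measurableC mC) (fun h => h C0)).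
Qed.

Let simple (h : Omega * measurableTypeR R -> R) :=
  exists2 s, is_simple P N s & h = fun u => sp_fun s u.2 u.1.

(** Indicators suffice by [L2_closure_dense]. Complements and countable unions must stay in L^2, so
    the Dynkin argument runs inside a window [Q K] of finite measure, and K tends to infinity
    afterwards. *)
Lemma simple_dense (f : Omega * measurableTypeR R -> R) :
  L2 PL f -> measurable_wrt predictable_rects f -> L2_closure PL simple f.
Proof.
pose D := L2_closure PL simple.
have simL h : simple h -> L2 PL h by move=> [s ss ->]; exact: L2_simple.
have simlin c h k : simple h -> simple k -> simple (fun u => c * h u + k u).
  move=> [s ss ->] [t tt ->]; have [r rr rE] := simple_lincomb c ss tt.
  by exists r => //; apply/funext => u; rewrite rE.
have sim0 : simple (fun=> 0).
  have [s ss sE] := @step_simple void (fun=> 0) (fun=> 0) (fun=> cst 0)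
    (fun i => match i with end) (fun i => match i with end).
  by exists s => //; apply/funext => u; rewrite sE big1.
have Dlin := L2_closure_lin simL simlin.
have Dlim := L2_closure_lim simL.
have sRm : <<s predictable_rects >> `<=` measurable.
  by apply: smallest_sub predictable_rects_measurable; exact: sigma_algebra_measurable.
pose Q (K : nat) : set (Omega * measurableTypeR R) := setT `*` `](- K%:R)%R, K%:R]%classic.
have Qoo K : (PL (Q K) < +oo)%E.
  have -> : PL (Q K) = (P setT * @lebesgue_measure R `](- K%:R)%R, K%:R]%classic)%E.
    by apply: product_measure1E => //; exact: measurable_itv.
  rewrite probability_setT mul1e; exact: lebesgue_itvoc_lty.
have mQ K : measurable (Q K) by exact: measurableX.
have rectL A K : <<s predictable_rects >> A -> L2 PL (\1_(A `&` Q K)).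
  move=> /sRm mA; apply: L2_indic; first exact: measurableI.
  apply: le_lt_trans (Qoo K); apply: le_measure; rewrite ?inE//; exact: measurableI.
have QL K : L2 PL (\1_(Q K)) by apply: L2_indic.
have Drect A : predictable_rects A -> forall K, D (\1_(A `&` Q K)).
  move=> [B [a [b [sB ->]]]] K.
  have mYB : measurable_wrt (FF (Num.max a (- K%:R))) (\1_B : Omega -> R).
    apply: (@measurable_indic _ (g_sigma_algebraType (FF (Num.max a (- K%:R)))) R setT).
    by apply: sub_sigma_algebra2 sB; apply: filtration_le; rewrite le_max lexx.
  have B1 w : `|\1_B w| <= 1 :> R by rewrite indicE; case: (_ \in _); rewrite ?normr1 ?normr0.
  (* Within the window, a rectangle starts at the maximum of a and -K, where [B] is still in the
     sigma-field of the filtration. *)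
  have [s ss sE] := @step_simple unit (fun=> Num.max a (- K%:R)) (fun=> Num.min b K%:R)
    (fun=> \1_B) (fun=> ex_intro _ 1 B1) (fun=> mYB).
  apply: sub_L2_closure; exists s => //; apply/funext => -[w x]; apply/esym; rewrite sE /= (big_pred1 tt)//.
  rewrite indic_itvoc gt_max le_min /Q indicE [in RHS]indicE -natrM mulnb.
  congr (nat_of_bool _)%:R; apply/idP/idP.
    move=> /andP[]; rewrite inE => Bw /andP[/andP[h1 h2] /andP[h3 h4]]; rewrite inE/=.
    by rewrite !in_itv/= h1 h2 h3 h4.
  rewrite inE/= !in_itv/= => -[[Bw /andP[-> ->]] [_ /andP[-> ->]]] /=.
  by rewrite andbT inE.
have DQ K : D (\1_(Q K)).
  rewrite -(setIid (Q K)); apply: Drect; exists setT, (- K%:R), K%:R; split => //.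
  exact: (@measurableT _ (g_sigma_algebraType (FF (- K%:R)))).
have DA A : <<s predictable_rects >> A -> forall K, D (\1_(A `&` Q K)).
  move=> sA.
  apply: (@dynkin_induction _ (g_sigma_algebraType predictable_rects) predictable_rects
    (fun A => forall K, D (\1_(A `&` Q K))) erefl predictable_rectsI _ Drect) => //.
  - by move=> K; rewrite setTI.
  - move=> S mS DS K.
    have -> : \1_(~` S `&` Q K) = (fun u => -1 * \1_(S `&` Q K) u + \1_(Q K) u) :> (_ -> R).
      apply/funext => u; rewrite !indicE !in_setI in_setC.
      by case: (u \in S); case: (u \in Q K) => /=; ring.
    exact: (Dlin _ _ _ (rectL _ K mS) (QL K) (DS K) (DQ K)).
  - move=> F mF tF DF K.
    have mU n : <<s predictable_rects >> (\big[setU/set0]_(i < n) F i).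
      by apply: (@bigsetU_measurable _ (g_sigma_algebraType predictable_rects)).
    have mUF : <<s predictable_rects >> (\bigcup_k F k).
      by apply: (@bigcup_measurable _ (g_sigma_algebraType predictable_rects)).
    apply: (Dlim (fun n => \1_((\big[setU/set0]_(i < n) F i) `&` Q K))).
    + by move=> n; exact: rectL.
    + exact: rectL.
    + elim=> [|n ih].
        by rewrite big_ord0 set0I indic0; exact: sub_L2_closure.
      have -> : \1_((\big[setU/set0]_(i < n.+1) F i) `&` Q K) =
          (fun u => 1 * \1_(F n `&` Q K) u + \1_((\big[setU/set0]_(i < n) F i) `&` Q K) u) :> (_ -> R).
        apply/funext => u; rewrite big_ord_recr/= !indicE !in_setI in_setU mul1r.
        case: (boolP (u \in F n)) => [|_]; last by rewrite orbF add0r.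
        rewrite inE => Fnu; rewrite orbT.
        case: (boolP (u \in \big[setU/set0]_(i < n) F i)) => [|_]; last by rewrite addr0.
        rewrite inE -bigcup_mkord => -[i /= ni Fiu]; exfalso.
        have := tF i n Logic.I Logic.I (ex_intro _ u (conj Fiu Fnu)).
        by move=> E; rewrite E ltnn in ni.
      exact: (Dlin _ _ _ (rectL _ K (mF n)) (rectL _ K (mU n)) (DF n K) ih).
    apply: (L2_dominated (g := \1_(Q K))) => //.
    + by move=> n; exact: rectL.
    + exact: rectL.
    + move=> n u; rewrite !indicE !in_setI.
      by case: (u \in Q K); case: (u \in \big[_/_]_(_ < _) _); case: (u \in \bigcup_k _);
        rewrite /= ?subr0 ?sub0r ?subrr ?normrN ?normr0 ?normr1 ?ler01 ?lexx.
    move=> u; have [[i _ Fiu]|nFu] := pselect ((\bigcup_k F k) u).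
      apply: cvg_near_cst; exists i.+1 => // n /= ni.
      rewrite !indicE !in_setI; congr (nat_of_bool (_ && _))%:R.
      transitivity true; last by rewrite mem_set//; exists i.
      by rewrite mem_set// -bigcup_mkord; exists i.
    rewrite (_ : (fun n => _) = cst (\1_(\bigcup_k F k `&` Q K) u)); first exact: cvg_cst.
    apply/funext => n; rewrite /= !indicE !in_setI; congr (nat_of_bool (_ && _))%:R.
    rewrite !memNset// -bigcup_mkord => -[i _ Fiu]; apply: nFu; by exists i.
move=> fL mf; apply: (L2_closure_dense simL simlin predictable_rects_measurable sim0 _ fL mf).
move=> A sA Aoo.
have AL : L2 PL (\1_A) by apply: L2_indic => //; exact: sRm.
apply: (Dlim (fun K => \1_(A `&` Q K))) => //.
- by move=> K; exact: rectL.
- by move=> K; exact: DA.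
apply: (L2_dominated (g := \1_A)) => //.
- by move=> K; exact: rectL.
- move=> K u; rewrite !indicE in_setI.
  by case: (u \in A); case: (u \in Q K); rewrite /= ?subr0 ?sub0r ?subrr ?normrN ?normr0 ?normr1 ?ler01 ?lexx.
move=> u; apply: cvg_near_cst; exists (Num.truncn `|u.2|).+1 => // K /= uK.
rewrite !indicE in_setI (_ : (u \in Q K) = true) ?andbT//.
rewrite mem_set//; split => //=; rewrite in_itv/=.
have : `|u.2| < K%:R by apply: lt_le_trans (truncnS_gt _) _; rewrite ler_nat.
by rewrite ltr_norml => /andP[-> /ltW].
Qed.

End simple_processes.

(** * The Ito integral *)

Section ito_chaos.
Context d (Omega : measurableType d) (R : realType) (P : probability Omega R).
Variables (nu : {measure set (R0 R) -> \bar R}) (nu2 : (second_moment nu < +oo)%E).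
Variable N : R.-ker Omega ~> (measurableTypeR R * R0 R)%type.
Hypothesis Pcomplete : measure_is_complete P.
Hypothesis prm : poisson_random_measure P (intensity nu2) N.
Local Notation Z := (measurableTypeR R * R0 R)%type.
Local Notation lam := (@lebesgue_measure R : {measure set (measurableTypeR R) -> \bar R}).
Local Notation PL := ((P \x @lebesgue_measure R)%E : {measure set (Omega * measurableTypeR R)%type -> \bar R}).
Local Notation PM := ((P \x intensity nu2)%E : {measure set (Omega * Z)%type -> \bar R}).
Local Notation c2 := (fine (second_moment nu)).
Local Notation spf s := (fun v : Omega * measurableTypeR R => sp_fun s v.2 v.1).

(** The uncurried form of [lift_process], convertible to it on [fun v => X v.2 v.1]. *)
Definition lift_fun (h : Omega * measurableTypeR R -> R) (u : Omega * Z) : R :=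
  h (u.1, u.2.1) * R0_val u.2.2.

Definition cut (K : R) (h : Omega * measurableTypeR R -> R) (v : Omega * measurableTypeR R) : R :=
  h v * \1_(`[- K, K]%classic) v.2.

Lemma second_momentE : second_moment nu = c2%:E.
Proof.
rewrite fineK// ge0_fin_numE//.
by apply: integral_ge0 => z _; rewrite lee_fin sqr_ge0.
Qed.

Lemma measurable_lift (h : Omega * measurableTypeR R -> R) :
  measurable_fun setT h -> measurable_fun setT (lift_fun h).
Proof.
move=> mh; apply: measurable_funM.
  by apply: (measurableT_comp mh); apply/measurable_fun_pair => //=; exact: measurableT_comp.
by apply: (measurableT_comp (@measurable_R0_val R)); exact: measurableT_comp.
Qed.

(** By Tonelli the variable z integrates out to m_2. The lift therefore multiplies squared norms by
    m_2, and approximations on Omega x R carry over to Omega x Z. *)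
Lemma integral_lift_sq (h : Omega * measurableTypeR R -> R) : measurable_fun setT h ->
  (\int[PM]_u (lift_fun h u ^+ 2)%:E = second_moment nu * \int[PL]_v (h v ^+ 2)%:E)%E.
Proof.
move=> mh.
have mh2 : measurable_fun setT (fun v => (h v ^+ 2)%:E).
  by apply/measurable_EFinP; exact: measurable_funX.
have ml := measurable_lift mh.
have ml2 : measurable_fun setT (fun u => (lift_fun h u ^+ 2)%:E).
  by apply/measurable_EFinP; exact: measurable_funX.
have mz : measurable_fun setT (fun z : R0 R => (R0_val z ^+ 2)%:E).
  by apply/measurable_EFinP; apply: measurable_funX; exact: measurable_R0_val.
transitivity (\int[P]_w \int[intensity nu2]_z (lift_fun h (w, z) ^+ 2)%:E)%E.
  by apply: fubini_tonelli1 => // u; rewrite lee_fin sqr_ge0.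
transitivity (\int[P]_w (second_moment nu * \int[lam]_x (h (w, x) ^+ 2)%:E))%E; last first.
  rewrite ge0_integralZl//; last 3 first.
  - apply: (measurable_fun_fubini_tonelli_F (fun v => (h v ^+ 2)%:E)) => // v.
    by rewrite lee_fin sqr_ge0.
  - by move=> w _; apply: integral_ge0 => x _; rewrite lee_fin sqr_ge0.
  - by apply: integral_ge0 => z _; rewrite lee_fin sqr_ge0.
  congr (_ * _)%E; apply/esym; apply: fubini_tonelli1 => // u; by rewrite lee_fin sqr_ge0.
apply: eq_integral => w _.
transitivity (\int[lam]_x \int[levy_measure nu2]_y (lift_fun h (w, (x, y)) ^+ 2)%:E)%E.
  apply: (fubini_tonelli1 (fun z => (lift_fun h (w, z) ^+ 2)%:E)).
    exact: measurableT_comp ml2 (measurable_pair1 _).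
  by move=> u; rewrite lee_fin sqr_ge0.
rewrite -ge0_integralZl//; last 3 first.
- exact: measurableT_comp mh2 (measurable_pair1 _).
- by move=> x _; rewrite lee_fin sqr_ge0.
- by apply: integral_ge0 => z _; rewrite lee_fin sqr_ge0.
apply: eq_integral => x _; rewrite /lift_fun/=.
under eq_integral do rewrite exprMn EFinM.
rewrite ge0_integralZl//; last 2 first.
- by move=> z _; rewrite lee_fin sqr_ge0.
- by rewrite lee_fin sqr_ge0.
by rewrite muleC.
Qed.

Lemma L2_lift (h : Omega * measurableTypeR R -> R) : L2 PL h -> L2 PM (lift_fun h).
Proof.
move=> hL; have mh := L2_measurable hL.
have [_ /integrableP[mh2 hoo]] := (L2P _ _).1 hL.
have ml := measurable_lift mh.
apply/L2P; split => //; apply/integrableP; split.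
  by apply/measurable_EFinP; exact: measurable_funX.
under eq_integral do rewrite /= ger0_norm ?sqr_ge0//.
rewrite integral_lift_sq// second_momentE -sqnE//.
by rewrite -EFinM ltry.
Qed.

Lemma sqn_lift (h : Omega * measurableTypeR R -> R) : L2 PL h ->
  sqn PM (lift_fun h) = c2 * sqn PL h.
Proof.
move=> hL; apply: EFin_inj; rewrite EFinM -second_momentE !sqnE//; last exact: L2_lift.
exact: integral_lift_sq (L2_measurable hL).
Qed.

Lemma L2_cut K (h : Omega * measurableTypeR R -> R) : L2 PL h -> L2 PL (cut K h).
Proof.
move=> hL; rewrite (_ : cut K h = fun v => \1_(`[- K, K]%classic) v.2 * h v); last first.
  by apply/funext => v; rewrite mulrC.
apply: (L2_boundedM (M := 1)) hL => [|v].
  apply: (@measurableT_comp _ _ _ _ _ _ (\1_(`[- K, K]%classic) : measurableTypeR R -> R)) => //.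
by rewrite indicE; case: (_ \in _); rewrite ?normr1 ?normr0.
Qed.

Lemma cutB K (h h' : Omega * measurableTypeR R -> R) : cut K h \- cut K h' = cut K (h \- h').
Proof. by apply/funext => v; rewrite /cut /= mulrBl. Qed.

Lemma lift_funB (h h' : Omega * measurableTypeR R -> R) :
  lift_fun h \- lift_fun h' = lift_fun (h \- h').
Proof. by apply/funext => v; rewrite /lift_fun /= mulrBl. Qed.

Lemma sqnorm_onE K (f : Omega * measurableTypeR R -> R) : L2 PL f ->
  sqnorm_on P K (fun x w => f (w, x)) = (sqn PL (cut K f))%:E.
Proof.
move=> fL; rewrite sqnE; last exact: L2_cut.
have mf2 : measurable_fun setT (fun v => (cut K f v ^+ 2)%:E).
  by apply/measurable_EFinP; apply: measurable_funX; exact: L2_measurable (L2_cut K fL).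
transitivity (\int[P]_w \int[lam]_x (cut K f (w, x) ^+ 2)%:E)%E; last first.
  by apply/esym; apply: fubini_tonelli1 => // v; rewrite lee_fin sqr_ge0.
apply: eq_integral => w _; rewrite integral_mkcond.
apply: eq_integral => x _; rewrite /cut /= patchE indicE.
case: (boolP (x \in _)) => _ /=; last by rewrite mulr0 expr0n.
by rewrite mulr1 real_normK ?num_real.
Qed.

Definition levy_kernel (A : set R) (z : Z) : R := \1_A z.1 * R0_val z.2.

Lemma L2_levy_kernel (A : set R) : measurable A -> (@lebesgue_measure R A < +oo)%E ->
  L2 (intensity nu2) (levy_kernel A).
Proof.
move=> mA Aoo; apply: (@L2_tensor _ _ _ _ _ (@lebesgue_measure R) (levy_measure nu2) (\1_A : measurableTypeR R -> R) (@R0_val R : R0 R -> R)).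
  exact: L2_indic.
apply/L2P; split; first exact: measurable_R0_val.
apply/integrableP; split.
  by apply/measurable_EFinP; apply: measurable_funX; exact: measurable_R0_val.
by under eq_integral do rewrite /= ger0_norm ?sqr_ge0//.
Qed.

Local Notation cell_kernel s i K := (levy_kernel (sp_cell s i `&` `[- K, K]%classic)).

Lemma sp_cell_cut (s : simple_process Omega R) i K :
  measurable (sp_cell s i `&` `[- K, K]%classic) /\
  (@lebesgue_measure R (sp_cell s i `&` `[(- K)%R, K]%classic) < +oo)%E.
Proof.
have mA : measurable (sp_cell s i `&` `[- K, K]%classic).
  by apply: measurableI; exact: measurable_itv.
split => //; apply: le_lt_trans (lebesgue_itvoc_lty (sp_knot s i) (sp_knot s i.+1)).
by apply: le_measure; rewrite ?inE//; exact: measurable_itv.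
Qed.

Lemma simple_ito_exists K (s : simple_process Omega R) :
  exists G, is_simple_ito P nu2 N K s G.
Proof.
have /choice[Ls LsP] i : exists L,
    is_levy_noise P nu2 N (sp_cell s i `&` `[- K, K]%classic) L.
  have [mA Aoo] := sp_cell_cut s i K.
  exact: (order1_exists Pcomplete prm (L2_levy_kernel mA Aoo)).
by exists (fun w => \sum_(i < sp_size s) sp_coef s i w * Ls i w), Ls; split.
Qed.

Lemma lift_cut_simple K (s : simple_process Omega R) :
  lift_fun (cut K (spf s)) =
  fun u => \sum_(i < sp_size s) sp_coef s i u.1 * cell_kernel s i K u.2.
Proof.
apply/funext => u; rewrite /lift_fun /cut /sp_fun /= !mulr_suml; apply: eq_bigr => i _.
by rewrite /levy_kernel indicI -!mulrA.
Qed.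

Section simple_term.
Variables (s : simple_process Omega R) (i : nat) (K : R) (L : Omega -> R).
Hypotheses (ss : is_simple P N s) (si : (i < sp_size s)%N).
Hypothesis LL : is_levy_noise P nu2 N (sp_cell s i `&` `[- K, K]%classic) L.

Lemma simple_term_L2 : L2 P (fun w => sp_coef s i w * L w).
Proof.
have [_ [M MP] mY] := ss si; have [_ LL2 _] := LL.
exact: L2_boundedM (measurable_coef Pcomplete mY) MP LL2.
Qed.

Lemma simple_term_kernel_L2 :
  L2 PM (fun u => sp_coef s i u.1 * cell_kernel s i K u.2).
Proof.
have [_ [M MP] mY] := ss si.
have [mA Aoo] := sp_cell_cut s i K.
exact: (L2_tensor (L2_bounded_coef Pcomplete mY MP) (L2_levy_kernel mA Aoo)).
Qed.

Lemma levy_kernel_past z : z.1 <= sp_knot s i ->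
  cell_kernel s i K z = 0.
Proof.
move=> zs; rewrite /levy_kernel indicI /= /sp_cell indic_itvoc ltNge zs /=.
by rewrite !mul0r.
Qed.

Lemma measurable_past (a : R) : measurable [set z : Z | z.1 <= a].
Proof.
have := @measurable_fst _ _ (measurableTypeR R) (R0 R) measurableT `]-oo, a]%classic (measurable_itv _).
by rewrite setTI; congr measurable; apply/seteqP; split => z /=; rewrite in_itv.
Qed.

Lemma simple_coef_noise : measurable_wrt (noise_on P N [set z | z.1 <= sp_knot s i]) (sp_coef s i).
Proof.
have [_ _ mY] := ss si; apply: measurable_wrt_sub mY => E /filtration_noise_on.
exact: sub_sigma_algebra.
Qed.

Lemma simple_term_mean : ip P (sp_coef s i) L = 0.
Proof.
have [_ [M MP] _] := ss si.
by apply: (cell_mean Pcomplete prm (measurable_past _) simple_coef_noise MP levy_kernel_past LL).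
Qed.

Lemma simple_term_duality n (f : n.+1.-tuple Z -> R) (J : Omega -> R) (W : Omega * Z -> R) :
  symmetric_kernel (intensity nu2) f -> is_multiple_integral P (intensity nu2) N f J -> L2 PM W ->
  {ae intensity nu2, forall z, is_multiple_integral P (intensity nu2) N
     (fun t => f (tuple_rcons (t, z))) (fun w => W (w, z))} ->
  n.+1%:R * ip PM W (fun u => sp_coef s i u.1 * cell_kernel s i K u.2) =
  ip P J (fun w => sp_coef s i w * L w).
Proof.
move=> fs fJ WL Wf; have [_ [M MP] _] := ss si.
exact: (cell_duality Pcomplete prm (measurable_past _) simple_coef_noise MP fs fJ WL Wf levy_kernel_past LL).
Qed.

Lemma simple_term_noise : measurable_wrt (noise_events P N) (fun w => sp_coef s i w * L w).
Proof.
apply: measurable_wrtM.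
  by apply: measurable_wrt_sub simple_coef_noise => E /noise_on_events; exact: sub_sigma_algebra.
have := multiple_integral_noise Pcomplete prm LL.
by apply: measurable_wrt_sub => E /noise_on_events; exact: sub_sigma_algebra.
Qed.

End simple_term.

(** The two cells may overlap. It is enough to compare their left end points: both coefficients are
    known at the later one, and the cell starting there lies in its future. *)
Lemma simple_term_isometry s i K L s' i' K' L' :
  is_simple P N s -> (i < sp_size s)%N ->
  is_levy_noise P nu2 N (sp_cell s i `&` `[- K, K]%classic) L ->
  is_simple P N s' -> (i' < sp_size s')%N ->
  is_levy_noise P nu2 N (sp_cell s' i' `&` `[- K', K']%classic) L' ->
  ip P (fun w => sp_coef s i w * L w) (fun w => sp_coef s' i' w * L' w) =
  ip PM (fun u => sp_coef s i u.1 * cell_kernel s i K u.2)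
        (fun u => sp_coef s' i' u.1 * cell_kernel s' i' K' u.2).
Proof.
move=> ss si LL ss' si' LL'.
have [_ [M MP] _] := ss _ si; have [_ [M' MP'] _] := ss' _ si'.
have [aa'|/ltW a'a] := leP (sp_knot s i) (sp_knot s' i').
  apply: (cell_isometry Pcomplete prm (measurable_past (sp_knot s' i')) _
    (simple_coef_noise ss si) MP (simple_coef_noise ss' si') MP' _ LL LL').
    by move=> z /=; move/le_trans; exact.
  by move=> z; exact: levy_kernel_past.
rewrite ipC [RHS]ipC.
apply: (cell_isometry Pcomplete prm (measurable_past (sp_knot s i)) _
  (simple_coef_noise ss' si') MP' (simple_coef_noise ss si) MP _ LL' LL).
  by move=> z /=; move/le_trans; exact.
by move=> z; exact: levy_kernel_past.
Qed.

Section simple_integral.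
Variables (s : simple_process Omega R) (K : R) (G : Omega -> R).
Hypotheses (ss : is_simple P N s) (sG : is_simple_ito P nu2 N K s G).

Lemma simple_ito_L2 : L2 P G.
Proof.
have [Ls [LsP /funext ->]] := sG.
by apply: L2_sum => i _; exact: simple_term_L2 ss (ltn_ord i) (LsP _ (ltn_ord i)).
Qed.

Lemma lift_cut_simple_L2 : L2 PM (lift_fun (cut K (spf s))).
Proof. by apply: L2_lift; apply: L2_cut; exact (L2_simple Pcomplete ss). Qed.

Lemma simple_ito_noise : measurable_wrt (noise_events P N) G.
Proof.
have [Ls [LsP /funext ->]] := sG.
apply: measurable_wrt_sum => i.
exact: simple_term_noise ss (ltn_ord i) (LsP _ (ltn_ord i)).
Qed.

Lemma simple_ito_mean : ip P (fun=> 1) G = 0.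
Proof.
have [Ls [LsP /funext ->]] := sG.
rewrite ipC ip_suml; last 2 first.
- by move=> i _; exact: simple_term_L2 ss (ltn_ord i) (LsP _ (ltn_ord i)).
- exact: L2_cst.
apply: big1 => i _; rewrite -[RHS](simple_term_mean ss (ltn_ord i) (LsP _ (ltn_ord i))).
by apply: eq_Rintegral => w _; rewrite mulr1.
Qed.

Lemma simple_ito_duality n (f : n.+1.-tuple Z -> R) (J : Omega -> R) (W : Omega * Z -> R) :
  symmetric_kernel (intensity nu2) f -> is_multiple_integral P (intensity nu2) N f J -> L2 PM W ->
  {ae intensity nu2, forall z, is_multiple_integral P (intensity nu2) N
     (fun t => f (tuple_rcons (t, z))) (fun w => W (w, z))} ->
  n.+1%:R * ip PM W (lift_fun (cut K (spf s))) = ip P J G.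
Proof.
move=> fs fJ WL Wf; have [Ls [LsP /funext ->]] := sG; have [_ JL _] := fJ.
rewrite lift_cut_simple ipC ip_suml//; last first.
  by move=> i _; exact: simple_term_kernel_L2 ss (ltn_ord i).
rewrite [RHS]ipC ip_suml//; last first.
  by move=> i _; exact: simple_term_L2 ss (ltn_ord i) (LsP _ (ltn_ord i)).
rewrite mulr_sumr; apply: eq_bigr => i _; rewrite ipC [RHS]ipC.
exact (simple_term_duality ss (ltn_ord i) (LsP _ (ltn_ord i)) fs fJ WL Wf).
Qed.

End simple_integral.

(** Polarised, with two processes and two windows, so that different approximations and different
    values of K can be compared. *)
Lemma simple_ito_isometry s K G s' K' G' :
  is_simple P N s -> is_simple_ito P nu2 N K s G ->
  is_simple P N s' -> is_simple_ito P nu2 N K' s' G' ->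
  ip P G G' = ip PM (lift_fun (cut K (spf s))) (lift_fun (cut K' (spf s'))).
Proof.
move=> ss sG ss' sG'.
have GL' := simple_ito_L2 ss' sG'.
have [Ls [LsP /funext ->]] := sG.
rewrite ip_suml//; last first.
  by move=> i _; exact: simple_term_L2 ss (ltn_ord i) (LsP _ (ltn_ord i)).
rewrite lift_cut_simple ip_suml//; last 2 first.
- by move=> i _; exact: simple_term_kernel_L2 ss (ltn_ord i).
- exact: lift_cut_simple_L2.
apply: eq_bigr => i _; have [Ls' [LsP' /funext ->]] := sG'.
rewrite ipC [RHS]ipC lift_cut_simple.
rewrite ip_suml//; last 2 first.
- by move=> j _; exact: simple_term_L2 ss' (ltn_ord j) (LsP' _ (ltn_ord j)).
- exact: simple_term_L2 ss (ltn_ord i) (LsP _ (ltn_ord i)).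
rewrite ip_suml//; last 2 first.
- by move=> j _; exact: simple_term_kernel_L2 ss' (ltn_ord j).
- exact: simple_term_kernel_L2 ss (ltn_ord i).
apply: eq_bigr => j _.
exact: simple_term_isometry ss' (ltn_ord j) (LsP' _ (ltn_ord j)) ss (ltn_ord i) (LsP _ (ltn_ord i)).
Qed.

End ito_chaos.

(** * The closed graph of the simple integral *)

Section ito_pairs.
Context d (Omega : measurableType d) (R : realType) (P : probability Omega R).
Variables (nu : {measure set (R0 R) -> \bar R}) (nu2 : (second_moment nu < +oo)%E).
Variable N : R.-ker Omega ~> (measurableTypeR R * R0 R)%type.
Hypothesis Pcomplete : measure_is_complete P.
Hypothesis prm : poisson_random_measure P (intensity nu2) N.
Local Notation Z := (measurableTypeR R * R0 R)%type.
Local Notation PM := ((P \x intensity nu2)%E : {measure set (Omega * Z)%type -> \bar R}).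
Local Notation spf s := (fun v : Omega * measurableTypeR R => sp_fun s v.2 v.1).

(** The L^2 closure of the graph of the simple integral, with integrands cut to a window and lifted
    to Omega x Z. I_K(X) and I(X) both give points of it, so each property passes to the limit only
    once. *)
Definition ito_pair (G : Omega -> R) (V : Omega * Z -> R) : Prop :=
  [/\ L2 P G, L2 PM V &
      forall e, 0 < e -> exists K s G0,
        [/\ is_simple P N s, is_simple_ito P nu2 N K s G0, sqn P (G0 \- G) <= e &
            sqn PM (lift_fun (cut K (spf s)) \- V) <= e]].

Lemma simple_ito_pair K s G : is_simple P N s -> is_simple_ito P nu2 N K s G ->
  ito_pair G (lift_fun (cut K (spf s))).
Proof.
move=> ss sG; split.
- exact (simple_ito_L2 Pcomplete ss sG).
- exact (lift_cut_simple_L2 nu2 Pcomplete K ss).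
move=> e e0; exists K, s, G; split => //.
  by rewrite sqn_diag ltW.
by rewrite sqn_diag ltW.
Qed.

Lemma ito_pair_seq G V : ito_pair G V ->
  exists (K : nat -> R) (s : nat -> simple_process Omega R) (H : nat -> Omega -> R),
  [/\ forall k, is_simple P N (s k), forall k, is_simple_ito P nu2 N (K k) (s k) (H k),
      sqn P (H k \- G) @[k --> \oo] --> 0 &
      sqn PM (lift_fun (cut (K k) (spf (s k))) \- V) @[k --> \oo] --> 0].
Proof.
move=> [GL VL app].
have /choice[t tP] k : exists t : R * simple_process Omega R * (Omega -> R),
    [/\ is_simple P N t.1.2, is_simple_ito P nu2 N t.1.1 t.1.2 t.2,
        sqn P (t.2 \- G) <= 4^-1 ^+ k & sqn PM (lift_fun (cut t.1.1 (spf t.1.2)) \- V) <= 4^-1 ^+ k].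
  have e0 : 0 < 4^-1 ^+ k :> R by rewrite exprn_gt0.
  by have [K [s [H ?]]] := app _ e0; exists (K, s, H).
exists (fun k => (t k).1.1), (fun k => (t k).1.2), (fun k => (t k).2); split.
- by move=> k; have [] := tP k.
- by move=> k; have [] := tP k.
- apply: (squeeze_cvgr _ (cvg_cst 0) (@cvg_geometric_4 R)); apply: nearW => k.
  by rewrite sqn_ge0/=; have [] := tP k.
apply: (squeeze_cvgr _ (cvg_cst 0) (@cvg_geometric_4 R)); apply: nearW => k.
by rewrite sqn_ge0/=; have [] := tP k.
Qed.

Lemma ito_pair_lim (H : nat -> Omega -> R) (U : nat -> Omega * Z -> R) G V :
  (forall k, ito_pair (H k) (U k)) -> L2 P G -> L2 PM V ->
  sqn P (H k \- G) @[k --> \oo] --> 0 -> sqn PM (U k \- V) @[k --> \oo] --> 0 ->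
  ito_pair G V.
Proof.
move=> HU GL VL HG UV; split => // e e0.
have e4 : 0 < e / 4 by rewrite divr_gt0.
move/cvgrPdist_le : HG => /(_ _ e4)[k1 _ k1P].
move/cvgrPdist_le : UV => /(_ _ e4)[k2 _ k2P].
have := k1P _ (leq_maxl k1 k2); have := k2P _ (leq_maxr k1 k2).
set k := maxn k1 k2; rewrite /= !sub0r !normrN !ger0_norm ?sqn_ge0// => Uk Hk.
have [HL UL /(_ _ e4)[K [s [G0 [ss sG0 h1 h2]]]]] := HU k.
exists K, s, G0; split => //.
  have := sqn_tri (simple_ito_L2 Pcomplete ss sG0) HL GL; lra.
have := sqn_tri (lift_cut_simple_L2 nu2 Pcomplete K ss) UL VL; lra.
Qed.

Lemma ito_pair_ip G V G' V' : ito_pair G V -> ito_pair G' V' ->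
  ip P G G' = ip PM V V'.
Proof.
move=> GV GV'; have [GL VL _] := GV; have [GL' VL' _] := GV'.
have [K [s [H [ss sH HG HV]]]] := ito_pair_seq GV.
have [K' [s' [H' [ss' sH' HG' HV']]]] := ito_pair_seq GV'.
have HL k := simple_ito_L2 Pcomplete (ss k) (sH k).
have HL' k := simple_ito_L2 Pcomplete (ss' k) (sH' k).
have UL k := lift_cut_simple_L2 nu2 Pcomplete (K k) (ss k).
have UL' k := lift_cut_simple_L2 nu2 Pcomplete (K' k) (ss' k).
have c1 : ip P (H k) (H' k) @[k --> \oo] --> ip P G G' by exact: ip_cvg.
have c3 : ip PM (lift_fun (cut (K k) (spf (s k)))) (lift_fun (cut (K' k) (spf (s' k))))
  @[k --> \oo] --> ip PM V V' by exact: ip_cvg.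
suff E : (fun k => ip P (H k) (H' k)) = (fun k => ip PM (lift_fun (cut (K k) (spf (s k))))
    (lift_fun (cut (K' k) (spf (s' k))))).
  by rewrite E in c1; exact: (cvg_unique (@norm_hausdorff R R^o) c1 c3).
by apply/funext => k; exact (simple_ito_isometry Pcomplete prm (ss k) (sH k) (ss' k) (sH' k)).
Qed.

Lemma ito_pair_sqnB G V G' V' : ito_pair G V -> ito_pair G' V' ->
  sqn P (G \- G') = sqn PM (V \- V').
Proof.
move=> GV GV'; have [GL VL _] := GV; have [GL' VL' _] := GV'.
rewrite !sqnB// (ito_pair_ip GV GV'); congr (_ - _ + _).
  exact: ito_pair_ip.
exact: ito_pair_ip.
Qed.

Lemma ito_pair_noise G V : ito_pair G V -> measurable_wrt (noise_events P N) G.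
Proof.
move=> GV; have [GL VL _] := GV; have [K [s [H [ss sH HG HV]]]] := ito_pair_seq GV.
apply: (L2_cvg_measurable_wrt (mu := P) _ (fun k => simple_ito_L2 Pcomplete (ss k) (sH k)) GL _ HG).
  by move=> E nE; right.
by move=> k; exact (simple_ito_noise Pcomplete prm (ss k) (sH k)).
Qed.

Lemma ito_pair_mean G V : ito_pair G V -> ip P (fun=> 1) G = 0.
Proof.
move=> GV; have [GL VL _] := GV; have [K [s [H [ss sH HG HV]]]] := ito_pair_seq GV.
have c : ip P (fun=> 1) (H k) @[k --> \oo] --> ip P (fun=> 1) G.
  exact: (ip_cvgr (fun k => simple_ito_L2 Pcomplete (ss k) (sH k)) GL (L2_cst P 1) HG).
rewrite (_ : (fun k => _) = fun=> 0) in c.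
  by have := cvg_unique _ c (cvg_cst 0) => ->.
by apply/funext => k; exact (simple_ito_mean Pcomplete prm (ss k) (sH k)).
Qed.

Lemma ito_pair_duality G V n (f : n.+1.-tuple Z -> R) (J : Omega -> R) (W : Omega * Z -> R) :
  ito_pair G V ->
  symmetric_kernel (intensity nu2) f -> is_multiple_integral P (intensity nu2) N f J -> L2 PM W ->
  {ae intensity nu2, forall z, is_multiple_integral P (intensity nu2) N
     (fun t => f (tuple_rcons (t, z))) (fun w => W (w, z))} ->
  n.+1%:R * ip PM W V = ip P J G.
Proof.
move=> GV fs fJ WL Wf; have [GL VL _] := GV; have [_ JL _] := fJ.
have [K [s [H [ss sH HG HV]]]] := ito_pair_seq GV.
have c : ip P J (H k) @[k --> \oo] --> ip P J G.
  exact: (ip_cvgr (fun k => simple_ito_L2 Pcomplete (ss k) (sH k)) GL JL HG).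
have c' : n.+1%:R * ip PM W (lift_fun (cut (K k) (spf (s k)))) @[k --> \oo] -->
    n.+1%:R * ip PM W V.
  apply: cvgMl_tmp.
  exact: (ip_cvgr (fun k => lift_cut_simple_L2 nu2 Pcomplete (K k) (ss k)) VL WL HV).
suff E : (fun k => ip P J (H k)) = (fun k => n.+1%:R *
    ip PM W (lift_fun (cut (K k) (spf (s k))))).
  by rewrite E in c; exact: (cvg_unique (@norm_hausdorff R R^o) c' c).
by apply/funext => k; exact (esym (simple_ito_duality Pcomplete prm (ss k) (sH k) fs fJ WL Wf)).
Qed.

(** The pairings agree exactly on partial sums: the constant term is orthogonal to the centred [G],
    and [W n] matches [J n.+1], with the factor n + 1 of the derivative supplied by the duality.
    Continuity of the inner product does the rest. *)
Lemma ito_pair_malliavin G V F U : ito_pair G V ->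
  is_malliavin P (intensity nu2) N F U -> ip PM U V = ip P F G.
Proof.
move=> GV [[FL _] [UL _] [f [W [[fs [J [fJ FJ]]] _ WP WU]]]].
have [GL VL _] := GV.
have JL n : L2 P (J n.+1) by have [] := fJ n.+1 isT.
have WL n : L2 PM (W n) by have [[]] := WP n.
pose S k u := \sum_(0 <= n < k) n.+1%:R * W n u.
have SL k : L2 PM (S k) by apply: L2_sum => n _; exact: L2Z.
pose c := fine 'E_P[F]%E.
pose T k w := c + \sum_(1 <= n < k.+1) J n w.
have TE k : T k = (fun w => c + \sum_(0 <= n < k) J n.+1 w).
  by apply/funext => w; rewrite /T big_add1.
have sumL k : L2 P (fun w => \sum_(0 <= n < k) J n.+1 w) by exact: L2_sum.
have TL k : L2 P (T k) by rewrite TE; apply: L2D (sumL k); exact: L2_cst.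
have cS : sqn PM (S k \- U) @[k --> \oo] --> 0.
  by apply/(L2_normP (mu := PM)) => [k|]; [exact: L2B|exact: WU].
have cT : sqn P (T k \- F) @[k --> \oo] --> 0.
  by apply/(L2_normP (mu := P)) => [k|]; [exact: L2B|exact: FJ].
have c1 : ip PM V (S k) @[k --> \oo] --> ip PM V U by exact: (ip_cvgr SL UL VL cS).
have c3 : ip P G (T k) @[k --> \oo] --> ip P G F by exact: (ip_cvgr TL FL GL cT).
rewrite ipC [RHS]ipC.
suff E : (fun k => ip P G (T k)) = (fun k => ip PM V (S k)).
  by rewrite E in c3; exact: (cvg_unique (@norm_hausdorff R R^o) c1 c3).
apply/funext => k; rewrite ipC [RHS]ipC TE ipDl//; last exact: L2_cst.
rewrite (_ : ip P (fun=> c) G = 0) ?add0r; last first.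
  transitivity (ip P (fun w => c * (fun=> 1) w) G).
    by apply: eq_ip => // w; rewrite mulr1.
  by rewrite ipZl// ?(ito_pair_mean GV) ?mulr0//; exact: L2_cst.
rewrite !ip_suml//; last by move=> n _; exact: L2Z.
apply: eq_bigr => n _; rewrite ipZl//.
have [_ Wf] := WP n.
by rewrite (ito_pair_duality GV (fs n.+1 isT) (fJ n.+1 isT) (WL n) Wf).
Qed.

End ito_pairs.

(** * Existence of the Ito integral and its lifted integrand *)

Section ito_integral.
Context d (Omega : measurableType d) (R : realType) (P : probability Omega R).
Variables (nu : {measure set (R0 R) -> \bar R}) (nu2 : (second_moment nu < +oo)%E).
Variable N : R.-ker Omega ~> (measurableTypeR R * R0 R)%type.
Hypothesis Pcomplete : measure_is_complete P.
Hypothesis prm : poisson_random_measure P (intensity nu2) N.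
Local Notation Z := (measurableTypeR R * R0 R)%type.
Local Notation PL := ((P \x @lebesgue_measure R)%E : {measure set (Omega * measurableTypeR R)%type -> \bar R}).
Local Notation PM := ((P \x intensity nu2)%E : {measure set (Omega * Z)%type -> \bar R}).
Local Notation c2 := (fine (second_moment nu)).
Local Notation spf s := (fun v : Omega * measurableTypeR R => sp_fun s v.2 v.1).
Local Notation pair := (ito_pair P nu2 N).

Lemma sqn_lift_cutB K (h h' : Omega * measurableTypeR R -> R) : L2 PL h -> L2 PL h' ->
  sqn PM (lift_fun (cut K h) \- lift_fun (cut K h')) = c2 * sqn PL (cut K (h \- h')).
Proof.
move=> hL hL'; rewrite lift_funB cutB sqn_lift//.
by apply: L2_cut; exact: L2B.
Qed.

Variable X : R -> Omega -> R.
Hypothesis XL2 : L2_predictable P N X.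
Local Notation x := (fun v : Omega * measurableTypeR R => X v.2 v.1).

Let xwrt : measurable_wrt (predictable_rects P N) x.
Proof. exact: predictable_rects_wrt XL2.1. Qed.

Lemma L2_integrand : L2 PL x.
Proof.
have mx : measurable_fun setT x.
  by apply: measurable_wrt_measurable xwrt; exact: predictable_rects_measurable.
have mx2 : measurable_fun setT (fun v => (x v ^+ 2)%:E).
  by apply/measurable_EFinP; exact: measurable_funX.
apply/L2P; split => //; apply/integrableP; split => //.
under eq_integral do rewrite /= ger0_norm ?sqr_ge0//.
rewrite (fubini_tonelli1 (fun v => (x v ^+ 2)%:E))//; last first.
  by move=> v; rewrite lee_fin sqr_ge0.
apply: le_lt_trans XL2.2; rewrite le_eqVlt; apply/orP; left; apply/eqP.
apply: eq_integral => w _; apply: eq_integral => y _ /=.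
by rewrite real_normK ?num_real.
Qed.

Let xL := L2_integrand.

Lemma simple_approxP (s : nat -> simple_process Omega R) : (forall k, is_simple P N (s k)) ->
  simple_approx P N X s <->
  forall K, 0 < K -> sqn PL (cut K (spf (s k) \- x)) @[k --> \oo] --> 0.
Proof.
move=> ss; have sL k : L2 PL (spf (s k)) by exact (L2_simple Pcomplete (ss k)).
have E K : (fun k => sqnorm_on P K (fun y w => sp_fun (s k) y w - X y w)) =
    (fun k => (sqn PL (cut K (spf (s k) \- x)))%:E).
  by apply/funext => k; rewrite -sqnorm_onE//; exact: L2B.
split=> [[_ h] K K0|h].
  by have := h K K0; rewrite E => /fine_cvgP[].
split => // K K0; rewrite E; apply: cvg_EFin; first exact: nearW.
exact: h.
Qed.

(** Density in L^2 of the whole of Omega x R gives a single sequence that works on all windows at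
    once. *)
Lemma simple_approx_exists : exists s, simple_approx P N X s.
Proof.
have /choice[s sP] k : exists s, is_simple P N s /\ sqn PL (spf s \- x) <= 4^-1 ^+ k.
  have e0 : 0 < 4^-1 ^+ k :> R by rewrite exprn_gt0.
  by have [_ [s ss ->] sx] := simple_dense Pcomplete xL xwrt e0; exists s.
exists s; apply/simple_approxP => [k|K K0]; first by have [] := sP k.
apply: (squeeze_cvgr _ (cvg_cst 0) (@cvg_geometric_4 R)); apply: nearW => k.
have [ss sx] := sP k; rewrite sqn_ge0/=; apply: le_trans sx.
have L := L2B (L2_simple Pcomplete ss) xL.
apply: sqn_le => // [|v]; first exact: L2_cut.
rewrite /cut normrM -[leRHS]mulr1 ler_wpM2l// indicE.
by case: (_ \in _); rewrite ?normr1 ?normr0.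
Qed.

Let lift_cut_cvg K s : 0 < K -> simple_approx P N X s ->
  sqn PM (lift_fun (cut K (spf (s k))) \- lift_fun (cut K x)) @[k --> \oo] --> 0.
Proof.
move=> K0 sx; have ss := sx.1; have := (simple_approxP ss).1 sx K K0 => h.
rewrite (_ : (fun k => _) = (fun k => c2 * sqn PL (cut K (spf (s k) \- x)))); last first.
  apply/funext => k; apply: sqn_lift_cutB xL.
  exact (L2_simple Pcomplete (ss k)).
by rewrite -[X in _ --> X](mulr0 c2); exact: cvgMl_tmp.
Qed.

Let cutL K : L2 PM (lift_fun (cut K x)).
Proof. by apply: L2_lift; exact: L2_cut xL. Qed.

(** [is_ito_on] supplies an approximating sequence and the convergence of its integrals to [J],
    which places [J] in the closed graph. *)
Lemma ito_on_pair K J : 0 < K -> is_ito_on P nu2 N K X J -> pair J (lift_fun (cut K x)).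
Proof.
move=> K0 [JL [s [H [sx sH]]] h].
have ss := sx.1.
have HL k := simple_ito_L2 Pcomplete (ss k) (sH k).
apply: (ito_pair_lim Pcomplete (fun k => simple_ito_pair Pcomplete (ss k) (sH k)) JL (cutL K)).
  by apply/(L2_normP (mu := P)) => [k|]; [exact: L2B|exact (h s H sx sH)].
exact: lift_cut_cvg.
Qed.

(** Completeness gives a limit along one approximating sequence. For any other sequence, the
    isometry equates the distance of its integrals to this limit with the distance between the
    lifted integrands, so the limit does not depend on the sequence. *)
Lemma ito_on_exists K : 0 < K -> exists J, is_ito_on P nu2 N K X J.
Proof.
move=> K0; have [s sx] := simple_approx_exists.
have ss := sx.1.
have /choice[H sH] k := simple_ito_exists Pcomplete prm K (s k).
have HP k := simple_ito_pair Pcomplete (ss k) (sH k).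
have HL k := simple_ito_L2 Pcomplete (ss k) (sH k).
have UL k := lift_cut_simple_L2 nu2 Pcomplete K (ss k).
have HH i j : sqn P (H i \- H j) <=
    sqn PM (lift_fun (cut K (spf (s i))) \- lift_fun (cut K (spf (s j)))).
  by rewrite (ito_pair_sqnB Pcomplete prm (HP i) (HP j)).
have [J JL HJ] := L2_cauchy_transfer HL UL (cutL K) HH (lift_cut_cvg K0 sx).
have Jp := ito_pair_lim Pcomplete HP JL (cutL K) HJ (lift_cut_cvg K0 sx).
exists J; split => //; first by exists s, H.
move=> s' H' sx' sH'.
have HP' k := simple_ito_pair Pcomplete (sx'.1 k) (sH' k).
have HL' k := simple_ito_L2 Pcomplete (sx'.1 k) (sH' k).
apply/(L2_normP (mu := P)) => [k|]; first exact: L2B.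
rewrite (_ : (fun k => sqn P (H' k \- J)) =
    (fun k => sqn PM (lift_fun (cut K (spf (s' k))) \- lift_fun (cut K x)))).
  exact: lift_cut_cvg.
by apply/funext => k; exact (ito_pair_sqnB Pcomplete prm (HP' k) Jp).
Qed.

Let cut_mono (K K' : R) v : K <= K' -> `|cut K' x v - x v| <= `|cut K x v - x v|.
Proof.
move=> KK'; rewrite /cut !indicE.
have [vK|vK] := boolP (v.2 \in `[- K, K]%classic).
  rewrite mem_set ?mulr1//; move: vK; rewrite inE/= !in_itv/= => /andP[h1 h2].
  by rewrite (le_trans _ h1) ?lerN2//= (le_trans h2).
by case: (_ \in _); rewrite ?mulr1 ?mulr0 ?subrr ?normr0.
Qed.

Let cut_cvg : sqn PM (lift_fun (cut k.+1%:R x) \- lift_fun x) @[k --> \oo] --> 0.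
Proof.
rewrite (_ : (fun k => _) = (fun k => c2 * sqn PL (cut k.+1%:R x \- x))); last first.
  apply/funext => k; rewrite lift_funB; apply: sqn_lift.
  by apply: (L2B _ xL); exact: L2_cut.
rewrite -[X in _ --> X](mulr0 c2); apply: cvgMl_tmp.
apply: (L2_dominated (g := x)) => // [k|k v|v]; first exact: L2_cut.
  rewrite /cut indicE; case: (_ \in _); rewrite ?mulr1 ?mulr0 ?subrr ?normr0//.
  by rewrite sub0r normrN.
apply: cvg_near_cst; exists (Num.truncn `|v.2|).+1 => // k /= vk.
rewrite /cut indicE mem_set ?mulr1//= in_itv/=.
have : `|v.2| < k.+1%:R.
  by apply: lt_le_trans (truncnS_gt _) _; rewrite ler_nat ltnW.
by rewrite ltr_norml => /andP[/ltW -> /ltW].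
Qed.

(** The limit in real K is read along K = k + 1, which is positive for every k. *)
Lemma ito_pair_of_is_ito G : is_ito P nu2 N X G -> pair G (lift_fun x).
Proof.
move=> [GL [J [JP JG]]].
have Jp k := ito_on_pair (ltr0Sn R k) (JP _ (ltr0Sn R k)).
have JL k : L2 P (J k.+1%:R) by have [] := JP _ (ltr0Sn R k).
apply: (ito_pair_lim Pcomplete Jp GL (L2_lift nu2 xL)); last exact: cut_cvg.
apply/(L2_normP (mu := P)) => [k|]; first exact: L2B.
have c : (k.+1%:R : R) @[k --> \oo] --> +oo by rewrite cvg_shiftS; exact: cvgr_idn.
exact: (cvg_comp _ _ c JG).
Qed.

(** The limit is constructed along integer windows; the isometry and the monotonicity of the cut
    extend the convergence to real K. *)
Lemma ito_exists : exists G, is_ito P nu2 N X G.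
Proof.
(* For K <= 0 the value 0 is a mere default. *)
have /choice[J JP] K : exists J, 0 < K -> is_ito_on P nu2 N K X J.
  have [K0|K0] := ltP 0 K; last by exists (fun=> 0).
  by have [J ?] := ito_on_exists K0; exists J.
have Jp K (K0 : 0 < K) := ito_on_pair K0 (JP K K0).
have JL K (K0 : 0 < K) : L2 P (J K) by have [] := JP K K0.
have JJ i j : sqn P (J i.+1%:R \- J j.+1%:R) <=
    sqn PM (lift_fun (cut i.+1%:R x) \- lift_fun (cut j.+1%:R x)).
  by rewrite (ito_pair_sqnB Pcomplete prm (Jp _ (ltr0Sn R i)) (Jp _ (ltr0Sn R j))).
have [G GL JG] := L2_cauchy_transfer (fun k => JL _ (ltr0Sn R k)) (fun k => cutL k.+1%:R)
  (L2_lift nu2 xL) JJ cut_cvg.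
have Gp := ito_pair_lim Pcomplete (fun k => Jp _ (ltr0Sn R k)) GL (L2_lift nu2 xL) JG cut_cvg.
exists G; split => //; exists J; split => //.
(* Beyond an integer window with small error, enlarging the window only decreases the error. *)
have h : sqn P (J K \- G) @[K --> +oo] --> 0.
  apply/cvgrPdist_le => e e0.
  move/cvgrPdist_le : cut_cvg => /(_ _ e0)[k _ /(_ k (leqnn k))]/=.
  rewrite sub0r normrN ger0_norm ?sqn_ge0// => kP.
  near=> K; rewrite sub0r normrN ger0_norm ?sqn_ge0//.
  have K1 : k.+1%:R <= K by near: K; exact: nbhs_pinfty_ge.
  have K0 : 0 < K by exact: lt_le_trans K1.
  rewrite (ito_pair_sqnB Pcomplete prm (Jp K K0) Gp); apply: le_trans kP.
  apply: sqn_le => [||u]; try by apply: L2B => //; exact: L2_lift.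
  rewrite /lift_fun /= -!mulrBl !normrM ler_wpM2r//; exact: cut_mono.
(* Membership of [J K] in L^2 is known for positive K, so the norm is rewritten near infinity
   only. *)
have E : \forall K \near +oo, L2_norm P (J K \- G) = (Num.sqrt (sqn P (J K \- G)))%:E.
  near=> K; apply: L2_normE; apply: L2B => //; apply: JL.
  by near: K; exact: nbhs_pinfty_gt.
apply: cvg_trans.
  by apply: near_eq_cvg; near=> K; apply/esym; near: K; exact: E.
apply: cvg_EFin; first exact: nearW.
rewrite -[X in _ --> X](@sqrtr0 R).
by apply: (continuous_cvg _ _ h); exact: sqrt_continuous.
Unshelve. all: by end_near. Qed.

(** Joint measurability is checked on predictable rectangles, whose sides in Omega belong to the
    filtration and hence to the completed sigma-field of the noise. *)
Lemma lift_noise_H : L2_noise_H P (intensity nu2) N (lift_fun x).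
Proof.
split; first exact: L2_lift xL.
pose Om := g_sigma_algebraType (noise_events P N).
have m1 : measurable_fun setT (x : (Om * measurableTypeR R)%type -> R).
  move=> _ B mB; have := xwrt measurableT mB; apply: smallest_sub => //.
    exact: sigma_algebra_measurable.
  move=> _ [A [a [b [sA ->]]]]; apply: measurableX; last exact: measurable_itv.
  move: sA; apply: sub_sigma_algebra2 => E /filtration_noise_on; exact: noise_on_events.
apply: measurable_funM.
  apply: (@measurableT_comp _ _ _ _ _ _ (x : (Om * measurableTypeR R)%type -> R) _
    (fun u : Om * Z => (u.1, u.2.1))) => //.
  by apply/measurable_fun_pair => //=; exact: measurableT_comp.
by apply: (measurableT_comp (@measurable_R0_val R)); exact: measurableT_comp.
Qed.

End ito_integral.

Lemma expected_innerE d (Omega : measurableType d) d' (Z : measurableType d') (R : realType)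
    (P : probability Omega R) (m : {sigma_finite_measure set Z -> \bar R}) (U V : Omega * Z -> R) :
  L2 (P \x m)%E U -> L2 (P \x m)%E V -> expected_inner P m U V = (ip (P \x m)%E U V)%:E.
Proof.
move=> UL VL; rewrite ipE//.
exact: (integral12_prod_meas1 (L2_integrableM UL VL)).
Qed.

Lemma expectation_ip d (Omega : measurableType d) (R : realType) (P : probability Omega R)
    (F G : Omega -> R) : L2 P F -> L2 P G -> 'E_P[fun w => (F w * G w)%R]%E = (ip P F G)%:E.
Proof. by move=> FL GL; rewrite ipE// unlock. Qed.

(** The bound that defines the domain of delta comes from Cauchy-Schwarz with the norm of one
    version of the Ito integral, so a version has to be exhibited before the domain is settled. The
    duality then identifies every version. *)
Theorem lemma4p3 (R : realType) (d : measure_display) (Omega : measurableType d)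
    (P : probability Omega R) (Pcomplete : measure_is_complete P)
    (nu : {measure set (R0 R) -> \bar R}) (nu2 : (second_moment nu < +oo)%E)
    (N : R.-ker Omega ~> (measurableTypeR R * R0 R)%type)
    (N_poisson : poisson_random_measure P (intensity nu2) N)
    (Phi : R -> Omega -> R) (Phi_L2 : L2_predictable P N Phi) :
  [/\ dom_skorohod P (intensity nu2) N (lift_process Phi),
      exists G : Omega -> R, is_ito P nu2 N Phi G &
      forall G : Omega -> R, is_ito P nu2 N Phi G ->
        is_skorohod P (intensity nu2) N (lift_process Phi) G].
Proof.
pose x := fun v : Omega * measurableTypeR R => Phi v.2 v.1.
have VH : L2_noise_H P (intensity nu2) N (lift_process Phi).
  exact (lift_noise_H nu2 Pcomplete Phi_L2).
have duality G F U : is_ito P nu2 N Phi G -> is_malliavin P (intensity nu2) N F U ->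
    [/\ L2 P F, L2 P G, ip (P \x intensity nu2)%E U (lift_process Phi) = ip P F G &
        expected_inner P (intensity nu2) U (lift_process Phi) = (ip P F G)%:E].
  move=> /(ito_pair_of_is_ito Pcomplete Phi_L2) Gp FU.
  have E := ito_pair_malliavin Pcomplete N_poisson Gp FU.
  have [[FL _] [UL _] _] := FU; have [GL _ _] := Gp.
  split => //; rewrite -E; apply: expected_innerE => //; exact: VH.1.
have [G0 G0P] := ito_exists Pcomplete N_poisson Phi_L2.
have dom : dom_skorohod P (intensity nu2) N (lift_process Phi).
  (* The constant must be positive, while the norm of [G0] may vanish. *)
  split => //; exists (Num.sqrt (sqn P G0) + 1).
    by rewrite ltr_wpDl// sqrtr_ge0.
  move=> F U _ FU; have [FL G0L _ ->] := duality _ _ _ G0P FU.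
  rewrite L2_normE// -EFinM lee_fin (le_trans (ip_le_norm FL G0L))// mulrC.
  by rewrite ler_wpM2r ?sqrtr_ge0// lerDl.
split => //; first by exists G0.
move=> G GP; have Gp := ito_pair_of_is_ito Pcomplete Phi_L2 GP.
split => //.
  by split; [have [] := Gp|exact: (ito_pair_noise Pcomplete N_poisson Gp)].
move=> F U _ FU; have [FL GL _ ->] := duality _ _ _ GP FU.
by rewrite expectation_ip.
Qed.
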